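(* Let $c_0,\delta_0>0$ and let $a\in[0,1]^{\mathbb{Z}}$ be an irreducible, aperiodic sequence. Let $\beta\in(0,1/6)$. There are $n_0,t_0\geq 0$ and $C,c\in(0,+\infty)$ such that the following holds. For any $n\geq n_0$, any independent sequence $X_1,\dots,X_n$ of random variables with laws in $\mathcal{M}_{\delta_0,c_0}^a$, any $t_0\leq t\leq n^{\beta}$, any integer $k$ with $n/3\leq k\leq 2n/3$, and any $0\leq u,v\leq\frac12t\sqrt n$ with $P_u(\bar S_n=v)>0$, $$P_u\bigl(\min_{i=1,\dots,n}\bar S_i\geq 0,\ \bar S_k\geq t\sqrt n,\ \bar S_n=v\bigr)\geq\frac{\min(u+1,\sqrt n)\min(v+1,\sqrt n)}{Ctn^{3/2}}\exp(-ct^2)$$ and $$P_u\bigl(\min_{i=1,\dots,n}\bar S_i\geq 0,\ \bar S_k\geq t\sqrt n,\ \bar S_n=v\bigr)\leq\frac{C\min(u+1,\sqrt n)\min(v+1,\sqrt n)}{tn^{3/2}}\exp(-t^2/c).$$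
   Context: Here $u,v,t$ are real. Write $\bar X_i=X_i-E(X_i)$. Under $P_u$, $\bar S_0=u$ and $\bar S_k=u+\bar X_1+\dots+\bar X_k$. $\mathcal{M}_{\mathbb{Z}}$ is the set of probability measures on $\mathbb{Z}$; $p(i)$ is the mass of $p$ at $i$. A measure $p\in\mathcal{M}_{\mathbb{Z}}$ is called irreducible (resp. aperiodic) if the random walk on $\mathbb{Z}$ with i.i.d. steps of law $p$ is an irreducible (resp. aperiodic) Markov chain. A sequence $a=(a_i)_{i\in\mathbb{Z}}\in[0,1]^{\mathbb{Z}}$ is irreducible and aperiodic if there are an irreducible and aperiodic $p\in\mathcal{M}_{\mathbb{Z}}$ and numbers $b_i>0$, $i\in\mathbb{Z}$, with $a_i=b_ip(i)$ for all $i$. For $\delta,c>0$, $$\mathcal{M}_{\delta,c}^a=\Bigl\{p\in\mathcal{M}_{\mathbb{Z}}:\ \sup_{|t|\leq\delta}\sum_{k\in\mathbb{Z}}p(k)e^{tk}\leq c,\ p(i)\geq a_i\ \forall i\in\mathbb{Z}\Bigr\}.$$ *)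

(* Defs.v *)
From HB Require Import structures.
From mathcomp Require Import all_boot all_order all_algebra.
From mathcomp Require Import all_classical all_reals all_analysis.

Set Implicit Arguments.
Unset Strict Implicit.
Unset Printing Implicit Defensive.

Import Order.TTheory GRing.Theory Num.Theory.
Import numFieldNormedType.Exports.

Local Open Scope classical_set_scope.
Local Open Scope ring_scope.

(* The integers carry the discrete sigma-algebra, so that the probability
   measures on Z are the elements of [probability int R]. *)
HB.instance Definition _ := isPointed.Build int 0.
HB.instance Definition _ := @isMeasurable.Build default_measure_display
  int discrete_measurable discrete_measurable0
  discrete_measurableC discrete_measurableU.

Section markov_chain.
Context {R : realType} {S : choiceType}.
Implicit Type Q : S -> S -> \bar R.

Fixpoint step_prob Q (n : nat) (x y : S) : \bar R :=
  (if n is m.+1 then \esum_(z in [set: S]) (Q x z * step_prob Q m z y)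
   else (x == y)%:R%:E)%E.

Definition irreducible_chain Q :=
  forall x y, exists n, (0 < step_prob Q n x y)%E.

Definition return_times Q (x : S) : set nat :=
  [set n | (0 < n)%N /\ (0 < step_prob Q n x x)%E].

Definition is_gcd (A : set nat) (d : nat) :=
  (forall n, A n -> (d %| n)%N) /\
  (forall e, (forall n, A n -> (e %| n)%N) -> (e %| d)%N).

Definition aperiodic_chain Q := forall x, is_gcd (return_times Q x) 1%N.

End markov_chain.

Section step_laws.
Context {R : realType}.

Definition walk_kernel (p : probability int R) (x y : int) : \bar R :=
  p [set y - x].

Definition irreducible_law (p : probability int R) :=
  irreducible_chain (walk_kernel p).

Definition aperiodic_law (p : probability int R) :=
  aperiodic_chain (walk_kernel p).

Definition irreducible_aperiodic_seq (a : int -> R) :=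
  exists (p : probability int R) (b : int -> R),
    [/\ irreducible_law p, aperiodic_law p, forall i, 0 < b i &
        forall i, (a i)%:E = ((b i)%:E * p [set i])%E].

Definition law_class (delta c : R) (a : int -> R) :
    set (probability int R) :=
  [set p | (ereal_sup [set \esum_(k in [set: int])
                             (p [set k] * (expR (s * k%:~R))%:E)
                      | s in [set s : R | (`|s| <= delta)%R]] <= c%:E)%E /\
           forall i, ((a i)%:E <= p [set i])%E].

End step_laws.

Definition mutually_independent (R : realType) (d d' : measure_display)
    (T : measurableType d) (T' : measurableType d') (P : probability T R)
    (I : finType) (X : I -> {RV P >-> T'}) :=
  forall (J : {set I}) (B : I -> set T'),
    (forall i, i \in J -> measurable (B i)) ->
    P (\bigcap_(i in [set` J]) (X i @^-1` B i)) =
    (\prod_(i in J) P (X i @^-1` B i))%E.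

Section centered_walk.
Context {R : realType} {d : measure_display} {T : measurableType d}
  {P : probability T R} {n : nat}.
Implicit Type X : 'I_n -> {RV P >-> int}.

Definition centered X (i : 'I_n) (w : T) : R :=
  (X i w)%:~R - fine 'E_P[fun w' => (X i w')%:~R : R].

(* [X (i - 1)] is the i-th step, since ordinals start at 0; the starting
   point [u] is a parameter of the walk rather than of the measure. *)
Definition walk X (u : R) (k : nat) (w : T) : R :=
  u + \sum_(i < n | (i < k)%N) centered X i w.

(* The minimum over i = 1, ..., n; for n > 0 the default value [walk X u n w]
   is one of the terms. *)
Definition walk_min X (u : R) (w : T) : R :=
  \big[Num.min/walk X u n w]_(1 <= i < n.+1) walk X u i w.

Definition excursion_event X (u v t : R) (k : nat) : set T :=
  [set w | [/\ 0 <= walk_min X u w,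
               t * Num.sqrt n%:R <= walk X u k w &
               walk X u n w = v]].

End centered_walk.

(* Main.v *)
Require Import Defs.
From mathcomp Require Import all_boot all_order all_algebra.
From mathcomp Require Import all_classical all_reals all_analysis.
From mathcomp Require Import measurable_realfun ring lra zify.

Set Implicit Arguments.
Unset Strict Implicit.
Unset Printing Implicit Defensive.

Import Order.TTheory GRing.Theory Num.Theory.
Import numFieldNormedType.Exports.

Local Open Scope classical_set_scope.
Local Open Scope ring_scope.

(** The proof is elementary: it works with walks whose steps have finitely
    supported laws, with constants that only depend on the exponential moment
    and on the sequence [a], and passes to general laws by approximation.

    For a finitely supported sequence of laws, [PE s F] is the expectation of
    [F] over the steps, a finite iterated sum.  What is used of the laws is
    collected in [admissible]: centred steps on a lattice, a uniform
    exponential moment, a uniform nondegeneracy, and the fact that any [m0]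
    consecutive steps charge three consecutive points of the lattice with
    weight at least [eta].  The last condition is what irreducibility and
    aperiodicity of [a] give ([charged_paths]).

    It implies local limit bounds without Fourier analysis.  Every block of
    [m0] steps contains, with weight [eta], a step of the binomial kernel
    (1/4, 1/2, 1/4), and binomial coefficients are explicit.  Hence all point
    masses are at most of order [1 / sqrt n] ([local_upper]) and at most of
    order [1 / distance] ([local_far]); and they are at least of order
    [1 / sqrt n] at distance at most [sqrt n] ([local_lower]).  Since a path
    that is killed must come back from below zero, the last bound survives the
    killing at heights of order [sqrt n] ([bridge]).  Chaining about [t ^ 2]
    such bridges, the walk crosses a distance of order [t * sqrt n] at a cost
    [exp (- C * t ^ 2)], without being killed ([crossing]).

    Near the origin, the walk killed on the negative half-line is compared with
    a corrected hyperbolic sine, which is superharmonic up to a factor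
    [1 + C * th ^ 2] ([sinh_corr_step]).  As the mean of the endpoint on
    survival is of order [u + 1], and as survival and the endpoint are
    positively associated, survival from [u] up to time [n] has probability of
    order [(u + 1) / sqrt n] ([surv_upper]), and on survival the endpoint is of
    order [sqrt n] ([surv_window]), with a Gaussian tail ([surv_high]).

    An excursion is cut into four stretches of comparable lengths, the cut in
    the centre being at time [k].  The first one leaves the origin and gives
    the factor [min (u + 1, sqrt n) / sqrt n]; the last one, read backwards,
    gives the same factor for [v]; the height at time [k] gives the exponential,
    and joining the pieces at a prescribed point gives the remaining
    [1 / sqrt n] ([excursion_upper], [excursion_lower]).

    Finally, an integer-valued law with exponential moments is replaced by the
    restriction to a large range, completed by two atoms around the barycentre
    of the removed part.  This keeps the mean, hence the centred walk; the
    approximations are admissible uniformly in the range, and the probability of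
    the excursion event is the limit of its values for the approximations
    ([prob_of_approx]). *)

(** * Iterated expectations under finitely supported laws *)

Section finite_laws.
Context {R : realType}.

(** The entries of a law are pairs (value, weight); values may be repeated. *)
Definition law := seq (R * R).

Definition Ex (p : law) (f : R -> R) : R := \sum_(a <- p) a.2 * f a.1.

Fixpoint PE (s : seq law) (F : seq R -> R) : R :=
  if s is p :: s' then Ex p (fun y => PE s' (fun ys => F (y :: ys)))
  else F [::].

Fixpoint endpt (x : R) (ys : seq R) : R :=
  if ys is y :: ys' then endpt (x + y) ys' else x.

Fixpoint surv (x : R) (ys : seq R) : bool :=
  if ys is y :: ys' then (0 <= x + y) && surv (x + y) ys' else true.

Fixpoint path_of (s : seq law) (ys : seq R) : Prop :=
  match s, ys with
  | [::], [::] => True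
  | p :: s', y :: ys' => y \in unzip1 p /\ path_of s' ys'
  | _, _ => False
  end.

Definition nonneg_law (p : law) := forall a, a \in p -> 0 <= a.2.

Definition nonneg_laws (s : seq law) := forall p, p \in s -> nonneg_law p.

Implicit Types (p : law) (s : seq law) (f g : R -> R) (F G : seq R -> R).

Lemma ExD p f g : Ex p (fun y => f y + g y) = Ex p f + Ex p g.
Proof. by rewrite /Ex -big_split; apply: eq_bigr => a _; rewrite mulrDr. Qed.

Lemma ExZ p c f : Ex p (fun y => c * f y) = c * Ex p f.
Proof. by rewrite /Ex big_distrr; apply: eq_bigr => a _; rewrite mulrCA. Qed.

Lemma ExZr p c f : Ex p (fun y => f y * c) = Ex p f * c.
Proof. by rewrite /Ex big_distrl; apply: eq_bigr => a _; rewrite mulrA. Qed.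

Lemma ExN p f : Ex p (fun y => - f y) = - Ex p f.
Proof. by rewrite /Ex -sumrN; apply: eq_bigr => a _; rewrite mulrN. Qed.

Lemma ExB p f g : Ex p (fun y => f y - g y) = Ex p f - Ex p g.
Proof. by rewrite ExD ExN. Qed.

Lemma Ex_cst p c : Ex p (fun=> c) = c * Ex p (fun=> 1).
Proof. by rewrite -ExZ; congr Ex; apply/funext => y; rewrite mulr1. Qed.

Lemma eq_Ex p f g : (forall y, f y = g y) -> Ex p f = Ex p g.
Proof. by move=> fg; congr Ex; apply/funext. Qed.

Lemma le_Ex_supp p f g : nonneg_law p ->
  (forall y, y \in unzip1 p -> f y <= g y) -> Ex p f <= Ex p g.
Proof.
move=> p0 fg; rewrite /Ex big_seq [X in _ <= X]big_seq; apply: ler_sum => a ap.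
by apply: ler_wpM2l; [exact: p0|apply: fg; exact: map_f].
Qed.

Lemma le_Ex p f g : nonneg_law p -> (forall y, f y <= g y) -> Ex p f <= Ex p g.
Proof. by move=> p0 fg; apply: le_Ex_supp. Qed.

Lemma Ex_ge0 p f : nonneg_law p -> (forall y, 0 <= f y) -> 0 <= Ex p f.
Proof.
move=> p0 f0; rewrite -[X in X <= _](mul0r (Ex p (fun=> 1))) -Ex_cst.
exact: le_Ex.
Qed.

Lemma Ex_sum p (I : Type) (r : seq I) (f : I -> R -> R) :
  Ex p (fun y => \sum_(i <- r) f i y) = \sum_(i <- r) Ex p (f i).
Proof.
rewrite /Ex exchange_big; apply: eq_bigr => a _; exact: big_distrr.
Qed.

Lemma PE_cat s1 s2 F :
  PE (s1 ++ s2) F = PE s1 (fun a => PE s2 (fun b => F (a ++ b))).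
Proof. by elim: s1 F => //= p s1 IH F; apply: eq_Ex => y; rewrite IH. Qed.

Lemma eq_PE s F G : (forall ys, F ys = G ys) -> PE s F = PE s G.
Proof. by move=> FG; congr PE; apply/funext. Qed.

Lemma PED s F G : PE s (fun ys => F ys + G ys) = PE s F + PE s G.
Proof.
elim: s F G => //= p s IH F G; rewrite -ExD; apply: eq_Ex => y; exact: IH.
Qed.

Lemma PEZ s c F : PE s (fun ys => c * F ys) = c * PE s F.
Proof.
elim: s F => //= p s IH F; rewrite -ExZ; apply: eq_Ex => y; exact: IH.
Qed.

Lemma PEZr s c F : PE s (fun ys => F ys * c) = PE s F * c.
Proof. by rewrite mulrC -PEZ; apply: eq_PE => ys; rewrite mulrC. Qed.

Lemma PEN s F : PE s (fun ys => - F ys) = - PE s F.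
Proof. by rewrite -mulN1r -PEZ; apply: eq_PE => ys; rewrite mulN1r. Qed.

Lemma PEB s F G : PE s (fun ys => F ys - G ys) = PE s F - PE s G.
Proof. by rewrite PED PEN. Qed.

Lemma le_PE_supp s F G : nonneg_laws s ->
  (forall ys, path_of s ys -> F ys <= G ys) -> PE s F <= PE s G.
Proof.
elim: s F G => /= [|p s IH] F G s0 FG; first exact: FG.
apply: le_Ex_supp => [|y yp]; first by apply: s0; rewrite mem_head.
apply: IH => [q qs|ys sys]; first by apply: s0; rewrite inE qs orbT.
exact: FG.
Qed.

Lemma le_PE s F G : nonneg_laws s ->
  (forall ys, F ys <= G ys) -> PE s F <= PE s G.
Proof. by move=> s0 FG; apply: le_PE_supp. Qed.

Lemma PE0 s : PE s (fun=> 0) = 0.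
Proof.
by rewrite -[RHS](mul0r (PE s (fun=> 1))) -PEZ; apply: eq_PE => ?; rewrite mul0r.
Qed.

Lemma PE_ge0 s F : nonneg_laws s -> (forall ys, 0 <= F ys) -> 0 <= PE s F.
Proof. by move=> s0 F0; rewrite -(PE0 s); apply: le_PE. Qed.

Lemma PE_Ex s p (F : R -> seq R -> R) :
  PE s (fun ys => Ex p (fun y => F y ys)) = Ex p (fun y => PE s (F y)).
Proof.
elim: s F => //= q s IH F; under eq_Ex do rewrite IH.
rewrite {1}/Ex; under eq_bigr do rewrite /Ex big_distrr /=.
rewrite exchange_big /=; apply: eq_bigr => a _.
by rewrite /Ex big_distrr /=; apply: eq_bigr => b _; rewrite mulrCA.
Qed.

Lemma PE_swap s1 s2 (F : seq R -> seq R -> R) :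
  PE s1 (fun a => PE s2 (F a)) = PE s2 (fun b => PE s1 (fun a => F a b)).
Proof.
elim: s1 F => //= p s1 IH F; rewrite PE_Ex; apply: eq_Ex => y.
exact: (IH (fun a b => F (y :: a) b)).
Qed.

Lemma PE_sum s (I : Type) (r : seq I) (F : I -> seq R -> R) :
  PE s (fun ys => \sum_(i <- r) F i ys) = \sum_(i <- r) PE s (F i).
Proof.
elim: s F => //= p s IH F; rewrite -Ex_sum; apply: eq_Ex => y.
exact: (IH (fun i ys => F i (y :: ys))).
Qed.

Lemma endpt_cat x ys zs : endpt x (ys ++ zs) = endpt (endpt x ys) zs.
Proof. by elim: ys x => /=. Qed.

Lemma endpt_shift c x ys : endpt (c + x) ys = c + endpt x ys.
Proof. by elim: ys x => //= y ys IH x; rewrite -addrA IH. Qed.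

Lemma endptE x ys : endpt x ys = x + endpt 0 ys.
Proof. by rewrite -endpt_shift addr0. Qed.

Lemma surv_cat x ys zs : surv x (ys ++ zs) = surv x ys && surv (endpt x ys) zs.
Proof. by elim: ys x => //= y ys IH x; rewrite IH andbA. Qed.

Lemma surv_endpt x ys : 0 <= x -> surv x ys -> 0 <= endpt x ys.
Proof. by elim: ys x => //= y ys IH x x0 /andP[xy] /(IH _ xy). Qed.

Lemma surv_le x x' ys : x <= x' -> surv x ys -> surv x' ys.
Proof.
elim: ys x x' => //= y ys IH x x' xx' /andP[xy sxy].
rewrite (le_trans xy) ?lerD2r//=; apply: IH sxy; by rewrite lerD2r.
Qed.

Lemma endpt_le x x' ys : x <= x' -> endpt x ys <= endpt x' ys.
Proof. by rewrite (endptE x) (endptE x') lerD2r. Qed.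

Lemma path_of_cat s1 s2 a b :
  path_of s1 a -> path_of s2 b -> path_of (s1 ++ s2) (a ++ b).
Proof. by elim: s1 a => [[]//|p s1 IH [//|y a]] /= [? ?] ?; split => //; exact: IH. Qed.

Lemma path_of_size s ys : path_of s ys -> size ys = size s.
Proof. by elim: s ys => [[]//|p s IH [//|y ys]] /= [_ /IH ->]. Qed.

(** ** Reversing a walk *)

Definition opp_law p : law := [seq (- a.1, a.2) | a <- p].

Definition rev_laws s : seq law := rev (map opp_law s).

Definition rev_steps (ys : seq R) : seq R := rev (map -%R ys).

Lemma Ex_opp p f : Ex (opp_law p) f = Ex p (fun y => f (- y)).
Proof. by rewrite /Ex big_map. Qed.

Lemma rev_laws_cat s1 s2 : rev_laws (s1 ++ s2) = rev_laws s2 ++ rev_laws s1.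
Proof. by rewrite /rev_laws map_cat rev_cat. Qed.

Lemma size_rev_laws s : size (rev_laws s) = size s.
Proof. by rewrite size_rev size_map. Qed.

Lemma PE_rev s F : PE (rev_laws s) F = PE s (F \o rev_steps).
Proof.
elim: s F => //= p s IH F.
rewrite /rev_laws /= rev_cons -cats1 PE_cat /=.
rewrite (PE_Ex (rev _) _ (fun y a => F (a ++ [:: y]))).
rewrite Ex_opp; apply: eq_Ex => y; rewrite -/(rev_laws s) IH.
apply: eq_PE => ys /=.
by rewrite /rev_steps /= rev_cons -cats1.
Qed.

Lemma endpt_rev x ys : endpt (endpt x ys) (rev_steps ys) = x.
Proof.
elim: ys x => //= y ys IH x.
by rewrite /rev_steps /= rev_cons -cats1 endpt_cat IH /= addrK.
Qed.

(** The walk from [x] along [ys] and its reversal from the other end visit the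
    same positions; the only difference is which end is not tested. *)
Lemma surv_rev x ys :
  (0 <= x) && surv x ys =
  (0 <= endpt x ys) && surv (endpt x ys) (rev_steps ys).
Proof.
elim: ys x => [|y ys IH] x /=; first by rewrite andbT.
rewrite IH /rev_steps /= rev_cons -cats1 surv_cat /=.
rewrite (endpt_rev (x + y)) addrK andbT.
by rewrite andbC andbA.
Qed.

End finite_laws.

(** * Elementary bounds on the exponential *)

Section exponential_bounds.
Context {R : realType}.
Implicit Types s t x : R.

Lemma expRB1_le s : expR s - 1 <= s * expR s.
Proof.
have := expR_ge1Dx (- s); have := expR_gt0 s; have := expRxMexpNx_1 s.
by move: (expR s) (expR (- s)) => a b ab a0 b1; nra.
Qed.

Lemma expR_le_quad s : expR s <= 1 + s + s ^+ 2 * expR `|s|.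
Proof.
have h := expRB1_le s; have g := expR_ge1Dx s.
have [s0|s0] := leP 0 s.
  by rewrite ger0_norm//; move: (expR s) h g => a h g; nra.
have : 1 <= expR `|s| by rewrite -expR0 ler_expR.
have : expR s <= 1 by rewrite -expR0 ler_expR ltW.
by move: (expR `|s|) (expR s) h g => b a h g a1 b1; nra.
Qed.

Lemma expR_ge_quad s : 1 + s + Num.min (s ^+ 2 / 4) 1 <= expR s.
Proof.
have [s2|s2] := leP (- 2) s.
  have -> : expR s = expR (s / 2) ^+ 2.
    by rewrite expr2 -expRD; congr expR; lra.
  have := expR_ge1Dx (s / 2); move: (expR _) => a h.
  have : Num.min (s ^+ 2 / 4) 1 <= s ^+ 2 / 4 by rewrite ge_min lexx.
  move: (Num.min _ _) => m hm; nra.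
have : Num.min (s ^+ 2 / 4) 1 <= 1 by rewrite ge_min lexx orbT.
have := expR_gt0 s; move: (Num.min _ _) (expR _) => m a; lra.
Qed.

Lemma sinh_ge t : 0 <= t -> 2 * t <= expR t - expR (- t).
Proof.
move=> t0; pose f (u : R) := expR u - expR (- u) - 2 * u.
have df (u : R) : is_derive u 1 f (expR u + expR (- u) - 2).
  rewrite /f; apply: is_derive_eq; rewrite /GRing.scale /=; ring.
suff : f 0 <= f t by rewrite /f oppr0 expR0; lra.
apply: (@ger0_derive1_ndecry _ f 0) => //.
- move=> u _; rewrite derive1E (@derive_val _ _ _ _ _ _ _ (df u)).
  have := expR_ge1Dx u; have := expR_ge1Dx (- u); lra.
- apply: continuous_subspaceT => u.
  by apply/differentiable_continuous/derivable1_diffP; case: (df u).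
Qed.

Lemma sinh_le_cosh t : 0 <= t ->
  expR t - expR (- t) <= t * (expR t + expR (- t)).
Proof.
move=> t0; pose f (u : R) := (1 + u) * expR (- u) - (1 - u) * expR u.
have df (u : R) : is_derive u 1 f (u * (expR u - expR (- u))).
  rewrite /f; apply: is_derive_eq; rewrite /GRing.scale /=; ring.
suff : f 0 <= f t by rewrite /f oppr0 expR0; lra.
apply: (@ger0_derive1_ndecry _ f 0) => //.
- move=> u; rewrite in_itv/= andbT => u0; rewrite derive1E (@derive_val _ _ _ _ _ _ _ (df u)).
  by rewrite mulr_ge0 ?(ltW u0)// subr_ge0 ler_expR; lra.
- apply: continuous_subspaceT => u.
  by apply/differentiable_continuous/derivable1_diffP; case: (df u).
Qed.

Lemma sinh_le t : 0 <= t -> expR t - expR (- t) <= 2 * t * expR t.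
Proof.
move=> t0; have := sinh_le_cosh t0.
have : expR (- t) <= expR t by rewrite ler_expR; lra.
by move: (expR t) (expR _) => a b; nra.
Qed.

Lemma sinh_ge_cube t : 0 <= t -> t ^+ 3 / 6 <= expR t - expR (- t).
Proof.
move=> t0; have := expR_ge1Dxn 2 t0.
have : expR (- t) <= 1 by rewrite -expR0 ler_expR; lra.
rewrite (_ : 3`!%:R = 6 :> R); last by rewrite /factorial.
move: (expR t) (expR _) => a b; lra.
Qed.

(** The cubic remainder matters: the linear term vanishes for a centred step. *)
Lemma sinh_taylor s : expR s - expR (- s) <= 2 * s + 4 * `|s| ^+ 3 * expR `|s|.
Proof.
have [s0|s0] := leP 0 s; last first.
  have /sinh_ge : 0 <= - s by lra.
  have : 0 <= `|s| ^+ 3 * expR `|s| by rewrite mulr_ge0 ?exprn_ge0 ?expR_ge0.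
  rewrite opprK -mulrA; lra.
rewrite -mulrA ger0_norm//; have h1 := sinh_le_cosh s0.
have h2 := expR_le_quad s; have h3 := expR_le_quad (- s).
rewrite sqrrN normrN in h3; rewrite ger0_norm// in h2 h3.
move: (expR s) (expR (- s)) h1 h2 h3 (expR_ge0 s) => a b h1 h2 h3 a0.
have : s * (a + b - 2) <= s * (2 * s ^+ 2 * a) by apply: ler_wpM2l => //; lra.
have -> : s * (2 * s ^+ 2 * a) = 2 * (s ^+ 3 * a) by ring.
have : 0 <= s ^+ 3 * a.
  by rewrite mulr_ge0 ?exprn_ge0.
lra.
Qed.

Lemma expR_ge_id t : t <= expR t.
Proof. by have := expR_ge1Dx t; lra. Qed.

End exponential_bounds.

(** * Admissible laws *)

Section admissible_laws.
Context {R : realType}.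
Implicit Types (p : @law R) (s b : seq (@law R)).

(** In [good_nondeg], the constant 1/2 is chosen because two distinct points
    of the lattice cannot both be at distance less than 1/2 from the mean; the
    condition replaces a lower bound on the variance. *)
Record good_law (d K kap : R) p : Prop := GoodLaw {
  good_nonneg : nonneg_law p;
  good_mass : Ex p (fun=> 1) = 1;
  good_mean : Ex p id = 0;
  good_exp : Ex p (fun y => expR (d * `|y|)) <= K;
  good_nondeg : kap <= Ex p (fun y => (1 / 2 <= `|y|)%R%:R);
  good_lattice : forall y y', y \in unzip1 p -> y' \in unzip1 p ->
    y - y' \is a Num.int }.

(** Aperiodicity enters only here: the sum of the steps in the block charges
    three consecutive lattice points, so that it contains a multiple of the
    binomial kernel (1/4, 1/2, 1/4).  The functional form makes the condition
    indifferent to the representation of the laws as lists. *)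
Definition three_points (eta : R) b := exists2 ys0, path_of b ys0 &
  forall (f : R -> R) x, (forall z, 0 <= f z) ->
  eta * (f (endpt x ys0 - 1) + f (endpt x ys0) + f (endpt x ys0 + 1)) <=
  PE b (fun ys => f (endpt x ys)).

Definition spreading (m0 : nat) (eta : R) s := forall s1 b s2,
  s = s1 ++ b ++ s2 -> size b = m0 -> three_points eta b.

Definition admissible (d K kap eta : R) (m0 : nat) s :=
  (forall p, p \in s -> good_law d K kap p) /\ spreading m0 eta s.

Lemma admissible_cat d K kap eta m0 s1 s2 :
  admissible d K kap eta m0 (s1 ++ s2) ->
  admissible d K kap eta m0 s1 /\ admissible d K kap eta m0 s2.
Proof.
move=> [g sp]; split; split.
- by move=> p ps; apply: g; rewrite mem_cat ps.
- by move=> t1 b t2 st; apply: (sp t1 b (t2 ++ s2)); rewrite st -!catA.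
- by move=> p ps; apply: g; rewrite mem_cat ps orbT.
- by move=> t1 b t2 st; apply: (sp (s1 ++ t1) b t2); rewrite st -!catA.
Qed.

Lemma admissible_nonneg d K kap eta m0 s :
  admissible d K kap eta m0 s -> nonneg_laws s.
Proof. by move=> [g _] p /g /good_nonneg. Qed.

End admissible_laws.

(** ** Moments of one step *)

Section one_step.
Context {R : realType} (d K kap : R) (d0 : 0 < d) (kap0 : 0 < kap).
Implicit Types (p : @law R) (th lam x : R).
Local Notation good := (good_law d K kap).

Lemma good_cst p c : good p -> Ex p (fun=> c) = c.
Proof. by move=> gp; rewrite Ex_cst (good_mass gp) mulr1. Qed.

Lemma good_affine p a c : good p -> Ex p (fun y => a + c * y) = a.
Proof.
move=> gp; rewrite ExD good_cst// ExZ.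
by rewrite (_ : Ex p (fun y => y) = 0) ?mulr0 ?addr0//; exact: good_mean gp.
Qed.

(** A pointwise bound by an affine function plus a multiple of the exponential
    weight turns into a bound of the expectation. *)
Lemma good_le_affine p (f : R -> R) a c e : good p -> 0 <= e ->
  (forall y, f y <= a + c * y + e * expR (d * `|y|)) -> Ex p f <= a + e * K.
Proof.
move=> gp e0 fle; apply: (le_trans (le_Ex (good_nonneg gp) fle)).
rewrite ExD good_affine// ExZ lerD2l; apply: ler_wpM2l => //.
exact: good_exp gp.
Qed.

Lemma good_var p : good p -> Ex p (fun y => y ^+ 2) <= 2 / d ^+ 2 * K.
Proof.
move=> gp; rewrite -[X in _ <= X]add0r; apply: (good_le_affine (c := 0)) => //.
  by rewrite divr_ge0 ?exprn_ge0// ltW.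
move=> y; rewrite mul0r !add0r.
have := @expR_ge1Dxn _ (d * `|y|) 1 (mulr_ge0 (ltW d0) (normr_ge0 _)).
rewrite exprMn real_normK ?num_real// (_ : 2`!%:R = 2) // => h.
have h2 : d ^+ 2 * y ^+ 2 <= 2 * expR (d * `|y|) by lra.
rewrite -(@ler_pM2l _ (d ^+ 2)) ?exprn_gt0//.
rewrite [X in _ <= X](_ : _ = 2 * expR (d * `|y|))//.
by field; rewrite gt_eqF.
Qed.

(** Halving the frequency leaves room for any power of the step. *)
Lemma pow_expR_half n th y : `|th| <= d / 2 ->
  (d / 2) ^+ n.+1 * `|y| ^+ n.+1 * expR `|th * y| <=
  n.+1`!%:R * expR (d * `|y|).
Proof.
move=> thd.
have -> : expR (d * `|y|) = expR (d / 2 * `|y|) * expR (d / 2 * `|y|).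
  by rewrite -expRD; congr expR; lra.
rewrite mulrA; apply: ler_pM.
- by rewrite -exprMn exprn_ge0// mulr_ge0// divr_ge0// ltW.
- exact: expR_ge0.
- have /(@expR_ge1Dxn _ _ n) : 0 <= d / 2 * `|y|.
    by rewrite mulr_ge0// divr_ge0// ltW.
  rewrite -exprMn => h.
  rewrite [leRHS]mulrC -ler_pdivrMr ?ltr0n ?fact_gt0//.
  by apply: le_trans h; rewrite lerDr.
- by rewrite ler_expR normrM; apply: ler_wpM2r.
Qed.

Definition mgf_const : R := 8 / d ^+ 2 * K.

Lemma good_mgf p th : good p -> `|th| <= d / 2 ->
  Ex p (fun y => expR (th * y)) <= 1 + mgf_const * th ^+ 2.
Proof.
move=> gp thd; rewrite /mgf_const.
have -> : 8 / d ^+ 2 * K * th ^+ 2 = (8 / d ^+ 2 * th ^+ 2) * K by ring.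
apply: (good_le_affine (c := th)) => //.
  by rewrite mulr_ge0 ?sqr_ge0// divr_ge0 ?exprn_ge0// ltW.
move=> y; apply: (le_trans (expR_le_quad _)); rewrite lerD2l exprMn.
have := @pow_expR_half 1 th y thd.
rewrite real_normK ?num_real// (_ : 2`!%:R = 2)// => h.
have d2 : 0 < d ^+ 2 by rewrite exprn_gt0.
have key : y ^+ 2 * expR `|th * y| <= 8 / d ^+ 2 * expR (d * `|y|).
  rewrite -(@ler_pM2l _ (d ^+ 2))//.
  rewrite [X in _ <= X](_ : _ = 8 * expR (d * `|y|)); last first.
    by field; rewrite gt_eqF.
  rewrite expr_div_n in h; move: h; rewrite -!mulrA; lra.
have := ler_wpM2l (sqr_ge0 th) key; rewrite -!mulrA; lra.
Qed.

Definition skew_const : R := 4 * (48 / d ^+ 3 * K).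

(** The step is centred, so that the odd part of its exponential moment starts
    at the third order. *)
Lemma good_skew p th : good p -> 0 <= th -> th <= d / 2 ->
  Ex p (fun y => expR (th * y)) - Ex p (fun y => expR (- th * y)) <=
  skew_const * th ^+ 3.
Proof.
move=> gp th0 thd; rewrite -ExB /skew_const.
have -> : 4 * (48 / d ^+ 3 * K) * th ^+ 3 = 0 + (4 * (48 / d ^+ 3) * th ^+ 3) * K.
  ring.
apply: (good_le_affine (c := 2 * th)) => //.
  by rewrite !mulr_ge0 ?invr_ge0 ?exprn_ge0// ltW.
move=> y; rewrite mulNr; apply: (le_trans (sinh_taylor _)).
rewrite mulrA add0r lerD2l normrM (ger0_norm th0) exprMn.
have := @pow_expR_half 2 th y; rewrite normrM (ger0_norm th0) => /(_ thd).
rewrite (_ : 3`!%:R = 6)// => h.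
have d3 : 0 < d ^+ 3 by rewrite exprn_gt0.
have key : `|y| ^+ 3 * expR (th * `|y|) <= 48 / d ^+ 3 * expR (d * `|y|).
  rewrite -(@ler_pM2l _ (d ^+ 3))//.
  rewrite [X in _ <= X](_ : _ = 48 * expR (d * `|y|)); last first.
    by field; rewrite gt_eqF.
  rewrite expr_div_n in h; move: h; rewrite -!mulrA; lra.
have := ler_wpM2l (exprn_ge0 3 th0) key; rewrite -!mulrA; lra.
Qed.

Definition gain_const lam : R := kap * Num.min (lam ^+ 2 / 16) 1.

Lemma gain_const_gt0 lam : lam != 0 -> 0 < gain_const lam.
Proof.
move=> lam0; rewrite mulr_gt0// lt_min ltr01 andbT divr_gt0//.
by rewrite exprn_even_gt0.
Qed.

(** Jensen's inequality is strict, quantitatively, for a nondegenerate step. *)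
Lemma good_exp_gain p lam : good p ->
  1 + gain_const lam <= Ex p (fun y => expR (lam * y)).
Proof.
move=> gp; set m := Num.min (lam ^+ 2 / 16) 1.
have m0 : 0 <= m by rewrite le_min ler01 divr_ge0 ?sqr_ge0.
apply: (@le_trans _ _ (Ex p (fun y => 1 + lam * y + m * (1 / 2 <= `|y|)%R%:R))).
  rewrite ExD good_affine// ExZ lerD2l /gain_const mulrC.
  by apply: ler_wpM2l => //; exact: good_nondeg gp.
apply: le_Ex (good_nonneg gp) _ => y.
apply: le_trans (expR_ge_quad _); rewrite lerD2l.
have n0 : 0 <= Num.min ((lam * y) ^+ 2 / 4) 1.
  by rewrite le_min ler01 divr_ge0 ?sqr_ge0.
have [hy|hy] := leP (1 / 2) `|y|; last by rewrite mulr0.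
rewrite mulr1 /m; apply: le_min2 => //.
rewrite exprMn -[y ^+ 2]real_normK ?num_real//.
have : (1 / 2) ^+ 2 <= `|y| ^+ 2.
  by rewrite ler_pXn2r// ?nnegrE//; lra.
move=> /(ler_wpM2l (sqr_ge0 lam)); rewrite expr_div_n expr1n; lra.
Qed.

Lemma good_pos_part p : good p -> kap / 4 <= Ex p (fun y => Num.max y 0).
Proof.
move=> gp.
have -> : Ex p (fun y => Num.max y 0) = Ex p (fun y => 0 + 1 / 2 * y + 1 / 2 * `|y|).
  apply: eq_Ex => y; case: (leP y 0) => y0.
    by rewrite ler0_norm//; lra.
  by rewrite gtr0_norm//; lra.
rewrite ExD good_affine// add0r ExZ.
suff : kap / 2 <= Ex p (fun y => `|y|) by lra.
apply: (@le_trans _ _ (Ex p (fun y => 1 / 2 * (1 / 2 <= `|y|)%R%:R))).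
  by rewrite ExZ; have := good_nondeg gp; lra.
apply: le_Ex (good_nonneg gp) _ => y.
have [h|_] := leP (1 / 2) `|y|; first by rewrite mulr1.
by rewrite mulr0.
Qed.

End one_step.

(** * Upper bounds for walks killed below the origin *)

Section killed_upper.
Context {R : realType} (d K kap : R).
Hypotheses (d0 : 0 < d) (kap0 : 0 < kap) (K1 : 1 <= K).
Implicit Types (p : @law R) (s : seq (@law R)) (th x u : R).
Local Notation good := (good_law d K kap).

(** The test function of the killed walk.  As long as [th * x] is small, it
    is close to [th * x]; the bounded concave term [1 - expR (- (d / 4 * x))] gains, at
    every step, more than what the jumps below the origin cost. *)
Definition sinh_corr th x : R :=
  (expR (th * x) - expR (- (th * x))) / 2 + th * (1 - expR (- (d / 4 * x))).

Lemma sinh_corr_ge th x : 0 <= th -> 0 <= x -> th * x <= sinh_corr th x.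
Proof.
move=> th0 x0; rewrite /sinh_corr -[X in X <= _]addr0; apply: lerD.
  by have := sinh_ge (mulr_ge0 th0 x0); lra.
rewrite mulr_ge0// subr_ge0 -expR0 ler_expR oppr_le0 mulr_ge0//.
by rewrite divr_ge0// ltW.
Qed.

Lemma sinh_corr_ge0 th x : 0 <= th -> 0 <= x -> 0 <= sinh_corr th x.
Proof.
by move=> th0 x0; apply: le_trans (sinh_corr_ge th0 x0); exact: mulr_ge0.
Qed.

(** The growth is more than quadratic, which later bounds the contribution of
    large endpoints to the mean of the endpoint. *)
Lemma sinh_corr_ge_cube th x : 0 <= th -> 0 <= x ->
  (th * x) ^+ 3 / 12 <= sinh_corr th x.
Proof.
move=> th0 x0; rewrite /sinh_corr -[X in X <= _]addr0; apply: lerD.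
  by have := sinh_ge_cube (mulr_ge0 th0 x0); lra.
rewrite mulr_ge0// subr_ge0 -expR0 ler_expR oppr_le0 mulr_ge0//.
by rewrite divr_ge0// ltW.
Qed.

Lemma sinh_corr_ge_exp th x : 0 <= th -> 0 <= x ->
  (expR (th * x) - 1) / 2 <= sinh_corr th x.
Proof.
move=> th0 x0; rewrite /sinh_corr -[X in X <= _]addr0; apply: lerD.
  have : expR (- (th * x)) <= 1.
    by rewrite -expR0 ler_expR oppr_le0 mulr_ge0.
  by lra.
rewrite mulr_ge0// subr_ge0 -expR0 ler_expR oppr_le0 mulr_ge0//.
by rewrite divr_ge0// ltW.
Qed.

Lemma sinh_corr_le th x : 0 <= th -> 0 <= x ->
  sinh_corr th x <= th * (x + 1) * expR (th * x).
Proof.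
move=> th0 x0; have tx0 := mulr_ge0 th0 x0.
have h1 := sinh_le tx0; rewrite /sinh_corr.
have h2 : th * (1 - expR (- (d / 4 * x))) <= th * expR (th * x).
  apply: ler_wpM2l => //.
  have : 1 <= expR (th * x) by rewrite -expR0 ler_expR.
  have := expR_ge0 (- (d / 4 * x)); lra.
rewrite mulrDr mulr1 mulrDl; lra.
Qed.

Lemma sinh_corr_neg th x : 0 <= th -> th <= d / 4 -> x <= 0 ->
  - sinh_corr th x <= th * ((1 + 4 / d) * expR (- (d * x))).
Proof.
move=> th0 thd x0; rewrite /sinh_corr.
set L := d / 4; have L0 : 0 < L by rewrite divr_gt0.
have ux : 0 <= - x by lra.
have h1 := sinh_le (mulr_ge0 th0 ux).
rewrite mulrN opprK in h1.
have e1 : expR (- (th * x)) <= expR (- (L * x)).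
  by rewrite ler_expR lerN2; apply: ler_wnM2r.
have e2 : - x <= L^-1 * expR (- (L * x)).
  rewrite -(@ler_pM2l _ L)// mulVKf ?gt_eqF// mulrN; exact: expR_ge_id.
have e3 : expR (- (L * x)) * expR (- (L * x)) <= expR (- (d * x)).
  rewrite -expRD ler_expR /L; have : 0 <= d * - x by rewrite mulr_ge0// ltW.
  by lra.
have e4 : 1 <= expR (- (L * x)).
  rewrite -expR0 ler_expR -mulrN mulr_ge0//; exact: ltW.
have -> : 4 / d = L^-1 by rewrite /L invf_div.
move: (expR (- (th * x))) (expR (- (L * x))) (expR (th * x)) (expR (- (d * x)))
  h1 e1 e2 e3 e4 (expR_ge0 (- (th * x))) (expR_ge0 (th * x)).
move=> A B D E h1 e1 e2 e3 e4 A0 D0.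
have iL : 0 <= L^-1 by rewrite invr_ge0 ltW.
have f1 : - x * A <= L^-1 * E.
  apply: (@le_trans _ _ (L^-1 * B * B)); first by apply: ler_pM.
  by rewrite -mulrA; apply: ler_wpM2l.
have f2 : B <= E by nra.
have := ler_wpM2l th0 f1; have := ler_wpM2l th0 f2.
move: h1; rewrite -!mulrA; lra.
Qed.

(** Up to the factor [1 + C * th ^+ 2], [sinh_corr th] is superharmonic for the
    killed walk away from the origin: the skewness of the step costs
    [th ^+ 3], which [th ^+ 2 * sinh (th * x)] absorbs as soon as [1 <= x]. *)
Lemma sinh_corr_step : exists x0 C : R, [/\ 1 <= x0, 0 < C &
  forall p th x, good p -> 0 < th <= d / 4 -> x0 <= x ->
  Ex p (fun y => (0 <= x + y)%R%:R * sinh_corr th (x + y)) <=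
  (1 + C * th ^+ 2) * sinh_corr th x].
Proof.
set L := d / 4; have L0 : 0 < L by rewrite divr_gt0.
set cl := gain_const kap (- L).
have cl0 : 0 < cl by apply: gain_const_gt0 => //; rewrite oppr_eq0 gt_eqF.
set C1 := (1 + 4 / d) * K.
have C10 : 0 < C1.
  rewrite mulr_gt0//; last exact: lt_le_trans K1.
  by rewrite ltr_wpDr// divr_ge0// ltW.
set x1 := C1 / (3 * L * cl).
exists (Num.max 1 x1), (mgf_const d K + skew_const d K); split.
- by rewrite le_max lexx.
- by rewrite addr_gt0// !mulr_gt0 ?invr_gt0 ?exprn_gt0//; exact: lt_le_trans K1.
move=> p th x gp /andP[th0 thd]; rewrite ge_max => /andP[x_ge1 x_gex1].
have x0 : 0 <= x by apply: le_trans x_ge1.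
set A := Ex p (fun y => expR (th * y)).
set B := Ex p (fun y => expR (- th * y)).
set G := Ex p (fun y => expR (- L * y)).
have thd2 : th <= d / 2 by move: thd d0; rewrite /L; lra.
have hA : A <= 1 + mgf_const d K * th ^+ 2.
  by apply: (good_mgf d0 gp); rewrite gtr0_norm.
have hAB : A - B <= skew_const d K * th ^+ 3.
  by apply: (good_skew d0 gp) => //; exact: ltW.
have hG : 1 + cl <= G by exact: good_exp_gain gp.
set S := (expR (th * x) - expR (- (th * x))) / 2.
set E := expR (- (L * x)).
have kill : Ex p (fun y => (0 <= x + y)%R%:R * sinh_corr th (x + y)) <=
    (expR (th * x) * A - expR (- (th * x)) * B) / 2 + th * (1 - E * G)
    + th * (C1 * expR (- (d * x))).
  apply: (@le_trans _ _ (Ex p (fun y =>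
      (expR (th * x) * expR (th * y) - expR (- (th * x)) * expR (- th * y)) * 2^-1
      + th * (1 - E * expR (- L * y))
      + th * (1 + 4 / d) * expR (- (d * x)) * expR (d * `|y|)))).
    apply: le_Ex (good_nonneg gp) _ => y.
    have -> : expR (th * x) * expR (th * y) - expR (- (th * x)) * expR (- th * y)
       = expR (th * (x + y)) - expR (- (th * (x + y))).
      by rewrite -!expRD; congr (expR _ - expR _); ring.
    have -> : E * expR (- L * y) = expR (- (d / 4 * (x + y))).
      by rewrite /E -expRD; congr expR; rewrite /L; ring.
    rewrite -/(sinh_corr th (x + y)).
    have [z0|z0] := leP 0 (x + y).
      rewrite mul1r lerDl !mulr_ge0 ?expR_ge0//; first exact: ltW.
      by rewrite addr_ge0// divr_ge0// ltW.
    rewrite mul0r; have := sinh_corr_neg (ltW th0) thd (ltW z0).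
    have : expR (- (d * (x + y))) <= expR (- (d * x)) * expR (d * `|y|).
      rewrite -expRD ler_expR mulrDr opprD lerD2l -mulrN.
      by apply: ler_wpM2l; [exact: ltW|rewrite -normrN ler_norm].
    have c0 : 0 <= th * (1 + 4 / d).
      by rewrite mulr_ge0 ?(ltW th0)// addr_ge0// divr_ge0// ltW.
    move=> /(ler_wpM2l c0); rewrite -!mulrA; lra.
  rewrite !ExD ExZr ExZ !ExB !ExZ !(good_cst _ gp) -/A -/B -/G.
  apply: lerD => //.
  have -> : th * (C1 * expR (- (d * x))) =
     th * (1 + 4 / d) * expR (- (d * x)) * K by rewrite /C1; ring.
  apply: ler_wpM2l; last exact: good_exp gp.
  rewrite !mulr_ge0 ?expR_ge0 ?(ltW th0)//.
  by rewrite addr_ge0// divr_ge0// ltW.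
have S_ge : th * x <= S.
  by have := sinh_ge (mulr_ge0 (ltW th0) x0); rewrite /S; lra.
have En1 : expR (- (th * x)) <= 1.
  by rewrite -expR0 ler_expR oppr_le0 mulr_ge0// ltW.
have E0 := expR_ge0 (- (th * x)).
have kx : C1 * expR (- (d * x)) <= E * cl.
  have -> : expR (- (d * x)) = E * expR (- (3 * L * x)).
    by rewrite /E -expRD; congr expR; rewrite /L; field.
  rewrite mulrCA; apply: ler_wpM2l; first exact: expR_ge0.
  have L3 : 0 < 3 * L by rewrite mulr_gt0.
  have : C1 <= cl * (3 * L * x).
    have : x1 * (3 * L * cl) <= x * (3 * L * cl).
      by apply: ler_wpM2r => //; rewrite ltW// mulr_gt0.
    rewrite /x1 divfK; last by rewrite gt_eqF// mulr_gt0.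
    by move=> /le_trans; apply; rewrite le_eqVlt; apply/orP; left; apply/eqP; ring.
  have : 3 * L * x * expR (- (3 * L * x)) <= 1.
    rewrite expRN ler_pdivrMr ?expR_gt0// mul1r; exact: expR_ge_id.
  have := expR_ge0 (- (3 * L * x)).
  move: (expR _) => e e0 h1 h2.
  apply: (@le_trans _ _ (cl * (3 * L * x) * e)); first exact: ler_wpM2r.
  by rewrite -mulrA -[X in _ <= X]mulr1; apply: ler_wpM2l => //; exact: ltW.
apply: (le_trans kill); rewrite /sinh_corr -/S -/L -/E.
have E0' : 0 <= E by exact: expR_ge0.
have E1' : E <= 1.
  by rewrite -expR0 ler_expR oppr_le0 mulr_ge0// ltW.
have m0 : 0 <= mgf_const d K.
  rewrite !mulr_ge0 ?invr_ge0 ?exprn_ge0 ?(ltW d0)//.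
  by apply: le_trans K1.
have s0 : 0 <= skew_const d K.
  rewrite !mulr_ge0 ?invr_ge0 ?exprn_ge0 ?(ltW d0)//.
  by apply: le_trans K1.
have main : (expR (th * x) * A - expR (- (th * x)) * B) / 2 <=
    (1 + (mgf_const d K + skew_const d K) * th ^+ 2) * S.
  have -> : (expR (th * x) * A - expR (- (th * x)) * B) / 2 =
      A * S + expR (- (th * x)) * (A - B) / 2 by rewrite /S; ring.
  have S0 : 0 <= S by apply: le_trans S_ge; rewrite mulr_ge0// ltW.
  have h1 : A * S <= (1 + mgf_const d K * th ^+ 2) * S by apply: ler_wpM2r.
  have h2 : expR (- (th * x)) * (A - B) <= skew_const d K * th ^+ 3.
    apply: (@le_trans _ _ (expR (- (th * x)) * (skew_const d K * th ^+ 3))).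
      exact: ler_wpM2l.
    rewrite -[X in _ <= X]mul1r; apply: ler_wpM2r => //.
    by rewrite mulr_ge0// exprn_ge0// ltW.
  have h3 : skew_const d K * th ^+ 3 <= skew_const d K * th ^+ 2 * S.
    rewrite exprSr mulrA; apply: ler_wpM2l; first by rewrite mulr_ge0 ?sqr_ge0//.
    apply: le_trans S_ge; rewrite -[X in X <= _]mulr1; apply: ler_wpM2l => //.
    exact: ltW.
  have h4 : 0 <= skew_const d K * th ^+ 2 * S.
    by apply: mulr_ge0 => //; apply: mulr_ge0 => //; exact: sqr_ge0.
  by lra.
have h5 : th * (1 - E * G) + th * (C1 * expR (- (d * x))) <= th * (1 - E).
  rewrite -mulrDr; apply: ler_wpM2l; first exact: ltW.
  by have : E * (1 + cl) <= E * G by [apply: ler_wpM2l]; lra.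
have h6 : th * (1 - E) <=
    (1 + (mgf_const d K + skew_const d K) * th ^+ 2) * (th * (1 - E)).
  rewrite -[X in X <= _]mul1r; apply: ler_wpM2r.
    by rewrite mulr_ge0 ?(ltW th0)// subr_ge0.
  by rewrite lerDl mulr_ge0 ?sqr_ge0// addr_ge0.
rewrite [X in _ <= X]mulrDr; lra.
Qed.

(** The shift by [x0] keeps the walk in the region where the one-step bound
    holds for as long as it survives. *)
Lemma sinh_corr_killed : exists x0 C : R, [/\ 1 <= x0, 0 < C &
  forall s th u, (forall p, p \in s -> good p) -> 0 < th <= d / 4 -> 0 <= u ->
  PE s (fun ys => (surv u ys)%:R * sinh_corr th (x0 + endpt u ys)) <=
  expR (C * th ^+ 2 * (size s)%:R) * sinh_corr th (x0 + u)].
Proof.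
have [x0 [C [x01 C0 step]]] := sinh_corr_step.
have x00 : 0 <= x0 by apply: le_trans x01.
exists x0, C; split=> // s th u gs thd; have /andP[th0 _] := thd.
elim: s u gs => [|p s IH] u gs u0 /=.
  by rewrite mulr0 expR0 !mul1r.
have gp : good p by apply: gs; rewrite mem_head.
pose e := expR (C * th ^+ 2 * (size s)%:R).
apply: (@le_trans _ _ (Ex p (fun y => (0 <= (x0 + u) + y)%R%:R *
    sinh_corr th (x0 + u + y) * e))).
  apply: le_Ex (good_nonneg gp) _ => y.
  have [uy|uy] := leP 0 (u + y); last first.
    under eq_PE do rewrite mul0r.
    rewrite PE0; have [z0|_] := leP 0 (x0 + u + y); last by rewrite !mul0r.
    by rewrite mulr_ge0 ?expR_ge0// mul1r sinh_corr_ge0// ltW.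
  rewrite -addrA (_ : 0 <= x0 + (u + y)) ?mul1r; last by rewrite addr_ge0.
  rewrite mulrC; apply: IH => // q qs.
  by apply: gs; rewrite inE qs orbT.
rewrite ExZr mulrC.
have := step p th (x0 + u) gp thd; rewrite lerDl => /(_ u0) h.
have e0 : 0 <= e by exact: expR_ge0.
apply: (le_trans (ler_wpM2l e0 h)).
rewrite mulrA; apply: ler_wpM2r; first by apply: sinh_corr_ge0; [exact: ltW|exact: addr_ge0].
have -> : C * th ^+ 2 * (size s).+1%:R = C * th ^+ 2 * (size s)%:R + C * th ^+ 2.
  by rewrite -natr1; ring.
by rewrite expRD; apply: ler_wpM2l => //; exact: expR_ge1Dx.
Qed.

(** ** Association *)

(** Chebyshev's inequality: over two independent copies of the step, the product
    of the differences of [f] and of [g] is nonnegative. *)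
Lemma Ex_assoc p (f g : R -> R) : nonneg_law p -> Ex p (fun=> 1) = 1 ->
  {homo f : x y / x <= y} -> {homo g : x y / x <= y} ->
  Ex p f * Ex p g <= Ex p (fun y => f y * g y).
Proof.
move=> p0 p1 fm gm.
have : 0 <= Ex p (fun y => Ex p (fun z => (f y - f z) * (g y - g z))).
  apply: Ex_ge0 => // y; apply: Ex_ge0 => // z.
  have [yz|zy] := leP y z.
    by rewrite mulr_le0// subr_le0; [exact: fm|exact: gm].
  by rewrite mulr_ge0// subr_ge0; [apply: fm|apply: gm]; exact: ltW.
have cst c : Ex p (fun=> c) = c by rewrite Ex_cst p1 mulr1.
rewrite (@eq_Ex _ p _ (fun y => Ex p (fun z => f z * g z) + f y * g y +
   - (f y * Ex p g) - g y * Ex p f)).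
  by rewrite ExB !ExD ExN !ExZr cst; lra.
move=> y; rewrite -(ExZ _ (f y)) -(ExZ _ (g y)) -{1}(cst (f y * g y)) -ExD -!ExB.
by apply: eq_Ex => z; ring.
Qed.

Lemma PE_survS s x x' : nonneg_laws s -> x <= x' ->
  PE s (fun ys => (surv x ys)%:R) <= PE s (fun ys => (surv x' ys)%:R).
Proof.
move=> s0 xx; apply: le_PE => // ys; rewrite ler_nat.
by have := @surv_le R x x' ys xx; case: surv => // /(_ isT) ->.
Qed.

(** Survival and the endpoint increase with every step; the induction conditions
    on the first one. *)
Lemma surv_assoc s (f : R -> R) x : (forall p, p \in s -> good p) ->
  {homo f : x y / x <= y} ->
  PE s (fun ys => (surv x ys)%:R) * PE s (fun ys => f (endpt x ys)) <=
  PE s (fun ys => (surv x ys)%:R * f (endpt x ys)).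
Proof.
move=> gs fm; elim: s x gs => [|p s IH] x gs /=; first by [].
have gp : good p by apply: gs; rewrite mem_head.
have gs' q : q \in s -> good q by move=> qs; apply: gs; rewrite inE qs orbT.
have s0 : nonneg_laws s by move=> q /gs' /good_nonneg.
have E1 y : PE s (fun ys => ((0 <= x + y) && surv (x + y) ys)%:R) =
    (0 <= x + y)%R%:R * PE s (fun ys => (surv (x + y) ys)%:R).
  by rewrite -PEZ; apply: eq_PE => ys; rewrite -natrM mulnb.
under [X in X * _]eq_Ex do rewrite E1.
apply: (@le_trans _ _ (Ex p (fun y => (0 <= x + y)%R%:R *
  PE s (fun ys => (surv (x + y) ys)%:R) * PE s (fun ys => f (endpt (x + y) ys))))).
  apply: Ex_assoc; [exact: good_nonneg gp|exact: good_mass gp| |].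
    move=> y z yz; apply: ler_pM => //.
    - exact: PE_ge0.
    - rewrite ler_nat; have [xy|//] := leP 0 (x + y).
      by rewrite (le_trans xy)// lerD2l.
    - by apply: PE_survS => //; rewrite lerD2l.
  move=> y z yz; apply: le_PE => // ys; apply: fm; apply: endpt_le.
  by rewrite lerD2l.
apply: le_Ex (good_nonneg gp) _ => y; rewrite -mulrA.
apply: (le_trans (ler_wpM2l _ (IH (x + y) gs'))) => //.
by rewrite -PEZ; apply: le_PE => // ys; rewrite -mulnb natrM mulrA.
Qed.

(** ** Exponential tails *)

Lemma PE_cst s c : (forall p, p \in s -> good p) -> PE s (fun=> c) = c.
Proof.
elim: s => //= p s IH gs; rewrite IH; last first.
  by move=> q qs; apply: gs; rewrite inE qs orbT.
by rewrite (good_cst (d := d) (K := K) (kap := kap))//; apply: gs; rewrite mem_head.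
Qed.

Lemma PE_exp_le s th x : (forall p, p \in s -> good p) -> `|th| <= d / 2 ->
  PE s (fun ys => expR (th * endpt x ys)) <=
  expR (mgf_const d K * th ^+ 2 * (size s)%:R) * expR (th * x).
Proof.
move=> gs thd; elim: s x gs => [|p s IH] x gs /=.
  by rewrite mulr0 expR0 mul1r.
have gp : good p by apply: gs; rewrite mem_head.
set e := expR (mgf_const d K * th ^+ 2 * (size s)%:R).
apply: (@le_trans _ _ (Ex p (fun y => e * expR (th * x) * expR (th * y)))).
  apply: le_Ex (good_nonneg gp) _ => y; rewrite -mulrA -expRD -mulrDr.
  by apply: IH => q qs; apply: gs; rewrite inE qs orbT.
rewrite ExZ mulrAC; apply: ler_wpM2r; first exact: expR_ge0.
have -> : mgf_const d K * th ^+ 2 * (size s).+1%:R =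
    mgf_const d K * th ^+ 2 * (size s)%:R + mgf_const d K * th ^+ 2.
  by rewrite -natr1; ring.
rewrite expRD; apply: ler_wpM2l; first exact: expR_ge0.
apply: (le_trans (good_mgf d0 gp thd)); exact: expR_ge1Dx.
Qed.

Lemma PE_chernoff s th x b : (forall p, p \in s -> good p) -> 0 <= th <= d / 2 ->
  PE s (fun ys => (b <= endpt x ys)%R%:R) <=
  expR (mgf_const d K * th ^+ 2 * (size s)%:R - th * (b - x)).
Proof.
move=> gs /andP[th0 thd].
have s0 : nonneg_laws s by move=> q /gs /good_nonneg.
apply: (@le_trans _ _ (PE s (fun ys => expR (- (th * b)) * expR (th * endpt x ys)))).
  apply: le_PE => // ys; rewrite -expRD.
  have [bx|_] := leP b (endpt x ys); last exact: expR_ge0.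
  by rewrite -expR0 ler_expR addrC subr_ge0; apply: ler_wpM2l.
rewrite PEZ mulrC; apply: (@le_trans _ _
  (expR (mgf_const d K * th ^+ 2 * (size s)%:R) * expR (th * x) * expR (- (th * b)))).
  apply: ler_wpM2r; first exact: expR_ge0.
  by apply: PE_exp_le => //; rewrite ger0_norm.
by rewrite -!expRD ler_expR; lra.
Qed.

End killed_upper.

(** * Local limit bounds *)

(** ** The binomial kernel *)

Section binomial_kernel.
Context {R : realType}.
Implicit Types (f : R -> R) (x z : R).

(** The mass at [j] of the sum of [k] steps with law (1/4, 1/2, 1/4) on -1, 0,
    1; each such step is half the sum of two signs. *)
Definition binom_mass (k j : nat) : R := 'C(k.*2, k + j)%:R / 4 ^+ k.

Lemma binom_mass_ge0 k j : 0 <= binom_mass k j.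
Proof. by rewrite divr_ge0// exprn_ge0. Qed.

Lemma binom_massS k j :
  binom_mass k.+1 j.+1 =
  binom_mass k j / 4 + binom_mass k j.+1 / 2 + binom_mass k j.+2 / 4.
Proof.
rewrite /binom_mass doubleS !addnS addSn !binS !natrD exprS.
by field; rewrite expf_neq0.
Qed.

Lemma binom_massS0 k :
  binom_mass k.+1 0 = binom_mass k 0 / 2 + binom_mass k 1 / 2.
Proof.
rewrite /binom_mass doubleS !addnS !addn0.
case: k => [|k]; first by rewrite (_ : 'C(_, 1) = 2%N)// (_ : 'C(_, 0) = 1%N)// (_ : 'C(_, 1) = 0%N)// expr1 expr0; lra.
have e : 'C(k.+1.*2, k) = 'C(k.+1.*2, k.+2).
  rewrite -bin_sub; last by rewrite -addnn; apply: leq_trans (leq_addr _ _).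
  by congr ('C(_, _)); lia.
move: (k.+1.*2) e => n e.
by rewrite !binS !natrD e exprS; field; rewrite expf_neq0.
Qed.

Lemma binom_mass_ratio k j : (j <= k)%N ->
  binom_mass k j.+1 = binom_mass k j * ((k - j)%:R / (k + j).+1%:R).
Proof.
move=> jk; rewrite /binom_mass addnS.
have := mul_bin_left k.*2 (k + j).
rewrite (_ : k.*2 - (k + j) = k - j)%N; last by lia.
move=> /(congr1 (fun m : nat => m%:R : R)); rewrite !natrM => h.
have n0 : (k + j).+1%:R != 0 :> R by rewrite pnatr_eq0.
have -> : 'C(k.*2, (k + j).+1)%:R =
    (k - j)%:R * 'C(k.*2, k + j)%:R / (k + j).+1%:R :> R.
  by rewrite -h mulrAC mulfV// mul1r.
move: (k - j)%:R 'C(_, _)%:R (k + j).+1%:R n0 => a c b b0.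
by field; rewrite b0 expf_neq0.
Qed.

Lemma binom_mass_le k j : binom_mass k j <= binom_mass k 0.
Proof.
elim: j => // j IH; have [jk|kj] := leqP j k; last first.
  rewrite {1}/binom_mass bin_small ?mul0r ?binom_mass_ge0//.
  by rewrite -addnn ltn_add2l ltnW.
apply: le_trans IH; rewrite binom_mass_ratio// -[leRHS]mulr1.
apply: ler_wpM2l; first exact: binom_mass_ge0.
rewrite ler_pdivrMr ?ltr0n// mul1r ler_nat; lia.
Qed.

Lemma binom_centralS k :
  binom_mass k.+1 0 = binom_mass k 0 * ((2 * k%:R + 1) / (2 * k%:R + 2)).
Proof.
rewrite binom_massS0 binom_mass_ratio// subn0 addn0 -natr1.
have : 0 <= k%:R :> R by [].
by move=> k0; field; lra.
Qed.

(** Wallis' product, as a monotone quantity: the left-hand side decreases. *)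
Lemma binom_central_le k : binom_mass k 0 ^+ 2 * (2 * k%:R + 1) <= 1.
Proof.
elim: k => [|k IH]; first by rewrite /binom_mass bin0; lra.
have k0 : 0 <= k%:R :> R by [].
rewrite binom_centralS -natr1 exprMn.
apply: le_trans IH; rewrite -mulrA; apply: ler_wpM2l; first exact: sqr_ge0.
rewrite expr_div_n mulrAC ler_pdivrMr; last by rewrite exprn_gt0//; lra.
nra.
Qed.

Lemma binom_central_ge k : 1 <= binom_mass k.+1 0 ^+ 2 * (4 * k.+1%:R).
Proof.
elim: k => [|k IH]; first by rewrite /binom_mass (_ : 'C(_, _) = 2%N)// expr1; lra.
have k0 : 0 <= k%:R :> R by [].
rewrite binom_centralS -!natr1 exprMn.
apply: (le_trans IH); rewrite -[leRHS]mulrA; apply: ler_wpM2l; first exact: sqr_ge0.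
rewrite -!natr1 expr_div_n mulrAC ler_pdivlMr; last by rewrite exprn_gt0//; lra.
nra.
Qed.

Definition bin_op f x : R := f (x - 1) / 4 + f x / 2 + f (x + 1) / 4.

Lemma iter_bin_op_int k z (m : int) :
  iter k bin_op (fun x => (x == z)%:R) (z + m%:~R) = binom_mass k `|m|%N.
Proof.
elim: k m => [|k IH] m /=.
  rewrite -subr_eq0 addrAC subrr add0r intr_eq0 /binom_mass add0n divr1.
  by case: m => [[|m]|m].
rewrite /bin_op.
have -> : z + m%:~R - 1 = z + (m - 1)%:~R by rewrite intrB addrA.
have -> : z + m%:~R + 1 = z + (m + 1)%:~R by rewrite intrD addrA.
rewrite !IH; case: m => [[|m]|m].
- by rewrite binom_massS0 /=; field.
- have -> : `|(Posz m.+1 - 1)%R|%N = m by lia.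
  have -> : `|(Posz m.+1 + 1)%R|%N = m.+2 by lia.
  by rewrite binom_massS.
- have -> : `|(Negz m - 1)%R|%N = m.+2 by lia.
  have -> : `|(Negz m + 1)%R|%N = m by lia.
  by rewrite (_ : `|Negz m|%N = m.+1)// binom_massS; lra.
Qed.

Lemma iter_bin_op_nint k x z : x - z \isn't a Num.int ->
  iter k bin_op (fun x => (x == z)%:R) x = 0.
Proof.
elim: k x => [|k IH] x xz /=.
  by case: eqP xz => // ->; rewrite subrr int_num0.
rewrite /bin_op !IH ?mul0r ?addr0//; apply: contra xz => h.
  by rewrite (_ : x - z = x + 1 - z - 1); [by rewrite rpredB ?int_num1|ring].
by rewrite (_ : x - z = x - 1 - z + 1); [by rewrite rpredD ?int_num1|ring].
Qed.

Lemma iter_bin_op_le k x z :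
  iter k bin_op (fun x => (x == z)%:R) x <= 2 / Num.sqrt (2 + k%:R).
Proof.
have k0 : 0 <= k%:R :> R by [].
have s0 : 0 < Num.sqrt (2 + k%:R) :> R by rewrite sqrtr_gt0; lra.
have [/intrP[m xz]|xz] := boolP (x - z \is a Num.int); last first.
  by rewrite iter_bin_op_nint// divr_ge0// ltW.
rewrite (_ : x = z + m%:~R); last by rewrite -xz; ring.
rewrite iter_bin_op_int; apply: le_trans (binom_mass_le _ _) _.
rewrite ler_pdivlMr//.
rewrite -(@ler_pXn2r _ 2)// ?nnegrE ?mulr_ge0 ?binom_mass_ge0 ?(ltW s0)//.
rewrite exprMn sqr_sqrtr; last by lra.
have := binom_central_le k; have := sqr_ge0 (binom_mass k 0); nra.
Qed.

End binomial_kernel.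

Section local_bounds.
Context {R : realType} (d K kap eta : R) (m0 : nat).
Hypotheses (d0 : 0 < d) (kap0 : 0 < kap) (K1 : 1 <= K).
Hypotheses (eta01 : 0 < eta <= 1) (m00 : (0 < m0)%N).
Implicit Types (p : @law R) (s b : seq (@law R)) (f : R -> R) (x z : R).
Local Notation good := (good_law d K kap).
Local Notation adm := (admissible d K kap eta m0).
Local Notation point z := (fun x : R => (x == z)%:R : R).

Lemma bin_op_PE s f x : bin_op (fun x => PE s (fun ys => f (endpt x ys))) x =
  PE s (fun ys => bin_op f (endpt x ys)).
Proof.
rewrite /bin_op !PED !PEZr; congr (PE s _ / _ + _ + PE s _ / _).
  by apply/funext => ys; rewrite addrC endpt_shift addrC.
by apply/funext => ys; rewrite addrC endpt_shift addrC.
Qed.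

Lemma iter_bin_op_PE k s f x :
  iter k bin_op (fun x => PE s (fun ys => f (endpt x ys))) x =
  PE s (fun ys => iter k bin_op f (endpt x ys)).
Proof.
elim: k f x => // k IH f x; rewrite iterSr.
have -> : bin_op (fun x => PE s (fun ys => f (endpt x ys))) =
    (fun x => PE s (fun ys => bin_op f (endpt x ys))).
  by apply/funext => y; rewrite bin_op_PE.
by rewrite IH; apply: eq_PE => ys; rewrite iterSr.
Qed.

(** ** Upper bound *)

(** A binomial step is won with weight [eta] only; by convexity of the inverse
    square root, on average this is worth at least [eta / 2] sure steps. *)
Lemma inv_sqrt_step t : 2 <= t ->
  eta / Num.sqrt (t + 1) + (1 - eta) / Num.sqrt t <= (Num.sqrt (t + eta / 2))^-1.
Proof.
move=> t2; have /andP[e0 e1] := eta01.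
have a0 : 0 < Num.sqrt t by rewrite sqrtr_gt0; lra.
have b0 : 0 < Num.sqrt (t + 1) by rewrite sqrtr_gt0; lra.
have c0 : 0 < Num.sqrt (t + eta / 2) by rewrite sqrtr_gt0; lra.
have a2 : Num.sqrt t ^+ 2 = t by rewrite sqr_sqrtr//; lra.
have b2 : Num.sqrt (t + 1) ^+ 2 = t + 1 by rewrite sqr_sqrtr//; lra.
have c2 : Num.sqrt (t + eta / 2) ^+ 2 = t + eta / 2 by rewrite sqr_sqrtr//; lra.
move: (Num.sqrt t) (Num.sqrt (t + 1)) (Num.sqrt (t + eta / 2)) a0 b0 c0 a2 b2 c2.
move=> a b c a0 b0 c0 a2 b2 c2.
have ac : a <= c by rewrite -(@ler_pXn2r _ 2)// ?nnegrE ?ltW//; lra.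
have ab : a <= b by rewrite -(@ler_pXn2r _ 2)// ?nnegrE ?ltW//; lra.
suff : a^-1 - c^-1 <= eta * (a^-1 - b^-1) by lra.
have ac0 : 0 < a + c by lra.
have ab0 : 0 < a + b by lra.
have -> : a^-1 - c^-1 = (c ^+ 2 - a ^+ 2) / (a * c * (a + c)).
  by field; rewrite !gt_eqF.
have -> : a^-1 - b^-1 = (b ^+ 2 - a ^+ 2) / (a * b * (a + b)).
  by field; rewrite !gt_eqF.
have -> : c ^+ 2 - a ^+ 2 = eta / 2 by lra.
have -> : b ^+ 2 - a ^+ 2 = 1 by lra.
rewrite mul1r -[leLHS]mulrA; apply: ler_wpM2l; first exact: ltW.
rewrite -invfM lef_pV2 ?posrE ?mulr_gt0//.
have h1 : a * b * (a + b) <= a * (2 * b ^+ 2).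
  by rewrite -[leLHS]mulrA; apply: ler_wpM2l; [exact: ltW|nra].
have h2 : a * (2 * a ^+ 2) <= a * c * (a + c).
  by rewrite -[leRHS]mulrA; apply: ler_wpM2l; [exact: ltW|nra].
have h3 : a * (2 * b ^+ 2) <= a * (4 * a ^+ 2).
  by apply: ler_wpM2l; [exact: ltW|lra].
lra.
Qed.

Lemma adm_cst s c : adm s -> PE s (fun=> c) = c.
Proof. by move=> [g _]; exact: PE_cst g. Qed.

(** A block is a mixture: with weight [eta] it contains a step of the binomial
    kernel, and nothing is known of the rest.  Set the binomial steps apart,
    say [k] of them, and add the blocks one at a time.  The bound [M] for the
    blocks already treated holds at every starting point, so that the
    three-point inequality, which bounds expectations of nonnegative functions
    from below, can be applied to [M] minus the probability. *)
Lemma local_upper_blocks N s k x z : adm s -> size s = (N * m0)%N ->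
  iter k bin_op (fun x => PE s (fun ys => point z (endpt x ys))) x <=
  2 / Num.sqrt (2 + k%:R + N%:R * (eta / 2)).
Proof.
have /andP[e0 e1] := eta01.
elim: N s k x => [|N IH] s k x as_ sz.
  by rewrite mul0r addr0; case: s as_ sz => //= _ _; exact: iter_bin_op_le.
have sE : s = take m0 s ++ drop m0 s by rewrite cat_take_drop.
have szt : size (take m0 s) = m0.
  by rewrite size_takel// sz mulSn leq_addr.
have szd : size (drop m0 s) = (N * m0)%N by rewrite size_drop sz mulSn addKn.
move: as_; rewrite sE; move: (take m0 s) (drop m0 s) szt szd => b s' szb szs' as_.
have [ab as'] := admissible_cat as_.
have [ys0 _ tp] := as_.2 [::] b s' erefl szb.
pose T x := PE s' (fun ys => point z (endpt x ys)).
have -> : (fun x => PE (b ++ s') (fun ys => point z (endpt x ys))) =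
    (fun x => PE b (fun ys => T (endpt x ys))).
  by apply/funext => y; rewrite PE_cat; apply: eq_PE => a; apply: eq_PE => c;
     rewrite endpt_cat.
rewrite iter_bin_op_PE.
set M := 2 / Num.sqrt (2 + k%:R + N%:R * (eta / 2)).
have TM y : iter k bin_op T y <= M by exact: IH.
have := tp (fun y => M - iter k bin_op T y) x.
move=> /(_ (fun y => ltac:(by rewrite subr_ge0))).
rewrite PEB adm_cst//.
have TM' := IH s' k.+1 (endpt x ys0) as' szs'.
have M0 := TM (endpt x ys0); have M1 := TM (endpt x ys0 - 1).
have M2 := TM (endpt x ys0 + 1).
rewrite -/T iterS {1}/bin_op in TM'.
pose t := 2 + k%:R + N%:R * (eta / 2).
have t2 : 2 <= t by rewrite /t -addrA lerDl addr_ge0// mulr_ge0// divr_ge0// ltW.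
have := inv_sqrt_step t2.
have <- : 2 + k.+1%:R + N%:R * (eta / 2) = t + 1 by rewrite /t -natr1; ring.
have <- : 2 + k%:R + N.+1%:R * (eta / 2) = t + eta / 2 by rewrite /t -natr1; ring.
rewrite -/t -/M in M0 M1 M2 *.
move: (iter k bin_op T (endpt x ys0)) (iter k bin_op T (endpt x ys0 - 1))
  (iter k bin_op T (endpt x ys0 + 1)) (PE b _) M0 M1 M2 TM'.
rewrite /M -/t; move: (Num.sqrt t)^-1 (Num.sqrt (2 + k.+1%:R + _))^-1
  (Num.sqrt (2 + k%:R + N.+1%:R * _))^-1 => i j l.
move=> a a1 a2 P M0 M1 M2 h5 h6 h7.
have h8 : eta * (a1 / 4 + a / 2 + a2 / 4) <= eta * (2 * j).
  by apply: ler_wpM2l => //; exact: ltW.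
have h9 : eta * (2 * i - (a1 / 4 + a / 2 + a2 / 4)) <=
    eta * (2 * i - a1 + (2 * i - a) + (2 * i - a2)).
  by apply: ler_wpM2l; [exact: ltW|lra].
lra.
Qed.

Lemma local_upper : exists2 C : R, 0 < C & forall s x z, adm s ->
  PE s (fun ys => point z (endpt x ys)) <= C / Num.sqrt (size s).+1%:R.
Proof.
have /andP[e0 e1] := eta01.
have m0r : 0 < m0%:R :> R by rewrite ltr0n.
pose q : R := Num.sqrt (eta / 2 / m0%:R).
have q0 : 0 < q by rewrite sqrtr_gt0 !divr_gt0.
exists (2 / q) => [|s x z as_]; first by rewrite divr_gt0.
set N := (size s %/ m0)%N; set r := (size s %% m0)%N.
have szE : size s = (r + N * m0)%N by rewrite addnC -divn_eq.
have sz1 : size (take r s) = r by rewrite size_takel// szE leq_addr.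
have sz2 : size (drop r s) = (N * m0)%N by rewrite size_drop szE addKn.
have [a1 a2] : adm (take r s) /\ adm (drop r s).
  by apply: admissible_cat; rewrite cat_take_drop.
rewrite -{1}(cat_take_drop r s) PE_cat.
apply: (@le_trans _ _ (2 / Num.sqrt (2 + 0%:R + N%:R * (eta / 2)))).
  rewrite -(adm_cst (2 / _) a1); apply: le_PE; first exact: admissible_nonneg a1.
  move=> a; under eq_PE do rewrite endpt_cat.
  exact: (@local_upper_blocks N _ 0 _ z a2 sz2).
have s0 : 0 < Num.sqrt (2 + 0%:R + N%:R * (eta / 2)) :> R.
  by rewrite sqrtr_gt0 addr0 ltr_wpDr// mulr_ge0// divr_ge0// ltW.
rewrite -mulrA ler_pM2l// -invfM lef_pV2 ?posrE ?mulr_gt0//.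
rewrite -sqrtrM; last by rewrite !divr_ge0// ltW.
rewrite ler_sqrt; last by rewrite addr0 ltW// ltr_wpDr// mulr_ge0// divr_ge0// ltW.
have : ((size s).+1 <= N.+1 * m0)%N.
  by rewrite szE mulSn -addSn leq_add2r ltn_pmod.
rewrite -(@ler_nat R) natrM => h.
have e2 : 0 <= eta / 2 / m0%:R by rewrite !divr_ge0// ltW.
apply: (le_trans (ler_wpM2l e2 h)).
have -> : eta / 2 / m0%:R * (N.+1%:R * m0%:R) = eta / 2 * N.+1%:R.
  by field; rewrite gt_eqF.
have <- : N%:R + 1 = N.+1%:R :> R by rewrite natr1.
rewrite addr0; lra.
Qed.

(** ** Decay away from the starting point *)

Definition var_const : R := 2 / d ^+ 2 * K.

Lemma var_const_ge0 : 0 <= var_const.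
Proof.
by rewrite mulr_ge0 ?divr_ge0 ?exprn_ge0 ?(ltW d0)//; apply: le_trans K1.
Qed.

Lemma PE_quad_le s x z : (forall p, p \in s -> good p) ->
  PE s (fun ys => (endpt x ys - z) ^+ 2) <=
  (x - z) ^+ 2 + var_const * (size s)%:R.
Proof.
elim: s x => [|p s IH] x gs /=; first by rewrite mulr0 addr0.
have gp : good p by apply: gs; rewrite mem_head.
apply: (@le_trans _ _ (Ex p (fun y =>
    ((x - z) ^+ 2 + var_const * (size s)%:R) + 2 * (x - z) * y + y ^+ 2))).
  apply: le_Ex (good_nonneg gp) _ => y.
  apply: le_trans (IH (x + y) _) _; last by rewrite !expr2; lra.
  by move=> q qs; apply: gs; rewrite inE qs orbT.
rewrite ExD (good_affine _ _ gp).
have := good_var d0 gp; rewrite -/var_const.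
have <- : (size s)%:R + 1 = (size s).+1%:R :> R by rewrite natr1.
rewrite mulrDr; lra.
Qed.

Lemma div_sqrt_le (a n m : nat) : (a <= n.+1)%N -> (n <= m)%N ->
  a%:R / Num.sqrt n.+1%:R <= Num.sqrt m.+1%:R :> R.
Proof.
move=> an nm; rewrite ler_pdivrMr ?sqrtr_gt0 ?ltr0n// -sqrtrM//.
apply: (@le_trans _ _ (Num.sqrt (a%:R ^+ 2))).
  by rewrite sqrtr_sqr ler_norm.
rewrite ler_wsqrtr// expr2; apply: ler_pM; rewrite ?ler_nat//.
by apply: leq_trans an _.
Qed.

(** The square of the displacement, split over the two halves of the walk,
    is averaged on one half while the other half pays for hitting a point. *)
Lemma local_far : exists2 C : R, 0 < C & forall s x z, adm s -> x != z ->
  PE s (fun ys => point z (endpt x ys)) <= C / `|z - x|.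
Proof.
have [C1 C10 up] := local_upper.
have v0 := var_const_ge0; have C10' := ltW C10.
have vC : 0 <= 2 * var_const * C1.
  by apply: mulr_ge0 => //; apply: mulr_ge0.
exists (2 * C1 * (var_const + 1)) => [|s x z as_ xz].
  by rewrite !mulr_gt0//; lra.
set P := PE s _; set D := z - x.
have sn := admissible_nonneg as_.
have D0 : 0 < `|D| by rewrite normr_gt0 subr_eq0 eq_sym.
have P0 : 0 <= P by apply: PE_ge0.
set n1 := (size s)./2; set n2 := (size s - n1)%N.
have [l1 l2] : (n1 <= n2.+1)%N /\ (n2 <= n1.+1)%N.
  by rewrite /n2 /n1; clear; lia.
have [l3 l4] : (n1 <= size s)%N /\ (n2 <= size s)%N.
  by rewrite /n2 /n1; clear; lia.
have sz1 : size (take n1 s) = n1 by rewrite size_takel.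
have sz2 : size (drop n1 s) = n2 by rewrite size_drop.
have [a1 a2] : adm (take n1 s) /\ adm (drop n1 s).
  by apply: admissible_cat; rewrite cat_take_drop.
have s1n := admissible_nonneg a1; have s2n := admissible_nonneg a2.
pose r : R := Num.sqrt (size s).+1%:R.
have r0 : 0 < r by rewrite sqrtr_gt0 ltr0n.
(* [D ^+ 2 <= 2 * A ^+ 2 + 2 * B ^+ 2], where [A] and [B] are the displacements
   over the two halves of the walk. *)
have main : D ^+ 2 * P <= 4 * var_const * C1 * r.
  rewrite /P -{1}(cat_take_drop n1 s) PE_cat -PEZ.
  under eq_PE do rewrite -PEZ.
  apply: (@le_trans _ _ (PE (take n1 s) (fun a => PE (drop n1 s) (fun c =>
     2 * (endpt 0 a - 0) ^+ 2 * point z (endpt (endpt x a) c) +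
     2 * (endpt 0 c - 0) ^+ 2 * point (z - endpt 0 c) (endpt x a))))).
    apply: le_PE => // a; apply: le_PE => // c; rewrite endpt_cat.
    have -> : (endpt x a == z - endpt 0 c) = (endpt (endpt x a) c == z).
      by rewrite (endptE (endpt x a) c) eq_sym subr_eq eq_sym.
    case: eqP => [e|_]; last by rewrite !mulr0 addr0.
    rewrite !mulr1 !subr0 /D -e (endptE (endpt x a)) (endptE x a).
    by have := sqr_ge0 (endpt 0 a - endpt 0 c); rewrite !expr2; lra.
  under eq_PE do rewrite PED.
  rewrite PED.
  have half t t' (F : seq R -> seq R -> R) : adm t -> adm t' ->
      (forall a, PE t' (F a) <= C1 / Num.sqrt (size t').+1%:R) ->
      (size t <= (size t').+1)%N -> (size t' <= size s)%N ->
      PE t (fun a => PE t' (fun c => 2 * (endpt 0 a - 0) ^+ 2 * F a c)) <=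
      2 * var_const * C1 * r.
    move=> at_ at' hF st st'.
    have e0 : 0 <= C1 / Num.sqrt (size t').+1%:R by rewrite divr_ge0// ltW.
    apply: (@le_trans _ _ (PE t (fun a =>
        (endpt 0 a - 0) ^+ 2 * (2 * (C1 / Num.sqrt (size t').+1%:R))))).
      apply: le_PE; first exact: admissible_nonneg at_.
      move=> a; rewrite PEZ (mulrC 2) -mulrA; apply: ler_wpM2l; first exact: sqr_ge0.
      by apply: ler_wpM2l.
    rewrite PEZr.
    have := PE_quad_le 0 0 at_.1; rewrite subrr expr0n add0r => hq.
    have c0 : 0 <= 2 * (C1 / Num.sqrt (size t').+1%:R) by exact: mulr_ge0.
    apply: (le_trans (ler_wpM2r c0 hq)).
    rewrite [leLHS](_ : _ = 2 * var_const * C1 *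
        ((size t)%:R / Num.sqrt (size t').+1%:R)); last by ring.
    by apply: ler_wpM2l => //; exact: div_sqrt_le.
  have h1 := half (take n1 s) (drop n1 s) (fun a c => point z (endpt (endpt x a) c))
    a1 a2 (fun a => up _ _ _ a2).
  rewrite sz1 sz2 in h1; have {}h1 := h1 l1 l4.
  have h2 := half (drop n1 s) (take n1 s) (fun c a => point (z - endpt 0 c) (endpt x a))
    a2 a1 (fun c => up _ _ _ a1).
  rewrite sz1 sz2 in h2; have {}h2 := h2 l2 l3.
  rewrite [X in _ + X <= _]PE_swap.
  by apply: (le_trans (lerD h1 h2)); lra.
have Pup : P * r <= C1 by rewrite -ler_pdivlMr//; exact: up.
rewrite ler_pdivlMr// mulrC.
have c0 : 0 <= 2 * C1 * (var_const + 1) by rewrite !mulr_ge0// ?ltW//; lra.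
rewrite -(@ler_pXn2r _ 2)// ?nnegrE ?mulr_ge0//.
rewrite exprMn real_normK ?num_real//.
apply: (@le_trans _ _ (4 * var_const * C1 ^+ 2)).
  rewrite expr2 mulrA.
  apply: (@le_trans _ _ (4 * var_const * C1 * r * P)); first exact: ler_wpM2r.
  have := ler_wpM2l vC Pup; rewrite expr2; lra.
rewrite !exprMn.
have : 0 <= C1 ^+ 2 * (var_const ^+ 2 + var_const + 1).
  by rewrite mulr_ge0 ?sqr_ge0// !addr_ge0// sqr_ge0.
rewrite sqrrD expr1n; lra.
Qed.

End local_bounds.

(** ** Lower bound *)

Section binomial_lower.
Context {R : realType}.

Lemma sqrt_nat_ge (y : R) :
  exists n0 : nat, forall n, (n0 <= n)%N -> y <= Num.sqrt n%:R.
Proof.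
exists (Num.truncn (y ^+ 2)).+1 => n nn.
apply: (le_trans (ler_norm y)); rewrite -sqrtr_sqr; apply: ler_wsqrtr.
rewrite ltW// -truncn_lt_nat ?sqr_ge0//.
Qed.

(** Off the centre, the ratios of consecutive binomial masses are at least
    [1 - O(n ^ (-1/2))] over a range of [O(n ^ (1/2))] sites. *)
Lemma binom_mass_lower (q : nat) (D : R) : (0 < q)%N -> 1 <= D ->
  exists c : R, exists2 n0 : nat, 0 < c & forall n k j : nat, (n0 <= n)%N ->
  (n %/ q <= k <= n)%N -> j%:R <= D * Num.sqrt n%:R ->
  c / Num.sqrt n%:R <= binom_mass k j.
Proof.
move=> q0 D1.
have qr0 : 0 < q%:R :> R by rewrite ltr0n.
have [n1 hn1] := sqrt_nat_ge (8 * q%:R * D).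
exists (expR (- (8 * q%:R * D ^+ 2)) / 2), (maxn n1 (2 * q)).
  by rewrite divr_gt0// expR_gt0.
move=> n k j; rewrite geq_max => /andP[/hn1 hn nq] /andP[nk kn] jD.
set rn := Num.sqrt n%:R in hn jD *.
have n0 : (0 < n)%N by apply: leq_trans nq; rewrite muln_gt0.
have rn0 : 0 < rn by rewrite sqrtr_gt0 ltr0n.
have rn2 : rn ^+ 2 = n%:R by rewrite sqr_sqrtr.
have k1 : (0 < k)%N.
  apply: leq_trans nk; rewrite divn_gt0//; apply: leq_trans nq; exact: leq_pmull.
have kr0 : 0 < k%:R :> R by rewrite ltr0n.
have nqk : rn ^+ 2 <= 2 * q%:R * k%:R.
  rewrite rn2 -!natrM ler_nat.
  apply: (leq_trans (ltnW (ltn_ceil n q0))).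
  rewrite (mulnC 2) -mulnA mulnC leq_mul2l; apply/orP; right.
  by rewrite mul2n -addnn -addn1 leq_add.
set J := D * rn; set s := 2 * J / k%:R.
have J0 : 0 < J by rewrite mulr_gt0//; lra.
have s0 : 0 <= s by apply: divr_ge0 => //; apply: mulr_ge0 => //; exact: ltW.
have sr : s * rn <= 4 * q%:R * D.
  rewrite /s /J mulrAC ler_pdivrMr//.
  have -> : 2 * (D * rn) * rn = 2 * D * rn ^+ 2 by ring.
  have -> : 4 * q%:R * D * k%:R = 2 * D * (2 * q%:R * k%:R) by ring.
  by apply: ler_wpM2l => //; lra.
have s12 : s <= 1 / 2.
  rewrite -(@ler_pM2r _ rn)//; lra.
have step i : i.+1%:R <= J ->
    binom_mass k i * expR (- (2 * s)) <= binom_mass k i.+1 :> R.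
  move=> iJ.
  have Jk : J <= k%:R.
    by move: s12; rewrite /s ler_pdivrMr//; lra.
  have ik : (i < k)%N by rewrite -(@ler_nat R); exact: le_trans Jk.
  rewrite [leRHS](binom_mass_ratio (ltnW ik)); apply: ler_wpM2l; first exact: binom_mass_ge0.
  apply: (@le_trans _ _ (1 - s)).
    rewrite expRN; apply: (@le_trans _ _ (1 + 2 * s)^-1).
      rewrite lef_pV2 ?posrE ?expR_gt0//; [exact: expR_ge1Dx|lra].
    rewrite -[leLHS]mul1r ler_pdivrMr; last by lra.
    nra.
  rewrite ler_pdivlMr ?ltr0n// (natrB _ (ltnW ik)).
  have -> : (k + i).+1%:R = k%:R + i%:R + 1 :> R by rewrite -natr1 natrD.
  have sk : s * k%:R = 2 * J by rewrite /s divfK// gt_eqF.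
  have i0 : 0 <= i%:R :> R by [].
  have : i%:R + 1 <= J by rewrite natr1.
  have : 0 <= s * (i%:R + 1) by rewrite mulr_ge0// addr_ge0.
  have -> : (1 - s) * (k%:R + i%:R + 1) =
    k%:R + i%:R + 1 - s * k%:R - s * (i%:R + 1) by ring.
  rewrite sk; lra.
have off i : i%:R <= J ->
    binom_mass k 0 * expR (- (2 * s * i%:R)) <= binom_mass k i :> R.
  elim: i => [|i IH] iJ; first by rewrite mulr0 oppr0 expR0 mulr1.
  apply: le_trans (step i iJ).
  have -> : - (2 * s * i.+1%:R) = - (2 * s * i%:R) + - (2 * s).
    by rewrite -natr1; ring.
  rewrite expRD mulrA; apply: ler_wpM2r; first exact: expR_ge0.
  by apply: IH; apply: le_trans iJ; rewrite ler_nat.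
apply: le_trans (off j jD).
rewrite -mulrA -invfM [leRHS]mulrC.
have ke : expR (- (8 * q%:R * D ^+ 2)) <= expR (- (2 * s * j%:R)).
  rewrite ler_expR lerN2; apply: (@le_trans _ _ (2 * s * J)).
    by apply: ler_wpM2l => //; rewrite mulr_ge0.
  have -> : 2 * s * J = 2 * D * (s * rn) by rewrite /J; ring.
  have -> : 8 * q%:R * D ^+ 2 = 2 * D * (4 * q%:R * D) by ring.
  by apply: ler_wpM2l => //; lra.
apply: ler_pM; [exact: expR_ge0| |exact: ke|].
  by rewrite invr_ge0 mulr_ge0// ltW.
rewrite -[leLHS]mul1r ler_pdivrMr; last by rewrite mulr_gt0.
rewrite -(@ler_pXn2r _ 2)// ?nnegrE ?mulr_ge0 ?binom_mass_ge0 ?(ltW rn0)//.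
rewrite expr1n [leRHS](_ : _ = binom_mass k 0 ^+ 2 * (4 * rn ^+ 2)); last by ring.
rewrite rn2.
case: k k1 kn {nk kr0 nqk s s0 sr s12 step off ke} => // k _ kn.
apply: (le_trans (binom_central_ge k)); apply: ler_wpM2l; first exact: sqr_ge0.
by apply: ler_wpM2l => //; rewrite ler_nat.
Qed.

End binomial_lower.

Section local_lower.
Context {R : realType} (d K kap eta : R) (m0 : nat).
Hypotheses (d0 : 0 < d) (kap0 : 0 < kap) (K1 : 1 <= K).
Hypotheses (eta01 : 0 < eta <= 1) (m00 : (0 < m0)%N).
Implicit Types (p : @law R) (s b : seq (@law R)) (f : R -> R) (x z : R).
Local Notation good := (good_law d K kap).
Local Notation adm := (admissible d K kap eta m0).
Local Notation point z := (fun x : R => (x == z)%:R : R).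
Local Notation sig2 := (var_const d K).

(** All paths end on the same translate of the integers; [z] is on it. *)
Definition reaches s x z := forall ys, path_of s ys -> z - endpt x ys \is a Num.int.

Lemma reaches_cat s1 s2 x z a : reaches (s1 ++ s2) x z -> path_of s1 a ->
  reaches s2 (endpt x a) z.
Proof.
by move=> h sa ys sy; rewrite -endpt_cat; apply: h; exact: path_of_cat.
Qed.

Lemma reaches_shift s x x' z : reaches s x z -> x' - x \is a Num.int ->
  reaches s x' z.
Proof.
move=> h xx ys /h; rewrite (endptE x) (endptE x') => hz.
have -> : z - (x' + endpt 0 ys) = z - (x + endpt 0 ys) - (x' - x) by ring.
exact: rpredB.
Qed.

(** The induction adds one block at a time.  The displacement enters the bound
    through its second moment only, while the last term records that the number
    of binomial steps is unlikely to be small: each block multiplies it by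
    [1 - eta / 2]. *)
Lemma local_lower_blocks (A B D : R) (n : nat) z : 0 <= B -> 0 <= D ->
  (forall k x, (k <= n)%N -> z - x \is a Num.int ->
    A - B * (x - z) ^+ 2 - D / 2 ^+ k <= iter k bin_op (point z) x) ->
  forall N s k x, adm s -> size s = (N * m0)%N -> reaches s x z ->
  (k + N <= n)%N ->
  A - B * ((x - z) ^+ 2 + sig2 * (size s)%:R) - D / 2 ^+ k * (1 - eta / 2) ^+ N <=
  iter k bin_op (fun x => PE s (fun ys => point z (endpt x ys))) x.
Proof.
move=> B0 D0 base; have /andP[e0 e1] := eta01.
elim=> [|N IH] s k x as_ sz reach kN.
  case: s as_ sz reach => // _ _ reach; rewrite mulr0 addr0 mulr1.
  by apply: base; [rewrite addn0 in kN|exact: (reach [::])].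
have sE : s = take m0 s ++ drop m0 s by rewrite cat_take_drop.
have szt : size (take m0 s) = m0 by rewrite size_takel// sz mulSn leq_addr.
have szd : size (drop m0 s) = (N * m0)%N by rewrite size_drop sz mulSn addKn.
move: as_ reach; rewrite sE size_cat; move: (take m0 s) (drop m0 s) szt szd.
move=> b s' szb szs' as_ reach; rewrite szb.
have [ab as'] := admissible_cat as_.
have [ys0 ys0b tp] := as_.2 [::] b s' erefl szb.
have bn := admissible_nonneg ab.
pose T x := PE s' (fun ys => point z (endpt x ys)).
have -> : (fun x => PE (b ++ s') (fun ys => point z (endpt x ys))) =
    (fun x => PE b (fun ys => T (endpt x ys))).
  by apply/funext => y; rewrite PE_cat; apply: eq_PE => a; apply: eq_PE => c;
     rewrite endpt_cat.
rewrite iter_bin_op_PE.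
set A' := A - B * (sig2 * (size s')%:R).
set e := D / 2 ^+ k * (1 - eta / 2) ^+ N.
have e_ge0 : 0 <= e.
  rewrite /e mulr_ge0 ?exprn_ge0//; last by lra.
  by rewrite divr_ge0// exprn_ge0.
pose g (y : R) := A' - B * (y - z) ^+ 2 - e.
pose F (y : R) := iter k bin_op T y.
have kN' : (k + N <= n)%N by apply: leq_trans kN; rewrite leq_add2l.
have gF y : reaches s' y z -> g y <= F y.
  move=> ry; apply: le_trans (IH s' k y as' szs' ry kN').
  by rewrite /g /A' /e; lra.
set r := endpt x ys0.
have rr : reaches s' r z by exact: reaches_cat reach ys0b.
have rm : reaches s' (r - 1) z.
  by apply: reaches_shift rr _; rewrite addrAC subrr sub0r rpredN int_num1.
have rp : reaches s' (r + 1) z.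
  by apply: reaches_shift rr _; rewrite addrAC subrr add0r int_num1.
pose h (y : R) := if `[< reaches s' y z >] then F y - g y else 0.
have h0 y : 0 <= h y.
  by rewrite /h; case: asboolP => // /gF; rewrite subr_ge0.
have hE y : reaches s' y z -> h y = F y - g y by rewrite /h; case: asboolP.
have := tp h x h0; rewrite -/r !hE// => tph.
have PEh : PE b (fun ys => h (endpt x ys)) <=
    PE b (fun ys => F (endpt x ys)) - PE b (fun ys => g (endpt x ys)).
  rewrite -PEB; apply: le_PE_supp => // ys byys.
  by rewrite hE//; exact: reaches_cat reach byys.
have PEg : A' - B * ((x - z) ^+ 2 + sig2 * m0%:R) - e <=
    PE b (fun ys => g (endpt x ys)).
  have -> : PE b (fun ys => g (endpt x ys)) =
      A' - B * PE b (fun ys => (endpt x ys - z) ^+ 2) - e.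
    by rewrite /g PEB PEB PEZ !(adm_cst _ ab).
  have := ler_wpM2l B0 (PE_quad_le d0 x z ab.1); rewrite szb; lra.
have bF : g r + e / 2 <= bin_op F r.
  have kN2 : (k.+1 + N <= n)%N by rewrite addSnnS.
  have := IH s' k.+1 r as' szs' rr kN2; rewrite -/T iterS => /(le_trans _); apply.
  have -> : D / 2 ^+ k.+1 = D / 2 ^+ k / 2 by rewrite exprSr invfM mulrA.
  by rewrite /g /A' /e; lra.
have bg : bin_op F r = (F (r - 1) - g (r - 1)) / 4 + (F r - g r) / 2
    + (F (r + 1) - g (r + 1)) / 4 + g r - B / 2.
  by rewrite /bin_op /g; field.
have := gF _ rr; have := gF _ rm; have := gF _ rp => hp hm hr.
have h3 : e / 2 <= F (r - 1) - g (r - 1) + (F r - g r) + (F (r + 1) - g (r + 1)).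
  lra.
have h4 := ler_wpM2l (ltW e0) h3.
have -> : D / 2 ^+ k * (1 - eta / 2) ^+ N.+1 = (1 - eta / 2) * e.
  by rewrite /e (exprS _ N); ring.
rewrite -/T -/F natrD.
move: h4 tph PEh PEg; rewrite /A' -/F; lra.
Qed.

Lemma geometric_small (r : R) : 0 <= r -> r < 1 -> exists Q : nat,
  (0 < Q)%N /\ r ^+ Q <= 1 / 4.
Proof.
move=> r0 r1; pose h := 1 - r.
have h0 : 0 < h by rewrite /h; lra.
exists (Num.truncn (3 / h)).+1; split=> //.
set Q := (Num.truncn _).+1.
have hQ : 3 <= h * Q%:R.
  rewrite mulrC -ler_pdivrMr//; apply: ltW; rewrite /Q.
  by rewrite -truncn_lt_nat// divr_ge0// ltW.
apply: (@le_trans _ _ (expR (- h) ^+ Q)).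
  rewrite ler_pXn2r ?nnegrE ?expR_ge0//; have := expR_ge1Dx (- h); rewrite /h; lra.
rewrite -expRM_natr mulNr expRN.
rewrite -[leLHS]mul1r ler_pdivrMr ?expR_gt0//.
have := expR_ge1Dx (h * Q%:R); lra.
Qed.

(** The binomial mass is bounded below by a parabola minus a term that is only
    needed when there are few binomial steps.  The parabola is integrated
    against the walk exactly, through the variance. *)
Lemma local_lower : exists c : R, exists2 n0 : nat, 0 < c & forall s x z,
  adm s -> (n0 <= size s)%N -> reaches s x z ->
  `|x - z| <= Num.sqrt (size s)%:R ->
  c / Num.sqrt (size s)%:R <= PE s (fun ys => point z (endpt x ys)).
Proof.
have /andP[e0 e1] := eta01.
have v0 := var_const_ge0 d0 K1.
(* The parabola [A - B * (x - z) ^+ 2] changes sign at distance [Dd * rn], far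
   beyond the standard deviation of the walk; the term in [D] is at least [A]
   when there are fewer than [k1] binomial steps. *)
pose Dd : R := 8 * (1 + sig2).
have Dd1 : 1 <= Dd by rewrite /Dd; lra.
pose rho := 1 - eta / 2.
have rho0 : 0 <= rho by rewrite /rho; lra.
have rho1 : rho < 1 by rewrite /rho; lra.
have [Q [Q0 hQ]] := geometric_small rho0 rho1.
pose q := (m0 * Q)%N.
have q0 : (0 < q)%N by rewrite muln_gt0 m00.
have [c [n1 c0 hc]] := binom_mass_lower q0 Dd1.
exists (c / 2), (maxn n1 (2 * q)) => [|s x z as_]; first by rewrite divr_gt0.
set n := size s; rewrite geq_max => /andP[nn1 nq] reach xz.
have n0 : (0 < n)%N by apply: leq_trans nq; rewrite muln_gt0.
set rn := Num.sqrt n%:R in xz *.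
have rn0 : 0 < rn by rewrite sqrtr_gt0 ltr0n.
have rn2 : rn ^+ 2 = n%:R by rewrite sqr_sqrtr.
have nr0 : 0 < n%:R :> R by rewrite ltr0n.
pose A := c / rn; have A0 : 0 < A by rewrite divr_gt0.
pose B := A / (Dd ^+ 2 * n%:R).
have Dd0 : 0 < Dd by lra.
have Dn0 : 0 < Dd ^+ 2 * n%:R by rewrite mulr_gt0// exprn_gt0.
have B0 : 0 <= B by rewrite divr_ge0// ltW.
pose k1 := (n %/ q)%N; pose D := A * 2 ^+ k1.
have D0 : 0 <= D by rewrite mulr_ge0 ?exprn_ge0// ltW.
have base k y : (k <= n)%N -> z - y \is a Num.int ->
    A - B * (y - z) ^+ 2 - D / 2 ^+ k <= iter k bin_op (point z) y.
  move=> kn /intrP[m zy].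
  have yE : y = z + (- m)%:~R by rewrite intrN -zy; ring.
  have yz : y - z = (- m)%:~R by rewrite yE; ring.
  rewrite yz yE iter_bin_op_int abszN.
  have m2 : ((- m)%:~R : R) ^+ 2 = (`|m|%N%:R) ^+ 2.
    by rewrite intrN sqrrN natr_absz intr_norm real_normK ?num_real.
  rewrite m2; set j := `|m|%N.
  have Dk0 : 0 <= D / 2 ^+ k by rewrite divr_ge0// exprn_ge0.
  have [jD|jD] := leP j%:R (Dd * rn); last first.
    apply: le_trans (binom_mass_ge0 _ _).
    have : A <= B * j%:R ^+ 2.
      rewrite /B mulrAC ler_pdivlMr//; apply: ler_wpM2l; first exact: ltW.
      by rewrite -rn2 -exprMn ler_pXn2r ?nnegrE ?(ltW jD)// mulr_ge0// ltW.
    lra.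
  have Bj : 0 <= B * j%:R ^+ 2 by rewrite mulr_ge0// sqr_ge0.
  have [kk|kk] := leqP k1 k.
    have : A <= binom_mass k j by apply: (hc n k j nn1 _ jD); rewrite -/k1 kk.
    lra.
  apply: le_trans (binom_mass_ge0 _ _).
  have : A <= D / 2 ^+ k.
    rewrite /D ler_pdivlMr ?exprn_gt0//; apply: ler_wpM2l; first exact: ltW.
    by apply: ler_weXn2l; [lra|exact: ltnW].
  lra.
set N := (n %/ m0)%N; set r := (n %% m0)%N.
have szE : n = (r + N * m0)%N by rewrite addnC -divn_eq.
have sz1 : size (take r s) = r by rewrite size_takel// -/n szE leq_addr.
have sz2 : size (drop r s) = (N * m0)%N by rewrite size_drop -/n szE addKn.
have [a1 a2] : adm (take r s) /\ adm (drop r s).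
  by apply: admissible_cat; rewrite cat_take_drop.
rewrite -(cat_take_drop r s) in reach; rewrite -(cat_take_drop r s) PE_cat.
have Nn : (0 + N <= n)%N by rewrite add0n leq_div.
pose low (y : R) := A - B * ((y - z) ^+ 2 + sig2 * (N * m0)%:R) - D * rho ^+ N.
apply: (@le_trans _ _ (PE (take r s) (fun a => low (endpt x a)))); last first.
  apply: le_PE_supp; first exact: admissible_nonneg a1.
  move=> a sa; have := @local_lower_blocks A B D n z B0 D0 base N (drop r s) 0
    (endpt x a) a2 sz2 (reaches_cat reach sa) Nn.
  rewrite sz2 expr0 divr1 /= => /le_trans; apply.
  by apply: le_PE => [|c']; [exact: admissible_nonneg a2|rewrite endpt_cat].
have -> : PE (take r s) (fun a => low (endpt x a)) =
    A - B * (PE (take r s) (fun a => (endpt x a - z) ^+ 2) + sig2 * (N * m0)%:R)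
    - D * rho ^+ N.
  by rewrite /low !PEB PEZ PED !(adm_cst _ a1).
have hq := PE_quad_le d0 x z a1.1; rewrite sz1 in hq.
have xz2 : (x - z) ^+ 2 <= n%:R.
  by rewrite -rn2 -(real_normK (num_real (x - z))) ler_pXn2r// ?nnegrE// ltW.
have hB : B * (PE (take r s) (fun a => (endpt x a - z) ^+ 2) + sig2 * (N * m0)%:R)
    <= A / 8.
  apply: (@le_trans _ _ (B * (n%:R * (1 + sig2)))).
    apply: ler_wpM2l => //; rewrite mulrDr mulr1 {2}szE natrD.
    by move: hq xz2; rewrite (mulrC sig2 r%:R); lra.
  rewrite /B mulrAC ler_pdivrMr// -[leRHS]mulrA; apply: ler_wpM2l; first exact: ltW.
  have hDd : 1 + sig2 <= Dd ^+ 2 / 8 by rewrite /Dd; nra.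
  have := ler_wpM2l (ltW nr0) hDd; lra.
have hD : D * rho ^+ N <= A / 4.
  rewrite /D -mulrA; apply: ler_wpM2l; first exact: ltW.
  have kN : (Q * k1 <= N)%N.
    rewrite leq_divRL// /k1 mulnC mulnA.
    by rewrite -/q; apply: leq_trans (leq_trunc_div n q); rewrite mulnC.
  have r1 : rho ^+ N <= (1 / 4) ^+ k1.
    apply: (@le_trans _ _ (rho ^+ (Q * k1))).
      by apply: ler_wiXn2l => //; exact: ltW.
    by rewrite exprM; apply: lerXn2r => //; rewrite nnegrE ?exprn_ge0//; lra.
  apply: (@le_trans _ _ (2 ^+ k1 * (1 / 4) ^+ k1)).
    by apply: ler_wpM2l => //; exact: exprn_ge0.
  rewrite -exprMn; have k2 : (2 <= k1)%N by rewrite leq_divRL.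
  apply: (@le_trans _ _ ((2 * (1 / 4)) ^+ 2)).
    by apply: ler_wiXn2l => //; lra.
  by rewrite expr2; lra.
have -> : c / 2 / rn = A / 2 by rewrite /A; ring.
lra.
Qed.

End local_lower.

(** * Crossing the bulk without being killed *)

Section bridges.
Context {R : realType} (d K kap eta : R) (m0 : nat).
Hypotheses (d0 : 0 < d) (kap0 : 0 < kap) (K1 : 1 <= K).
Hypotheses (eta01 : 0 < eta <= 1) (m00 : (0 < m0)%N).
Implicit Types (p : @law R) (s b : seq (@law R)) (f : R -> R) (x z : R).
Local Notation good := (good_law d K kap).
Local Notation adm := (admissible d K kap eta m0).
Local Notation point z := (fun x : R => (x == z)%:R : R).

Lemma path_exists s : (forall p, p \in s -> good p) -> exists ys, path_of s ys.
Proof.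
elim: s => [|p s IH] gs; first by exists [::].
have [ys sys] : exists ys, path_of s ys.
  by apply: IH => q qs; apply: gs; rewrite inE qs orbT.
have := good_mass (gs p (mem_head _ _)).
case: p {gs} => [|a p] /=; first by rewrite /Ex big_nil => /eqP; rewrite eq_sym oner_eq0.
by move=> _; exists (a.1 :: ys) => /=; rewrite mem_head.
Qed.

Lemma path_of_lattice s x ys ys' : (forall p, p \in s -> good p) ->
  path_of s ys -> path_of s ys' -> endpt x ys - endpt x ys' \is a Num.int.
Proof.
rewrite (endptE x ys) (endptE x ys') opprD addrACA subrr add0r.
elim: s ys ys' => [|p s IH] [|y ys] [|y' ys'] //= gs.
  by rewrite subrr int_num0.
move=> [yp sys] [yp' sys'].
rewrite (endptE (0 + y)) (endptE (0 + y')) !add0r opprD addrACA rpredD//.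
  by apply: (good_lattice (gs p (mem_head _ _))).
by apply: IH => // q qs; apply: gs; rewrite inE qs orbT.
Qed.

(** Decomposition at the first visit to the negative half-line, after which the
    rest of the walk still has to hit [z]. *)
Lemma killed_defect s x z (M : R) : adm s -> 0 <= M ->
  (forall s' w, adm s' -> w < 0 -> PE s' (fun ys => point z (endpt w ys)) <= M) ->
  PE s (fun ys => point z (endpt x ys)) <=
  PE s (fun ys => (surv x ys && (endpt x ys == z))%:R) + M.
Proof.
move=> as_ M0 hM; elim: s x as_ => [|p s IH] x as_ /=; first by rewrite lerDl.
have [ap as'] := @admissible_cat _ d K kap eta m0 [:: p] s as_.
have gp : good p by apply: as_.1; rewrite mem_head.
rewrite -[X in _ + X](good_cst M gp) -ExD; apply: le_Ex (good_nonneg gp) _ => y.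
have [xy|xy] := leP 0 (x + y); first exact: IH.
by apply: le_trans (hM s (x + y) as' xy) _; rewrite lerDr PE_ge0//;
  exact: admissible_nonneg as'.
Qed.

(** Away from the origin, on the scale of the walk, killing is negligible: a
    killed path would have to come back from below zero to [z], which by
    [local_far] has probability at most of order [1 / z]. *)
Lemma bridge : exists Kb c : R, exists n0 : nat, [/\ 1 <= Kb, 0 < c &
  forall s x z, adm s -> (n0 <= size s)%N -> reaches s x z ->
  `|x - z| <= Num.sqrt (size s)%:R -> Kb * Num.sqrt (size s)%:R <= z ->
  c / Num.sqrt (size s)%:R <=
  PE s (fun ys => (surv x ys && (endpt x ys == z))%:R)].
Proof.
have [C C0 far] := local_far kap d0 K1 eta01 m00.
have [c [n0 c0 low]] := local_lower kap d0 K1 eta01 m00.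
pose Kb := Num.max 1 (2 * C / c).
exists Kb, (c / 2), (maxn n0 1); split; [by rewrite le_max lexx|by rewrite divr_gt0|].
move=> s x z as_; rewrite geq_max => /andP[sn0 s1] reach xz zK.
set rn := Num.sqrt _ in xz zK *.
have rn0 : 0 < rn by rewrite sqrtr_gt0 ltr0n.
have Kb1 : 1 <= Kb by rewrite le_max lexx.
have z0 : 0 < z by apply: lt_le_trans zK; rewrite mulr_gt0//; lra.
pose M := C / z.
have M0 : 0 <= M by rewrite divr_ge0// ltW.
have h1 := low s x z as_ sn0 reach xz.
have h2 : PE s (fun ys => point z (endpt x ys)) <=
  PE s (fun ys => (surv x ys && (endpt x ys == z))%:R) + M.
  apply: killed_defect => // s' w as' w0.
  apply: (le_trans (far s' w z as' _)); first by rewrite lt_eqF//; lra.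
  rewrite /M ler_pM2l// lef_pV2 ?posrE//; last by rewrite normr_gt0; lra.
  by apply: le_trans (ler_norm _); lra.
have h3 : M <= c / 2 / rn.
  rewrite /M ler_pdivrMr// mulrAC ler_pdivlMr//.
  have : 2 * C / c * rn <= z.
    apply: le_trans zK; apply: ler_wpM2r; first exact: ltW.
    by rewrite le_max lexx orbT.
  rewrite -(@ler_pM2l _ c)//.
  have -> : c * (2 * C / c * rn) = 2 * C * rn by field; rewrite gt_eqF.
  lra.
have : c / 2 / rn + c / 2 / rn = c / rn by field; rewrite gt_eqF.
rewrite -/rn in h1; lra.
Qed.

(** A window of width [W] contains at least [W / 4] points of the lattice. *)
Lemma lattice_sum s x (b W g : R) : adm s -> 4 <= W -> 0 <= g ->
  (forall y, reaches s x y -> b <= y <= b + W ->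
    g <= PE s (fun ys => (surv x ys && (endpt x ys == y))%:R)) ->
  g * (W / 4) <=
  PE s (fun ys => (surv x ys && (b <= endpt x ys <= b + W))%:R).
Proof.
move=> as_ W4 g0 hy; have [ys0 sys0] := path_exists as_.1.
set e0 := endpt x ys0.
pose y0 := e0 + (Num.ceil (b - e0))%:~R.
have by0 : b <= y0 < b + 1.
  have /andP[h1 h2] := ceil_itv (b - e0).
  by rewrite /y0; move: h1 h2; rewrite intrB => h1 h2; apply/andP; split; lra.
pose M := Num.truncn (W / 2).
have W20 : 0 <= W / 2 by lra.
have /andP[M1 M2] := truncn_itv W20; rewrite -/M in M1 M2.
have natS (i : nat) : i.+1%:R = i%:R + 1 :> R by rewrite natr1.
have MW : W / 4 <= M%:R by move: M2; rewrite (natS M); lra.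
have reachy (i : nat) : reaches s x (y0 + i%:R).
  move=> ys sys; rewrite /y0.
  have -> : e0 + (Num.ceil (b - e0))%:~R + i%:R - endpt x ys =
    (e0 - endpt x ys) + ((Num.ceil (b - e0)) + Posz i)%:~R.
    by rewrite intrD; ring.
  by rewrite rpredD ?intr_int//; exact: path_of_lattice as_.1 sys0 sys.
apply: (@le_trans _ _ (\sum_(i < M) PE s (fun ys =>
    (surv x ys && (endpt x ys == y0 + i%:R))%:R))).
  apply: (@le_trans _ _ (\sum_(i < M) g)).
    by rewrite sumr_const card_ord -[leRHS]mulr_natr; apply: ler_wpM2l.
  apply: ler_sum => i _; apply: hy; first exact: reachy.
  have : i.+1%:R <= M%:R :> R by rewrite ler_nat.
  have : 0 <= i%:R :> R by [].
  have /andP[] := by0; rewrite (natS i) => *; apply/andP; split; lra.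
rewrite -PE_sum; apply: le_PE; first exact: admissible_nonneg as_.
move=> ys; case: surv => /=; last by rewrite big1.
have [i /eqP ei|none] := pickP (fun i : 'I_M => endpt x ys == y0 + i%:R).
  have -> : (b <= endpt x ys <= b + W).
    have : i.+1%:R <= M%:R :> R by rewrite ler_nat.
    have : 0 <= i%:R :> R by [].
    have /andP[] := by0; rewrite (natS i) ei => *; apply/andP; split; lra.
  rewrite (bigD1 i)//= ei eqxx big1 ?addr0// => j ji.
  by rewrite (inj_eq (addrI _)) eqr_nat eq_sym (inj_eq val_inj) (negbTE ji).
by rewrite big1// => i _; rewrite none.
Qed.

Lemma window : exists Kb c : R, exists n0 : nat, [/\ 1 <= Kb, 0 < c &
  forall s x (b : R), adm s -> (n0 <= size s)%N ->
  `|b - x| <= Num.sqrt (size s)%:R / 2 -> Kb * Num.sqrt (size s)%:R <= b ->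
  c <= PE s (fun ys => (surv x ys &&
    (b <= endpt x ys <= b + Num.sqrt (size s)%:R / 4))%:R)].
Proof.
have [Kb [c [n0 [Kb1 c0 hb]]]] := bridge.
have [n1 hn1] := @sqrt_nat_ge R 16.
exists Kb, (c / 16), (maxn n0 n1); split=> //; first by rewrite divr_gt0.
move=> s x b as_; rewrite geq_max => /andP[sn0 /hn1 s16] bx bK.
set rn := Num.sqrt _ in s16 bx bK *.
have rn0 : 0 < rn by lra.
have -> : c / 16 = c / rn * (rn / 4 / 4) by field; rewrite gt_eqF.
apply: lattice_sum => //; [lra|by rewrite divr_ge0// ltW|].
move=> y ry /andP[by1 by2]; apply: hb => //.
  rewrite distrC ler_norml; move: bx; rewrite ler_norml -/rn => /andP[h1 h2].
  by apply/andP; split; lra.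
exact: le_trans bK by1.
Qed.

(** One block at a time along the line of slope [del]: the window around the
    line is as wide as a fixed fraction of the standard deviation of a block. *)
Lemma chain (l : nat) (Kb c : R) : 0 < c ->
  (forall s x (b : R), adm s -> size s = l ->
    `|b - x| <= Num.sqrt l%:R / 2 -> Kb * Num.sqrt l%:R <= b ->
    c <= PE s (fun ys => (surv x ys &&
      (b <= endpt x ys <= b + Num.sqrt l%:R / 4))%:R)) ->
  forall J s x (b del : R), adm s -> size s = (J * l)%N ->
  b <= x <= b + Num.sqrt l%:R / 4 -> `|del| <= Num.sqrt l%:R / 4 ->
  Kb * Num.sqrt l%:R <= b -> Kb * Num.sqrt l%:R <= b + J%:R * del ->
  c ^+ J <= PE s (fun ys => (surv x ys &&
      (b + J%:R * del <= endpt x ys <= b + J%:R * del + Num.sqrt l%:R / 4))%:R).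
Proof.
set r := Num.sqrt l%:R => c0 hw; elim=> [|J IH] s x b del as_ sz bx dr Kb1 KbJ.
  by case: s as_ sz => //= _ _; rewrite mul0r addr0 bx.
have sE : s = take l s ++ drop l s by rewrite cat_take_drop.
have szt : size (take l s) = l by rewrite size_takel// sz mulSn leq_addr.
have szd : size (drop l s) = (J * l)%N by rewrite size_drop sz mulSn addKn.
have [a1 a2] : adm (take l s) /\ adm (drop l s).
  by apply: admissible_cat; rewrite cat_take_drop.
have bJ : b + J.+1%:R * del = b + del + J%:R * del by rewrite -natr1; ring.
have J0 : 0 <= J%:R :> R by [].
have Kb2 : Kb * r <= b + del.
  have [d_ge0|d_lt0] := leP 0 del; first by apply: (le_trans Kb1); lra.
  by apply: (le_trans KbJ); rewrite bJ; nra.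
have hw1 : c <= PE (take l s) (fun ys => (surv x ys &&
      (b + del <= endpt x ys <= b + del + r / 4))%:R).
  apply: hw => //; move: bx dr => /andP[h1 h2]; rewrite !ler_norml => /andP[h3 h4].
  by apply/andP; split; lra.
rewrite sE PE_cat exprS.
apply: (@le_trans _ _ (c ^+ J * PE (take l s) (fun ys => (surv x ys &&
      (b + del <= endpt x ys <= b + del + r / 4))%:R))).
  by rewrite mulrC; apply: ler_wpM2l => //; rewrite exprn_ge0// ltW.
rewrite -PEZ; apply: le_PE; first exact: admissible_nonneg a1.
move=> a; case: (boolP (surv x a)) => /= sa; last first.
  by rewrite mulr0 PE_ge0//; exact: admissible_nonneg a2.
have [ba|ba] := boolP (_ <= _ <= _); last first.
  by rewrite mulr0 PE_ge0//; exact: admissible_nonneg a2.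
rewrite mulr1; under eq_PE do rewrite surv_cat sa endpt_cat /= bJ.
by apply: IH => //; rewrite -bJ.
Qed.

End bridges.

Section crossing.
Context {R : realType} (d K kap eta : R) (m0 : nat).
Hypotheses (d0 : 0 < d) (kap0 : 0 < kap) (K1 : 1 <= K).
Hypotheses (eta01 : 0 < eta <= 1) (m00 : (0 < m0)%N).
Implicit Types (p : @law R) (s : seq (@law R)) (x z t : R).
Local Notation adm := (admissible d K kap eta m0).

Lemma sqrt_mul_le (u v p q : R) : 0 <= u -> 0 <= v -> 0 <= p -> 0 <= q ->
  u ^+ 2 * p <= v ^+ 2 * q -> u * Num.sqrt p <= v * Num.sqrt q.
Proof.
move=> u0 v0 p0 q0 h.
rewrite -(@ler_pXn2r _ 2)// ?nnegrE ?mulr_ge0 ?sqrtr_ge0//.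
by rewrite !exprMn !sqr_sqrtr.
Qed.

Lemma expRNV_le (c : R) : 0 < c -> expR (- c^-1) <= c.
Proof.
move=> c0; rewrite expRN -[leRHS]invrK lef_pV2 ?posrE ?invr_gt0 ?expR_gt0//.
exact: expR_ge_id.
Qed.

(** The walk follows a straight line in about [t ^ 2] blocks, so that in each
    block the displacement is of the order of the standard deviation of the
    block.  Every block costs a constant factor, and the last one lands on the
    target. *)
Lemma crossing (a B : R) : 0 < a -> 1 <= B -> exists Cc N0 : R,
  [/\ 0 < Cc, 1 <= N0 & forall s x z t, adm s -> 1 <= t ->
  N0 * t ^+ 4 <= (size s)%:R -> reaches s x z ->
  a * Num.sqrt (size s)%:R <= x <= B * t * Num.sqrt (size s)%:R ->
  a * Num.sqrt (size s)%:R <= z <= B * t * Num.sqrt (size s)%:R ->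
  expR (- (Cc * t ^+ 2)) / Num.sqrt (size s)%:R <=
  PE s (fun ys => (surv x ys && (endpt x ys == z))%:R)].
Proof.
move=> a0 B1.
have [Kb1 [c1 [n1 [Kb11 c10 hb]]]] := bridge kap d0 K1 eta01 m00.
have [Kb2 [c2 [n2 [Kb21 c20 hw]]]] := window kap d0 K1 eta01 m00.
pose Kb := Kb1 + Kb2.
have KbK1 : Kb1 <= Kb by rewrite /Kb; lra.
have KbK2 : Kb2 <= Kb by rewrite /Kb; lra.
have Kb0 : 0 <= Kb by lra.
(* With [ka * t ^+ 2] blocks, the second term makes the displacement over a
   block at most a quarter of its standard deviation, and the third one puts
   the endpoints above the height required by [bridge] and [window]. *)
pose ka := 1 + 64 * B ^+ 2 + 2 * Kb ^+ 2 / a ^+ 2.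
have a20 : 0 < a ^+ 2 by rewrite exprn_gt0.
have k1 : 0 <= 64 * B ^+ 2 by rewrite mulr_ge0// sqr_ge0.
have k2 : 0 <= 2 * Kb ^+ 2 / a ^+ 2 by rewrite divr_ge0 ?(ltW a20)// mulr_ge0// sqr_ge0.
have ka1 : 1 <= ka by rewrite /ka; lra.
pose nn := (n1 + n2 + 1)%N.
have nn_n1 j : (n1 <= j + nn)%N by rewrite /nn; clear; lia.
have nn_n2 j : (n2 <= j + nn)%N by rewrite /nn; clear; lia.
have nn1 : 1 <= nn%:R :> R by rewrite ler1n /nn addn1.
exists (2 * ka / c2 + c1^-1), (3 * ka * (3 * ka + nn%:R)); split.
- by rewrite addr_gt0 ?divr_gt0 ?invr_gt0//; lra.
- nra.
move=> s x z t as_ t1 hN reach /andP[x1 x2] /andP[z1 z2].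
set L := size s in hN x1 x2 z1 z2 *; set rL := Num.sqrt _ in x1 x2 z1 z2 *.
have t21 : 1 <= t ^+ 2 by rewrite expr2; nra.
have kt1 : 1 <= ka * t ^+ 2 by nra.
have kt0 : 0 <= ka * t ^+ 2 by lra.
pose J := (Num.truncn (ka * t ^+ 2)).+1.
have natS (i : nat) : i.+1%:R = i%:R + 1 :> R by rewrite natr1.
have /andP[J1 J2] := truncn_itv kt0; rewrite -/J in J2.
have {}J1 : J%:R <= 2 * (ka * t ^+ 2) by rewrite /J natS; lra.
pose l := (L %/ J.+1)%N.
have JL : (J.+1 * (J + nn) <= L)%N.
  rewrite -(@ler_nat R) natrM natrD natS; apply: le_trans hN.
  have -> : t ^+ 4 = t ^+ 2 * t ^+ 2 by ring.
  have -> : 3 * ka * (3 * ka + nn%:R) * (t ^+ 2 * t ^+ 2) =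
    (3 * (ka * t ^+ 2)) * (3 * (ka * t ^+ 2) + nn%:R * t ^+ 2) by ring.
  apply: ler_pM; rewrite ?addr_ge0//; first by lra.
  by apply: lerD; [lra|rewrite ler_peMr].
have Jl : (J + nn <= l)%N by rewrite leq_divRL// mulnC.
have l0 : (0 < l)%N by apply: leq_trans Jl; rewrite addn_gt0.
have lL : (J.+1 * l <= L)%N by rewrite mulnC; exact: leq_trunc_div.
have Ll : (L < J.+1 * l.+1)%N by rewrite mulnC; exact: ltn_ceil.
have r_i : J%:R * l%:R <= L%:R :> R.
  by rewrite -natrM ler_nat; apply: leq_trans lL; rewrite leq_mul2r leqnSn orbT.
have r_ii : L%:R <= 4 * (J%:R * l%:R) :> R.
  rewrite -!natrM ler_nat; apply: (leq_trans (ltnW Ll)).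
  rewrite (_ : 4 * (J * l) = (J + J) * (l + l))%N; last by ring.
  by apply: leq_mul; rewrite -addn1 leq_add2l.
have J0 : 0 < J%:R :> R by rewrite ltr0n.
have lr0 : 0 < l%:R :> R by rewrite ltr0n.
have Lr0 : 0 < L%:R :> R by apply: lt_le_trans r_i; exact: mulr_gt0.
set r1 := Num.sqrt (l%:R : R).
have r10 : 0 < r1 by rewrite sqrtr_gt0.
have rL0 : 0 < rL by rewrite sqrtr_gt0.
have B0 : 0 <= B := le_trans ler01 B1.
have t0 : 0 <= t := le_trans ler01 t1.
have BJ : 64 * B ^+ 2 * t ^+ 2 <= J%:R.
  apply: ltW; apply: le_lt_trans J2; apply: ler_wpM2r; first exact: sqr_ge0.
  by rewrite /ka; clear - d0 kap0 K1 eta01 m00 k2; lra.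
have KJ : 2 * Kb ^+ 2 <= a ^+ 2 * J%:R.
  rewrite (mulrC (a ^+ 2)) -ler_pdivrMr//; apply: ltW; apply: le_lt_trans J2.
  by rewrite -[leLHS]mulr1; apply: ler_pM => //; rewrite /ka; lra.
have disp : 4 * B * t * rL <= J%:R * r1.
  have B4 : 0 <= 4 * B * t by apply: mulr_ge0 => //; apply: mulr_ge0.
  apply: (sqrt_mul_le B4 (ltW J0) (ltW Lr0) (ltW lr0)).
  apply: (@le_trans _ _ ((4 * B * t) ^+ 2 * (4 * (J%:R * l%:R)))).
    by apply: ler_wpM2l => //; exact: sqr_ge0.
  have := ler_wpM2r (ltW (mulr_gt0 J0 lr0)) BJ; rewrite !expr2; clear - d0 kap0 K1 eta01 m00; lra.
have Kr1 : Kb * r1 <= a * rL.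
  apply: (sqrt_mul_le Kb0 (ltW a0) (ltW lr0) (ltW Lr0)).
  have := ler_wpM2l (ltW a20) r_i; have := ler_wpM2r (ltW lr0) KJ.
  have : 0 <= Kb ^+ 2 * l%:R by rewrite mulr_ge0// sqr_ge0.
  by clear - d0 kap0 K1 eta01 m00; lra.
pose s1 := take (J * l) s; pose s2 := drop (J * l) s.
have JlL : (J * l <= L)%N by apply: leq_trans lL; rewrite leq_mul2r leqnSn orbT.
have sz1 : size s1 = (J * l)%N by rewrite size_takel.
have sz2 : size s2 = (L - J * l)%N by rewrite size_drop.
have [as1 as2] : adm s1 /\ adm s2.
  by apply: admissible_cat; rewrite cat_take_drop.
have sE : s = s1 ++ s2 by rewrite cat_take_drop.
have l_s2 : (l <= size s2)%N by rewrite sz2 leq_subRL// -mulSnr.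
have s2_l : (size s2 <= 2 * l)%N.
  rewrite sz2 leq_subLR; apply: (leq_trans (ltnW Ll)).
  rewrite mulnS mulSn addnCA [leqRHS]addnC mul2n -addnn -!addnA leq_add2l.
  rewrite leq_add2r; apply: leq_trans Jl.
  by rewrite -addn1 leq_add2l /nn addn1.
have s2_L : (size s2 <= L)%N by rewrite sz2 leq_subr.
set r2 := Num.sqrt ((size s2)%:R : R).
have r1r2 : r1 <= r2 by apply: ler_wsqrtr; rewrite ler_nat.
have r2L : r2 <= rL by apply: ler_wsqrtr; rewrite ler_nat.
have r20 : 0 < r2 := lt_le_trans r10 r1r2.
have Kr2 : Kb * r2 <= a * rL.
  apply: (sqrt_mul_le Kb0 (ltW a0) (ler0n _ _) (ltW Lr0)).
  have h2 : (size s2)%:R <= 2 * l%:R :> R by rewrite -natrM ler_nat.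
  have := ler_wpM2l (sqr_ge0 Kb) h2.
  have := ler_wpM2l (ltW a20) r_i; have := ler_wpM2r (ltW lr0) KJ.
  by clear - d0 kap0 K1 eta01 m00; lra.
pose del := (z - x) / J%:R.
have Jdel : x + J%:R * del = z by rewrite /del mulrCA divff ?gt_eqF// mulr1; ring.
have arL0 : 0 <= a * rL by rewrite mulr_ge0// ltW.
have hdel : `|del| <= r1 / 4.
  rewrite /del normrM normfV (ger0_norm (ltW J0)) ler_pdivrMr//.
  have : `|z - x| <= B * t * rL.
    by rewrite ler_norml; clear - d0 kap0 K1 eta01 m00 x1 x2 z1 z2 arL0; apply/andP; split; lra.
  by move: disp; clear - d0 kap0 K1 eta01 m00; lra.
have n1l : (n1 <= size s2)%N.
  by apply: leq_trans l_s2; exact: leq_trans Jl.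
have n2l : (n2 <= l)%N by exact: leq_trans Jl.
have Kxr : Kb2 * r1 <= x.
  by apply: le_trans x1; apply: le_trans Kr1; apply: ler_wpM2r => //; exact: ltW.
have Kzr : Kb2 * r1 <= z.
  by apply: le_trans z1; apply: le_trans Kr1; apply: ler_wpM2r => //; exact: ltW.
have step := @chain R d K kap eta m0 l Kb2 c2 c20.
have hch : c2 ^+ J <= PE s1 (fun ys => (surv x ys &&
      (z <= endpt x ys <= z + r1 / 4))%:R).
  rewrite -Jdel; apply: step => //.
  - move=> s' x' b' as' sz'; rewrite -sz'; apply: hw => //; by rewrite sz'.
  - by rewrite lexx lerDl divr_ge0// ltW.
  - by rewrite Jdel.
rewrite sE PE_cat.
apply: (@le_trans _ _ (PE s1 (fun ys => (surv x ys &&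
      (z <= endpt x ys <= z + r1 / 4))%:R) * (c1 / rL))); last first.
  rewrite -PEZr; apply: le_PE_supp; first exact: admissible_nonneg as1.
  move=> c cs; case: (boolP (surv x c)) => /= sc; last first.
    by rewrite mul0r PE_ge0//; exact: admissible_nonneg as2.
  have [/andP[zc1 zc2]|zc] := boolP (_ <= _ <= _); last first.
    by rewrite mul0r PE_ge0//; exact: admissible_nonneg as2.
  rewrite mul1r; under eq_PE do rewrite surv_cat sc endpt_cat /=.
  apply: (@le_trans _ _ (c1 / r2)).
    by rewrite ler_pM2l// lef_pV2 ?posrE.
  apply: hb => //; first by rewrite sE in reach; exact: reaches_cat reach cs.
    by rewrite ger0_norm ?subr_ge0// -/r2; clear - d0 kap0 K1 eta01 m00 zc1 zc2 r1r2 r10; lra.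
  rewrite -/r2; apply: le_trans z1; apply: le_trans Kr2.
  by apply: ler_wpM2r => //; exact: ltW.
rewrite mulrA; apply: ler_wpM2r; first by rewrite invr_ge0 ltW.
apply: (@le_trans _ _ (c2 ^+ J * c1)); last by apply: ler_wpM2r => //; exact: ltW.
have -> : - ((2 * ka / c2 + c1^-1) * t ^+ 2) =
   - (2 * (ka * t ^+ 2) / c2) + - (c1^-1 * t ^+ 2) by ring.
rewrite expRD; apply: ler_pM; rewrite ?expR_ge0//.
  apply: (@le_trans _ _ (expR (- c2^-1) ^+ J)); last first.
    by apply: lerXn2r; rewrite ?nnegrE ?expR_ge0 ?expRNV_le// ltW.
  rewrite -expRM_natr ler_expR mulNr lerN2 mulrC.
  by apply: ler_wpM2r; [rewrite invr_ge0 ltW|].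
apply: le_trans (expRNV_le c10); rewrite ler_expR lerN2.
by rewrite ler_peMr// invr_ge0 ltW.
Qed.

End crossing.

(** * Leaving the origin *)

Section leaving.
Context {R : realType} (d K kap eta : R) (m0 : nat).
Hypotheses (d0 : 0 < d) (kap0 : 0 < kap) (K1 : 1 <= K).
Hypotheses (eta01 : 0 < eta <= 1) (m00 : (0 < m0)%N).
Implicit Types (p : @law R) (s : seq (@law R)) (x z t u r : R).
Local Notation good := (good_law d K kap).
Local Notation adm := (admissible d K kap eta m0).

(** At the start, the test function is of order [th * (u + 1)]: this is where
    the distance to the origin enters. *)
Lemma sinh_corr_killed_le : exists x0 C : R, [/\ 1 <= x0, 0 < C &
  forall s th u, (forall p, p \in s -> good p) -> 0 < th <= d / 4 -> 0 <= u ->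
  PE s (fun ys => (surv u ys)%:R * sinh_corr d th (x0 + endpt u ys)) <=
  expR (C * (th ^+ 2 * (size s)%:R)) *
  (th * ((x0 + 1) * (u + 1)) * expR (th * (x0 + u)))].
Proof.
have [x0 [C [x01 C0 h]]] := sinh_corr_killed d0 kap0 K1.
exists x0, C; split=> // s th u gs thd u0; have /andP[th0 _] := thd.
apply: (le_trans (h s th u gs thd u0)).
rewrite -[C * th ^+ 2 * _]mulrA.
apply: ler_wpM2l; first exact: expR_ge0.
have xu0 : 0 <= x0 + u by lra.
apply: (le_trans (sinh_corr_le d (ltW th0) xu0)).
apply: ler_wpM2r; first exact: expR_ge0.
by apply: ler_wpM2l; [exact: ltW|nra].
Qed.

Lemma surv_pos_part s u : (forall p, p \in s -> good p) -> 0 <= u ->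
  u <= PE s (fun ys => (surv u ys)%:R * endpt u ys).
Proof.
elim: s u => [|p s IH] u gs u0 /=; first by rewrite mul1r.
have gp : good p by apply: gs; rewrite mem_head.
rewrite -{1}(good_affine u 1 gp); apply: le_Ex (good_nonneg gp) _ => y.
rewrite mul1r; have [uy|uy] := leP 0 (u + y).
  by apply: IH => // q qs; apply: gs; rewrite inE qs orbT.
by under eq_PE do rewrite mul0r; rewrite PE0 ltW.
Qed.

(** The positive part is subharmonic for the killed walk, and one step is
    enough to get a constant distance away from the origin. *)
Lemma surv_drift : exists2 c : R, 0 < c & forall s u,
  (forall p, p \in s -> good p) -> (0 < size s)%N -> 0 <= u ->
  c * (u + 1) <= PE s (fun ys => (surv u ys)%:R * endpt u ys).
Proof.
pose c := Num.min 1 (kap / 4) / 2.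
have h1 : Num.min 1 (kap / 4) <= 1 by rewrite ge_min lexx.
have h2 : Num.min 1 (kap / 4) <= kap / 4 by rewrite ge_min lexx orbT.
have h3 : 0 < Num.min 1 (kap / 4) by rewrite lt_min ltr01 divr_gt0.
exists c => [|[//|p s] u gs _ u0]; first by rewrite /c divr_gt0.
have gp : good p by apply: gs; rewrite mem_head.
have gs' q : q \in s -> good q by move=> qs; apply: gs; rewrite inE qs orbT.
have e1 : Ex p (fun y => Num.max (u + y) 0) <=
    PE (p :: s) (fun ys => (surv u ys)%:R * endpt u ys).
  apply: le_Ex (good_nonneg gp) _ => y.
  have [uy|uy] := leP (u + y) 0; last first.
    by have := surv_pos_part gs' (ltW uy); rewrite /= (ltW uy).
  apply: PE_ge0 => [q /gs' /good_nonneg//|ys] /=.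
  have [uy0|] := leP 0 (u + y); last by rewrite mul0r.
  case: (boolP (surv (u + y) ys)) => [|_]; last by rewrite mul0r.
  by move=> /(surv_endpt uy0); rewrite mul1r.
have e2 : u <= Ex p (fun y => Num.max (u + y) 0).
  rewrite -{1}(good_affine u 1 gp); apply: le_Ex (good_nonneg gp) _ => y.
  by rewrite mul1r le_max lexx.
have e3 : kap / 4 <= Ex p (fun y => Num.max (u + y) 0).
  apply: (le_trans (good_pos_part gp)); apply: le_Ex (good_nonneg gp) _ => y.
  by rewrite ge_max !le_max lexx orbT andbT; apply/orP; left; lra.
move: (Ex p _) (PE _ _) e1 e2 e3 h1 h2 h3; rewrite /c.
move: (Num.min _ _) => m A B e1 e2 e3 h1 h2 h3.
have : m * u <= u by rewrite ler_piMl.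
lra.
Qed.

(** By association, the mean of the endpoint on survival is at least the
    survival probability times the mean of its positive part, which is of the
    order of the square root of the length. *)
Lemma surv_upper : exists C : R, exists2 n0 : nat, 0 < C & forall s u, adm s ->
  (n0 <= size s)%N -> 0 <= u ->
  PE s (fun ys => (surv u ys)%:R) <= C * (u + 1) / Num.sqrt (size s)%:R.
Proof.
have [x0 [C [x01 C0 hH]]] := sinh_corr_killed_le.
have [Kb [c [n1 [Kb1 c0 hw]]]] := window kap d0 K1 eta01 m00.
have [n2 hn2] := sqrt_nat_ge (4 / d).
pose C' := expR C * (x0 + 1) * expR (x0 + 1).
have C'0 : 0 < C' by rewrite !mulr_gt0 ?expR_gt0//; lra.
exists (1 + 2 * C' / c), (maxn (maxn n1 n2) 1) => [|s u as_].
  by rewrite addr_gt0// divr_gt0// mulr_gt0.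
rewrite !geq_max -andbA => /and3P[sn1 /hn2 sn2 s1] u0.
set r := Num.sqrt _ in sn2 *.
have r0 : 0 < r by rewrite sqrtr_gt0 ltr0n.
have r2 : r ^+ 2 = (size s)%:R by rewrite sqr_sqrtr.
have sn := admissible_nonneg as_.
set P := PE s _.
have P1 : P <= 1.
  by rewrite -(adm_cst 1 as_); apply: le_PE => // ys; rewrite lern1 leq_b1.
have cC : 0 <= 2 * C' / c by apply: divr_ge0; [apply: mulr_ge0 => //|]; exact: ltW.
rewrite ler_pdivlMr//; have [ur|ru] := leP u r; last first.
  apply: (@le_trans _ _ r); first by rewrite ler_piMl// ltW.
  apply: (@le_trans _ _ (u + 1)); first by lra.
  by rewrite ler_peMl//; lra.
have s1r : 1 <= r ^+ 2 by rewrite r2 ler1n.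
have r1 : 1 <= r by rewrite -(@ler_pXn2r _ 2)// ?nnegrE ?expr1n// ltW.
pose th := r^-1.
have th0 : 0 < th by rewrite invr_gt0.
have thd : 0 < th <= d / 4.
  rewrite th0 /th /= -(invrK (d / 4)) lef_pV2 ?posrE ?invr_gt0 ?divr_gt0//.
  by rewrite invf_div.
pose f (x : R) := Num.max x 0.
have fm : {homo f : x y / x <= y}.
  by move=> x y xy; rewrite /f ge_max !le_max xy lexx orbT.
have up : PE s (fun ys => (surv u ys)%:R * f (endpt u ys)) <= C' * (u + 1).
  rewrite -(@ler_pM2l _ th)// -PEZ.
  apply: (@le_trans _ _ (PE s (fun ys => (surv u ys)%:R * sinh_corr d th (x0 + endpt u ys)))).
    apply: le_PE => // ys; case: (boolP (surv u ys)) => [sv|_]; last first.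
      by rewrite !mul0r mulr0.
    have e0 := surv_endpt u0 sv; rewrite !mul1r /f; have -> : Num.max (endpt u ys) 0 = endpt u ys.
      by apply/max_idPl.
    have xe : 0 <= x0 + endpt u ys by lra.
    apply: le_trans (sinh_corr_ge d0 (ltW th0) xe).
    by apply: ler_wpM2l; [exact: ltW|lra].
  apply: (le_trans (hH s th u as_.1 thd u0)).
  have -> : th ^+ 2 * (size s)%:R = 1.
    by rewrite -r2 /th -exprMn mulVf ?expr1n// gt_eqF.
  rewrite mulr1.
  have e1 : expR (th * (x0 + u)) <= expR (x0 + 1).
    rewrite ler_expR mulrDr; apply: lerD.
      rewrite ler_piMl//; first by lra.
      by rewrite /th invf_le1.
    by rewrite /th mulrC ler_pdivrMr// mul1r.
  have -> : th * (C' * (u + 1)) =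
      expR C * (th * ((x0 + 1) * (u + 1)) * expR (x0 + 1)) by rewrite /C'; ring.
  apply: ler_wpM2l; first exact: expR_ge0.
  by apply: ler_wpM2l => //; rewrite !mulr_ge0 ?(ltW th0)//; lra.
(* The displacement does not depend on the start: it is estimated from the
   height [Kb * r], where [window] applies. *)
have low : c * (r / 2) <= PE s (fun ys => f (endpt u ys)).
  pose x := Kb * r.
  have bx : `|(x + r / 2) - x| <= Num.sqrt (size s)%:R / 2.
    by rewrite addrAC subrr add0r ger0_norm// divr_ge0// ltW.
  have xK : Kb * Num.sqrt (size s)%:R <= x + r / 2.
    by rewrite lerDl divr_ge0// ltW.
  have := hw s x (x + r / 2) as_ sn1 bx xK; rewrite -/r => h.
  have r20 : 0 <= r / 2 by rewrite divr_ge0// ltW.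
  apply: (le_trans (ler_wpM2r r20 h)); rewrite -PEZr.
  apply: le_PE => // ys; rewrite /f.
  have [/andP[h1 _]|_] := boolP (x + r / 2 <= endpt x ys <= x + r / 2 + r / 4); last first.
    by rewrite andbF mul0r le_max lexx orbT.
  rewrite le_max; apply/orP; left.
  move: h1; rewrite (endptE x) (endptE u) => h1.
  case: surv => /=; rewrite ?mul1r ?mul0r; lra.
have assoc := surv_assoc u as_.1 fm; rewrite -/P in assoc.
have P0 : 0 <= P by exact: PE_ge0.
have h1 := ler_wpM2l P0 low.
have h2 : P * (c * (r / 2)) <= C' * (u + 1) by exact: le_trans h1 (le_trans assoc up).
have : P * r <= 2 * C' / c * (u + 1).
  rewrite -(@ler_pM2l _ (c / 2)) ?divr_gt0//.
  have -> : c / 2 * (2 * C' / c * (u + 1)) = C' * (u + 1) by field; rewrite gt_eqF.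
  by move: h2; rewrite (_ : P * (c * (r / 2)) = c / 2 * (P * r))//; ring.
by rewrite mulrDl mul1r; move: (P * r) => a ha; lra.
Qed.

(** A Gaussian tail on top of survival: the test function at the frequency
    [eps * t / r] sees both the distance [u + 1] to the origin and the
    exponential moment that controls a deviation of order [t * r]. *)
Lemma surv_high : exists C c N0 t0 : R, [/\ 0 < C, 0 < c, 1 <= N0, 1 <= t0 &
  forall s u t r, (forall p, p \in s -> good p) -> t0 <= t -> 0 < r ->
  N0 * t ^+ 2 <= r ^+ 2 -> (size s)%:R <= r ^+ 2 -> 0 <= u <= r ->
  PE s (fun ys => (surv u ys && (3 / 4 * t * r <= endpt u ys))%:R) <=
  C * (u + 1) / r * expR (- (c * t ^+ 2))].
Proof.
have [x0 [C [x01 C0 hH]]] := sinh_corr_killed_le.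
(* In units of [eps * t ^+ 2], the gain in the exponent is 3/4; the growth of
   the test function costs 1/8, the start 1/4, and the factor [t] 1/8. *)
have [eps epsE] : {eps : R | eps = (8 * C + 1)^-1} by eexists.
have eps0 : 0 < eps by rewrite epsE invr_gt0; lra.
have Ceps : C * eps <= 1 / 8.
  by rewrite epsE ler_pdivrMr; lra.
pose N0 := 1 + (4 * eps / d) ^+ 2.
pose D := 32 * (x0 + 1) * expR (d / 4 * x0).
exists D, (eps / 4), N0, (4 + 2 / eps); split.
- by rewrite /D !mulr_gt0 ?expR_gt0//; lra.
- by rewrite divr_gt0.
- by rewrite lerDl sqr_ge0.
- by have : 0 < 2 / eps by [rewrite divr_gt0]; lra.
move=> s u t r gs tt r0 Nt sr /andP[u0 ur].
have t4 : 4 <= t by apply: le_trans tt; rewrite lerDl divr_ge0// ltW.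
have te : 2 <= eps * t.
  by rewrite mulrC -ler_pdivrMr//; apply: le_trans tt; rewrite lerDr.
have t0 : 0 < t by lra.
have [th thE] : {th : R | th = eps * t / r} by eexists.
have th0 : 0 < th by rewrite thE; apply: divr_gt0 => //; exact: mulr_gt0.
have thd : th <= d / 4.
  have q0 : 0 <= 4 * eps / d * t.
    apply: mulr_ge0; last exact: ltW.
    by apply: divr_ge0; [apply: mulr_ge0 => //; exact: ltW|exact: ltW].
  rewrite thE ler_pdivrMr//.
  have hq : (4 * eps / d * t) ^+ 2 <= r ^+ 2.
    rewrite exprMn; apply: le_trans Nt; apply: ler_wpM2r; first exact: sqr_ge0.
    by rewrite /N0 lerDr.
  have : 4 * eps / d * t <= r.
    by rewrite -(@ler_pXn2r _ 2)// nnegrE ?q0// ltW.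
  rewrite -(@ler_pM2l _ (d / 4)) ?divr_gt0//.
  by rewrite (_ : d / 4 * (4 * eps / d * t) = eps * t)//; field; rewrite gt_eqF.
set P := PE s _.
have thr : th * r = eps * t by rewrite thE divfK// gt_eqF.
have sn : nonneg_laws s by move=> q /gs /good_nonneg.
pose E := expR (3 / 4 * (eps * t ^+ 2)).
have et8 : 2 * t <= eps * t ^+ 2 by rewrite expr2; nra.
have E2 : 2 <= E.
  by apply: le_trans (expR_ge1Dx _); lra.
have h1 : P * (E / 4) <= PE s (fun ys => (surv u ys)%:R * sinh_corr d th (x0 + endpt u ys)).
  rewrite /P -PEZr; apply: le_PE => // ys.
  case: (boolP (surv u ys)) => [sv|_] /=; last by rewrite !mul0r.
  have e0 := surv_endpt u0 sv.
  have xe : 0 <= x0 + endpt u ys by lra.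
  have [hi|_] := leP (3 / 4 * t * r) (endpt u ys); last first.
    by rewrite mul0r mul1r sinh_corr_ge0// ltW.
  rewrite !mul1r; apply: le_trans (sinh_corr_ge_exp d0 (ltW th0) xe).
  have : E <= expR (th * (x0 + endpt u ys)).
    rewrite ler_expR; apply: (@le_trans _ _ (th * (3 / 4 * t * r))).
      by rewrite (_ : th * (3 / 4 * t * r) = 3 / 4 * t * (th * r)); [rewrite thr expr2; lra|ring].
    by apply: ler_wpM2l; [exact: ltW|lra].
  by move: E2; lra.
have h2 : P * (E / 4) <= expR (1 / 8 * (eps * t ^+ 2)) *
    (th * ((x0 + 1) * (u + 1)) * (expR (d / 4 * x0) * expR (1 / 4 * (eps * t ^+ 2)))).
  have thth : 0 < th <= d / 4 by rewrite th0.
  apply: (le_trans h1); apply: (le_trans (hH s th u gs thth u0)).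
  apply: ler_pM; rewrite ?expR_ge0//.
  - by rewrite !mulr_ge0 ?expR_ge0 ?(ltW th0)//; lra.
  - rewrite ler_expR; apply: (@le_trans _ _ (C * (eps * t) ^+ 2)).
      apply: ler_wpM2l; first exact: ltW.
      by rewrite -thr exprMn; apply: ler_wpM2l => //; exact: sqr_ge0.
    have -> : C * (eps * t) ^+ 2 = C * eps * (eps * t ^+ 2) by ring.
    by apply: ler_wpM2r => //; rewrite mulr_ge0 ?sqr_ge0// ltW.
  - apply: ler_wpM2l; first by rewrite !mulr_ge0 ?(ltW th0)//; lra.
    rewrite -expRD ler_expR mulrDr; apply: lerD.
      by apply: ler_wpM2r => //; lra.
    apply: (@le_trans _ _ (th * r)); first by apply: ler_wpM2l => //; exact: ltW.
    rewrite thr expr2; have : eps * t * 4 <= eps * t * t by apply: ler_wpM2l => //; lra.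
    by lra.
have h3 : t <= 8 / eps * expR (1 / 8 * (eps * t ^+ 2)).
  have := expR_ge_id (1 / 8 * (eps * t ^+ 2)).
  rewrite -(@ler_pM2l _ (8 / eps)) ?divr_gt0//; apply: le_trans.
  rewrite (_ : 8 / eps * (1 / 8 * (eps * t ^+ 2)) = t ^+ 2); last by field; rewrite gt_eqF.
  by rewrite expr2; nra.
set e := eps * t ^+ 2 in et8 E E2 h1 h2 h3 *.
have h4 : P * E <= 4 * eps * (x0 + 1) * expR (d / 4 * x0) * ((u + 1) / r) *
    (8 / eps * expR (1 / 2 * e)).
  have -> : expR (1 / 2 * e) = expR (1 / 8 * e) * expR (1 / 4 * e) * expR (1 / 8 * e).
    by rewrite -!expRD; congr expR; lra.
  have g0 : 0 <= 4 * eps * (x0 + 1) * expR (d / 4 * x0) * ((u + 1) / r) *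
      (expR (1 / 8 * e) * expR (1 / 4 * e)).
    rewrite !mulr_ge0 ?expR_ge0 ?invr_ge0 ?(ltW eps0) ?(ltW r0)//; lra.
  have := ler_wpM2l g0 h3.
  have -> : 4 * eps * (x0 + 1) * expR (d / 4 * x0) * ((u + 1) / r) *
      (expR (1 / 8 * e) * expR (1 / 4 * e)) * t =
      4 * (expR (1 / 8 * e) * (th * ((x0 + 1) * (u + 1)) *
      (expR (d / 4 * x0) * expR (1 / 4 * e)))) by rewrite thE; field; rewrite gt_eqF.
  move=> h; apply: (@le_trans _ _ (4 * (P * (E / 4)))); first by lra.
  apply: (le_trans (ler_wpM2l _ h2)) => //.
  apply: (le_trans h); rewrite le_eqVlt; apply/orP; left; apply/eqP; ring.
have -> : eps / 4 * t ^+ 2 = 1 / 4 * e by rewrite /e; ring.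
have EE : E * expR (- (1 / 4 * e)) = expR (1 / 2 * e).
  by rewrite /E -expRD; congr expR; lra.
have E0 : 0 < E by exact: expR_gt0.
rewrite -(@ler_pM2r _ E)//; apply: (le_trans h4).
rewrite -[leRHS]mulrA (mulrC (expR _)) EE /D le_eqVlt; apply/orP; left; apply/eqP.
by field; rewrite !gt_eqF.
Qed.

End leaving.

Section leaving_window.
Context {R : realType} (d K kap eta : R) (m0 : nat).
Hypotheses (d0 : 0 < d) (kap0 : 0 < kap) (K1 : 1 <= K).
Hypotheses (eta01 : 0 < eta <= 1) (m00 : (0 < m0)%N).
Implicit Types (p : @law R) (s : seq (@law R)) (x z t u r : R).
Local Notation good := (good_law d K kap).
Local Notation adm := (admissible d K kap eta m0).

(** On survival, the endpoint has a mean of order [u + 1].  The part of it below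
    [a * r] is small because survival has probability of order [(u + 1) / r];
    the part above [B * r] is small because the test function of the killed
    walk dominates a cube.  What remains is at most [B * r] times the
    probability of the window. *)
Lemma surv_window_small : exists a B c : R, exists n0 : nat,
  [/\ 0 < a, 1 <= B, 0 < c & forall s u r, adm s -> (n0 <= size s)%N -> 0 < r ->
  (size s)%:R <= r ^+ 2 <= 7 * (size s)%:R -> 0 <= u <= r ->
  c * (u + 1) / r <=
  PE s (fun ys => (surv u ys && (a * r <= endpt u ys <= B * r))%:R)].
Proof.
have [x0 [C [x01 C0 hH]]] := sinh_corr_killed_le d0 kap0 K1.
have [c3 c30 hdrift] := surv_drift d K kap0.
have [C7 [n1 C70 hup]] := surv_upper d0 kap0 K1 eta01 m00.
have [n2 hn2] := sqrt_nat_ge (4 / d).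
have [C5 C5E] : {C5 : R | C5 = 12 * expR C * (x0 + 1) * expR (x0 + 1)} by eexists.
have C50 : 0 < C5 by rewrite C5E !mulr_gt0 ?expR_gt0//; lra.
have [a aE] : {a : R | a = c3 / (12 * C7)} by eexists.
have a0 : 0 < a by rewrite aE divr_gt0// mulr_gt0.
have [B BE] : {B : R | B = 4 * C5 / c3 + 1} by eexists.
have C5c : 0 < 4 * C5 / c3 by rewrite divr_gt0// mulr_gt0.
have B1 : 1 <= B by lra.
have B0 : 0 < B by lra.
exists a, B, (c3 / (2 * B)), (maxn (maxn n1 n2) 1); split=> //.
  by rewrite divr_gt0// mulr_gt0.
move=> s u r as_; rewrite !geq_max -andbA => /and3P[sn1 /hn2 sn2 s1] r0.
move=> /andP[sr rs] /andP[u0 ur].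
have sn := admissible_nonneg as_.
set q := Num.sqrt _ in sn2.
have q0 : 0 < q by rewrite sqrtr_gt0 ltr0n.
have q2 : q ^+ 2 = (size s)%:R by rewrite sqr_sqrtr.
have qr : q <= r by rewrite -(@ler_pXn2r _ 2)// ?nnegrE ?(ltW q0) ?(ltW r0)// q2.
have rq : r <= 3 * q.
  rewrite -(@ler_pXn2r _ 2)// ?nnegrE ?(ltW r0)// ?mulr_ge0 ?(ltW q0)//.
  rewrite exprMn q2; apply: (le_trans rs); apply: ler_wpM2r => //; lra.
have s1r : 1 <= r ^+ 2 by apply: le_trans sr; rewrite ler1n.
have r1 : 1 <= r by rewrite -(@ler_pXn2r _ 2)// ?nnegrE ?expr1n// ltW.
have [th thE] : {th : R | th = r^-1} by eexists.
have th0 : 0 < th by rewrite thE invr_gt0.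
have thr : th * r = 1 by rewrite thE mulVf// gt_eqF.
have thd : 0 < th <= d / 4.
  rewrite th0 thE /= -(invrK (d / 4)) lef_pV2 ?posrE ?invr_gt0 ?divr_gt0//.
  by rewrite invf_div; exact: le_trans qr.
set W := PE s _.
pose S3 := PE s (fun ys => (surv u ys)%:R * sinh_corr d th (x0 + endpt u ys)).
have hS3 : S3 * 12 * r <= C5 * (u + 1).
  have h := hH s th u as_.1 thd u0; rewrite -/S3 in h.
  have e1 : expR (th * (x0 + u)) <= expR (x0 + 1).
    rewrite ler_expR mulrDr; apply: lerD.
      by rewrite ler_piMl//; [lra|rewrite thE invf_le1].
    by rewrite -thr; apply: ler_wpM2l => //; exact: ltW.
  have e2 : expR (C * (th ^+ 2 * (size s)%:R)) <= expR C.
    rewrite ler_expR -[leRHS]mulr1; apply: ler_wpM2l; first exact: ltW.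
    apply: (@le_trans _ _ (th ^+ 2 * r ^+ 2)).
      by apply: ler_wpM2l => //; exact: sqr_ge0.
    by rewrite -exprMn thr expr1n.
  have xu0 : 0 <= (x0 + 1) * (u + 1) by rewrite mulr_ge0//; lra.
  have h2 : S3 <= expR C * (th * ((x0 + 1) * (u + 1)) * expR (x0 + 1)).
    apply: (le_trans h); apply: ler_pM; rewrite ?expR_ge0//.
      by rewrite mulr_ge0 ?expR_ge0// mulr_ge0// ltW.
    by apply: ler_wpM2l => //; rewrite mulr_ge0// ltW.
  have r12 : 0 <= 12 * r by rewrite mulr_ge0// ltW.
  rewrite -mulrA; apply: (le_trans (ler_wpM2r r12 h2)); rewrite C5E.
  rewrite le_eqVlt; apply/orP; left; apply/eqP.
  rewrite (_ : expR C * (th * ((x0 + 1) * (u + 1)) * expR (x0 + 1)) * (12 * r) =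
    expR C * ((th * r) * ((x0 + 1) * (u + 1)) * expR (x0 + 1)) * 12); last by ring.
  by rewrite thr; ring.
pose P := PE s (fun ys => (surv u ys)%:R).
have hP : P * r <= 3 * C7 * (u + 1).
  have := hup s u as_ sn1 u0; rewrite -/P -/q ler_pdivlMr// => h.
  have P0 : 0 <= P by exact: PE_ge0.
  have := ler_wpM2l P0 rq; lra.
have key : c3 * (u + 1) <= a * r * P + B * r * W + 12 * r / B ^+ 2 * S3.
  apply: (le_trans (hdrift s u as_.1 s1 u0)).
  rewrite -!PEZ -!PED; apply: le_PE => // ys.
  case: (boolP (surv u ys)) => [sv|_] /=; last by rewrite !(mul0r, mulr0, addr0).
  have e0 := surv_endpt u0 sv; rewrite !mul1r mulr1.
  set e := endpt u ys in e0 *.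
  have xe : 0 <= x0 + e by lra.
  have H0 := sinh_corr_ge0 d0 (ltW th0) xe.
  have coef : 0 <= 12 * r / B ^+ 2 by rewrite divr_ge0 ?sqr_ge0// mulr_ge0// ltW.
  have HS := mulr_ge0 coef H0.
  have ar0 : 0 <= a * r by rewrite mulr_ge0// ltW.
  have Br0 : 0 <= B * r by rewrite mulr_ge0// ltW.
  have [ea|ea] := leP (a * r) e; last first.
    by rewrite mulr0; lra.
  have [eB|eB] := leP e (B * r); first by rewrite mulr1; lra.
  rewrite mulr0 addr0.
  suff : e <= 12 * r / B ^+ 2 * sinh_corr d th (x0 + e) by lra.
  have h1 : (th * e) ^+ 3 / 12 <= sinh_corr d th (x0 + e).
    apply: le_trans (sinh_corr_ge_cube d0 (ltW th0) xe).
    rewrite ler_pM2r ?invr_gt0//; apply: lerXn2r; rewrite ?nnegrE ?mulr_ge0 ?(ltW th0)//.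
    by apply: ler_wpM2l; [exact: ltW|lra].
  apply: le_trans (ler_wpM2l coef h1).
  have -> : 12 * r / B ^+ 2 * ((th * e) ^+ 3 / 12) = e * ((th * e) ^+ 2 / B ^+ 2).
    rewrite (_ : 12 * r / B ^+ 2 * ((th * e) ^+ 3 / 12) =
      (th * r) * (e * ((th * e) ^+ 2 / B ^+ 2))); last first.
      by field; rewrite gt_eqF.
    by rewrite thr mul1r.
  rewrite -[leLHS]mulr1; apply: ler_wpM2l => //.
  rewrite ler_pdivlMr ?exprn_gt0// mul1r.
  apply: lerXn2r; rewrite ?nnegrE ?mulr_ge0 ?(ltW th0) ?(ltW B0)//.
  rewrite -(@ler_pM2r _ r)// (_ : th * e * r = th * r * e); last by ring.
  by rewrite thr mul1r ltW.
have h1 : a * r * P <= c3 / 4 * (u + 1).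
  have := ler_wpM2l (ltW a0) hP.
  rewrite (_ : a * (3 * C7 * (u + 1)) = c3 / 4 * (u + 1)); last first.
    by rewrite aE; field; rewrite gt_eqF.
  by rewrite mulrA (mulrC _ r) mulrA (mulrC r).
have h2 : 12 * r / B ^+ 2 * S3 <= c3 / 4 * (u + 1).
  have u1 : 0 <= u + 1 by lra.
  rewrite (_ : 12 * r / B ^+ 2 * S3 = S3 * 12 * r / B ^+ 2); last by ring.
  rewrite ler_pdivrMr ?exprn_gt0//; apply: (le_trans hS3).
  rewrite mulrAC; apply: ler_wpM2r => //.
  have : C5 = c3 / 4 * (4 * C5 / c3) by field; rewrite gt_eqF.
  move=> {1}->; apply: ler_wpM2l; first by rewrite divr_ge0// ltW.
  by rewrite expr2; nra.
rewrite ler_pdivrMr// -(@ler_pM2l _ (2 * B)) ?mulr_gt0//.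
rewrite (_ : 2 * B * (c3 / (2 * B) * (u + 1)) = c3 * (u + 1)); last first.
  by field; rewrite gt_eqF.
by move: key h1 h2; lra.
Qed.

(** A path that survives from [r] survives from any start above [r], where it
    ends higher by the difference of the starts. *)
Lemma surv_window : exists a B c : R, exists n0 : nat,
  [/\ 0 < a, 1 <= B, 0 < c & forall s u r, adm s -> (n0 <= size s)%N -> 0 < r ->
  (size s)%:R <= r ^+ 2 <= 7 * (size s)%:R -> 0 <= u ->
  c * Num.min (u + 1) r / r <= PE s (fun ys => (surv u ys &&
    (a * r <= endpt u ys <= Num.max u r + B * r))%:R)].
Proof.
have [a [B [c [n0 [a0 B1 c0 h]]]]] := surv_window_small.
exists a, B, c, n0; split=> // s u r as_ sn r0 sr u0.
have sn0 := admissible_nonneg as_.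
have Br0 : 0 <= B * r by rewrite mulr_ge0// ?(ltW r0)//; lra.
have m1 : Num.min (u + 1) r <= u + 1 by rewrite ge_min lexx.
have m2 : Num.min (u + 1) r <= r by rewrite ge_min lexx orbT.
have [ur|ru] := leP u r.
  have ur' : 0 <= u <= r by rewrite u0.
  apply: (@le_trans _ _ (c * (u + 1) / r)).
    by apply: ler_wpM2r; [rewrite invr_ge0 ltW|apply: ler_wpM2l => //; exact: ltW].
  apply: le_trans (h s u r as_ sn r0 sr ur') _; apply: le_PE => // ys.
  rewrite ler_nat; case: surv => //=.
  have [/andP[-> h2]|//] := boolP (a * r <= endpt u ys <= B * r).
  by rewrite /= (le_trans h2)// lerDr ltW.
have rr : 0 <= r <= r by rewrite lexx ltW.
apply: (@le_trans _ _ (c * (r + 1) / r)).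
  apply: ler_wpM2r; first by rewrite invr_ge0 ltW.
  by apply: ler_wpM2l; [exact: ltW|lra].
apply: le_trans (h s r r as_ sn r0 sr rr) _; apply: le_PE => // ys.
rewrite ler_nat; case: (boolP (surv r ys)) => //= sr'.
rewrite (surv_le (ltW ru) sr') /=.
have [/andP[h1 h2]|//] := boolP (a * r <= endpt r ys <= B * r).
suff -> : a * r <= endpt u ys <= u + B * r by [].
by move: h1 h2; rewrite (endptE r) (endptE u) => h1 h2; apply/andP; split; lra.
Qed.

End leaving_window.

(** * Excursions under finitely supported laws *)

Section excursions.
Context {R : realType} (d K kap eta : R) (m0 : nat).
Hypotheses (d0 : 0 < d) (kap0 : 0 < kap) (K1 : 1 <= K).
Hypotheses (eta01 : 0 < eta <= 1) (m00 : (0 < m0)%N).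
Implicit Types (p : @law R) (s : seq (@law R)) (x z t u v r h : R).
Local Notation good := (good_law d K kap).
Local Notation adm := (admissible d K kap eta m0).

Definition excursion u v h (k : nat) (ys : seq R) : bool :=
  [&& surv u ys, h <= endpt u (take k ys) & endpt u ys == v].

Lemma rev_stepsK : involutive (@rev_steps R).
Proof.
move=> ys; rewrite /rev_steps map_rev revK -map_comp -[RHS]map_id.
by apply: eq_map => y /=; rewrite opprK.
Qed.

(** Four stretches of comparable lengths; the height is tested between the
    second and the third. *)
Lemma split_four (T : Type) (s : seq T) (k : nat) : (42 <= size s)%N ->
  (size s <= 3 * k <= 2 * size s)%N -> exists s1 s2 s3 s4 : seq T,
  [/\ s = s1 ++ (s2 ++ (s3 ++ s4)), (size s1 + size s2 = k)%N,
      (size s <= 7 * size s1)%N /\ (size s <= 7 * size s2)%N &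
      (size s <= 7 * size s3)%N /\ (size s <= 7 * size s4)%N].
Proof.
set n := size s => n42 nk; pose m := (n %/ 6)%N.
exists (take m s), (take (k - m) (drop m s)),
  (take (n - m - k) (drop k s)), (drop (n - m) s).
have [m1 m2 m3] : [/\ (m <= k)%N, (n <= 7 * m)%N & (n <= 7 * (k - m))%N].
  by move: n42 nk; rewrite /m; clearbody n; clear; move=> *; split; lia.
have [m4 m5] : (n <= 7 * (n - m - k))%N /\ (k <= n - m)%N.
  by move: n42 nk; rewrite /m; clearbody n; clear; move=> *; split; lia.
have mn : (m <= n)%N by rewrite leq_div.
have sz2 : size (take (k - m) (drop m s)) = (k - m)%N.
  by rewrite size_takel// size_drop -/n leq_sub2r// (leq_trans m5)// leq_subr.
have sz3 : size (take (n - m - k) (drop k s)) = (n - m - k)%N.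
  by rewrite size_takel// size_drop -/n leq_sub2r// leq_subr.
have sz1 : size (take m s) = m by rewrite size_takel.
have sz4 : size (drop (n - m) s) = m by rewrite size_drop -/n subKn.
rewrite sz1 sz2 sz3 sz4; split=> //; last by rewrite subnKC.
have -> : take (n - m - k) (drop k s) ++ drop (n - m) s = drop k s.
  rewrite -{2}(cat_take_drop (n - m - k) (drop k s)) drop_drop.
  by rewrite subnK.
have -> : take (k - m) (drop m s) ++ drop k s = drop m s.
  by rewrite -{2}(cat_take_drop (k - m) (drop m s)) drop_drop subnK.
by rewrite cat_take_drop.
Qed.

Lemma excursion_cat u v h k a b c e : (size a + size b = k)%N ->
  excursion u v h k (a ++ (b ++ (c ++ e))) =
  let x := endpt u a in let w := endpt x b in let z := endpt w c in
  [&& surv u a, surv x b, surv w c & surv z e] && ((h <= w) && (endpt z e == v)).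
Proof.
move=> szk; rewrite /excursion !surv_cat !endpt_cat /= -szk.
rewrite takeD takel_cat// take_size drop_size_cat// take_size_cat// endpt_cat.
by rewrite -!andbA.
Qed.

(** The optimal frequency for a deviation of order [t * r] is of order [t / r];
    the condition on [t] keeps it in the range of the exponential moments. *)
Lemma PE_height : exists c N0 : R, [/\ 0 < c, 1 <= N0 &
  forall s x t r h, (forall p, p \in s -> good p) -> 1 <= t -> 0 < r ->
  N0 * t ^+ 2 <= r ^+ 2 -> (size s)%:R <= r ^+ 2 -> x + t * r / 4 <= h ->
  PE s (fun ys => (h <= endpt x ys)%R%:R) <= expR (- (c * t ^+ 2))].
Proof.
have [M ME] : {M : R | M = mgf_const d K} by eexists.
have M0 : 0 <= M.
  rewrite ME; apply: mulr_ge0; last by apply: le_trans K1.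
  by apply: divr_ge0 => //; apply: exprn_ge0; exact: ltW.
have [eps epsE] : {eps : R | eps = (8 * M + 1)^-1} by eexists.
have eps0 : 0 < eps by rewrite epsE invr_gt0; lra.
have Meps : M * eps <= 1 / 8 by rewrite epsE ler_pdivrMr; lra.
exists (eps / 8), (1 + (2 * eps / d) ^+ 2); split.
- by rewrite divr_gt0.
- by rewrite lerDl sqr_ge0.
move=> s x t r h gs t1 r0 Nt sr xh.
have t0 : 0 < t by lra.
have [th thE] : {th : R | th = eps * t / r} by eexists.
have th0 : 0 < th by rewrite thE; apply: divr_gt0 => //; exact: mulr_gt0.
have thr : th * r = eps * t by rewrite thE divfK// gt_eqF.
have thd : 0 <= th <= d / 2.
  rewrite (ltW th0) /= thE ler_pdivrMr//.
  have q0 : 0 <= 2 * eps / d * t.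
    apply: mulr_ge0; last exact: ltW.
    by apply: divr_ge0; [apply: mulr_ge0 => //; exact: ltW|exact: ltW].
  have hq : (2 * eps / d * t) ^+ 2 <= r ^+ 2.
    rewrite exprMn; apply: le_trans Nt; apply: ler_wpM2r; first exact: sqr_ge0.
    by rewrite lerDr.
  have : 2 * eps / d * t <= r by rewrite -(@ler_pXn2r _ 2)// nnegrE ?q0// ltW.
  rewrite -(@ler_pM2l _ (d / 2)) ?divr_gt0//.
  by rewrite (_ : d / 2 * (2 * eps / d * t) = eps * t)//; field; rewrite gt_eqF.
apply: (le_trans (PE_chernoff d0 x h gs thd)); rewrite -ME ler_expR.
have h1 : M * th ^+ 2 * (size s)%:R <= 1 / 8 * (eps * t ^+ 2).
  apply: (@le_trans _ _ (M * th ^+ 2 * r ^+ 2)).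
    by apply: ler_wpM2l => //; apply: mulr_ge0 => //; exact: sqr_ge0.
  rewrite (_ : M * th ^+ 2 * r ^+ 2 = M * (th * r) ^+ 2); last by ring.
  rewrite thr (_ : M * (eps * t) ^+ 2 = M * eps * (eps * t ^+ 2)); last by ring.
  by apply: ler_wpM2r => //; rewrite mulr_ge0 ?sqr_ge0// ltW.
have h2 : 1 / 4 * (eps * t ^+ 2) <= th * (h - x).
  apply: (@le_trans _ _ (th * (t * r / 4))).
    rewrite (_ : th * (t * r / 4) = th * r * t / 4); last by ring.
    by rewrite thr expr2; lra.
  by apply: ler_wpM2l; [exact: ltW|lra].
lra.
Qed.

(** ** Upper bound *)

(** The trivial bound 1 is the better one when the start is above [r]. *)
Lemma surv_min : exists C : R, exists2 n0 : nat, 1 <= C & forall s u r, adm s ->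
  (n0 <= size s)%N -> 1 <= r -> r ^+ 2 <= 7 * (size s)%:R -> 0 <= u ->
  PE s (fun ys => (surv u ys)%:R) <= C * Num.min (u + 1) r / r.
Proof.
have [C [n0 C0 h]] := surv_upper d0 kap0 K1 eta01 m00.
exists (1 + 6 * C), (maxn n0 1) => [|s u r as_]; first by lra.
rewrite geq_max => /andP[sn s1] r1 rs u0.
have r0 : 0 < r by lra.
set P := PE s _.
have sn0 := admissible_nonneg as_.
have P0 : 0 <= P by exact: PE_ge0.
have P1 : P <= 1.
  by rewrite -(adm_cst 1 as_); apply: le_PE => // ys; rewrite lern1 leq_b1.
rewrite ler_pdivlMr//.
have hr : P * r <= (1 + 6 * C) * r.
  by apply: ler_wpM2r; [exact: ltW|lra].
have hu : P * r <= (1 + 6 * C) * (u + 1).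
  have := h s u as_ sn u0; rewrite -/P.
  set q := Num.sqrt _.
  have q0 : 0 < q by rewrite sqrtr_gt0 ltr0n.
  have q2 : q ^+ 2 = (size s)%:R by rewrite sqr_sqrtr.
  have rq : r <= 3 * q.
    rewrite -(@ler_pXn2r _ 2)// ?nnegrE ?(ltW r0)// ?mulr_ge0 ?(ltW q0)//.
    by rewrite exprMn q2; apply: (le_trans rs); apply: ler_wpM2r => //; lra.
  rewrite ler_pdivlMr// => hq.
  have := ler_wpM2l P0 rq.
  have : 0 <= C * (u + 1) by rewrite mulr_ge0// ?(ltW C0)//; lra.
  lra.
by case: (leP (u + 1) r).
Qed.

(** Of the constraints, keep survival on the first stretch, the height at time
    [k], and survival of the reversed walk on the last stretch.  The third
    stretch has to join two given points, which costs [1 / r] by the local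
    limit bound, uniformly in these points.  The height is reached either on
    the first stretch, by [surv_high], or on the second, by [PE_height]; in both
    cases the factor of survival from [u] is kept. *)
Lemma excursion_upper : exists C c N0 t0 : R, exists n0 : nat,
  [/\ 0 < C, 0 < c, 1 <= t0 & forall s u v t (k : nat),
  adm s -> adm (rev_laws s) -> (n0 <= size s)%N ->
  (size s <= 3 * k <= 2 * size s)%N -> t0 <= t -> N0 * t ^+ 2 <= (size s)%:R ->
  let r := Num.sqrt (size s)%:R in
  0 <= u <= 1 / 2 * t * r -> 0 <= v ->
  PE s (fun ys => (excursion u v (t * r) k ys)%:R) <=
  C * (Num.min (u + 1) r / r) * (Num.min (v + 1) r / r) / r *
  expR (- (c * t ^+ 2))].
Proof.
have [C1 C10 hloc] := local_upper d K kap eta01 m00.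
have [C2 [n2 C21 hsurv]] := surv_min.
have [C3 [c3 [N3 [t3 [C30 c30 N31 t31 hhigh]]]]] := surv_high d0 kap0 K1.
have [c4 [N4 [c40 N41 hch]]] := PE_height.
pose c := Num.min c3 c4.
have cc3 : c <= c3 by rewrite ge_min lexx.
have cc4 : c <= c4 by rewrite ge_min lexx orbT.
have c0 : 0 < c by rewrite lt_min c30.
pose C5 := C2 + 2 * C3 + 2.
exists (3 * C1 * C2 * C5), c, (N3 + N4), t3, (maxn 42 (7 * n2)); split=> //.
  by rewrite !mulr_gt0 /C5//; lra.
move=> s u v t k as_ ars; rewrite geq_max => /andP[n42 sn2] nk tt hN r.
move=> /andP[u0 ut] v0.
have [s1 [s2 [s3 [s4 [sE szk [l1 l2] [l3 l4]]]]]] := split_four n42 nk.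
have n0 : (0 < size s)%N by apply: leq_trans n42.
have r0 : 0 < r by rewrite sqrtr_gt0 ltr0n.
have r2 : r ^+ 2 = (size s)%:R by rewrite sqr_sqrtr.
have s1r : 1 <= r ^+ 2 by rewrite r2 ler1n.
have r1 : 1 <= r by rewrite -(@ler_pXn2r _ 2)// ?nnegrE ?expr1n// ltW.
have t1 : 1 <= t by lra.
have t20 : 0 <= t ^+ 2 by exact: sqr_ge0.
have hN3 : N3 * t ^+ 2 <= r ^+ 2.
  by rewrite r2; apply: le_trans hN; apply: ler_wpM2r => //; lra.
have hN4 : N4 * t ^+ 2 <= r ^+ 2.
  by rewrite r2; apply: le_trans hN; apply: ler_wpM2r => //; lra.
have [a1 [a2 [a3 a4]]] : adm s1 /\ adm s2 /\ adm s3 /\ adm s4.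
  move: as_; rewrite sE => /admissible_cat[? /admissible_cat[? /admissible_cat[? ?]]].
  by [].
have ar4 : adm (rev_laws s4).
  move: ars; rewrite sE !rev_laws_cat => /admissible_cat[+ _].
  by move=> /admissible_cat[+ _] => /admissible_cat[].
have [p1 p2 p3 p4] : [/\ nonneg_laws s1, nonneg_laws s2, nonneg_laws s3 & nonneg_laws s4].
  by split; [exact: admissible_nonneg a1|exact: admissible_nonneg a2
            |exact: admissible_nonneg a3|exact: admissible_nonneg a4].
have szs : size s = (size s1 + (size s2 + (size s3 + size s4)))%N.
  by rewrite sE !size_cat.
have ls1 : (size s1)%:R <= r ^+ 2.
  by rewrite r2 ler_nat szs leq_addr.
have ls2 : (size s2)%:R <= r ^+ 2.
  by rewrite r2 ler_nat szs addnCA leq_addr.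
pose M := 3 * C1 / r.
pose Pv := PE s4 (fun e => (surv v (rev_steps e))%:R).
pose X := PE s1 (fun a => (surv u a)%:R *
  PE s2 (fun b => (t * r <= endpt (endpt u a) b)%R%:R)).
have M0 : 0 <= M by rewrite divr_ge0 ?mulr_ge0 ?(ltW C10)// ltW.
have step1 : PE s (fun ys => (excursion u v (t * r) k ys)%:R) <= X * (M * Pv).
  rewrite sE PE_cat.
  apply: (@le_trans _ _ (PE s1 (fun a => PE s2 (fun b =>
    ((surv u a)%:R * (t * r <= endpt (endpt u a) b)%R%:R) *
    PE s4 (fun e => (surv v (rev_steps e))%:R * PE s3 (fun c =>
      (endpt (endpt (endpt u a) b) c == endpt v (rev_steps e))%:R)))))).
    apply: le_PE_supp => // a sa; rewrite PE_cat.
    apply: le_PE_supp => // b sb; rewrite PE_cat -PEZ PE_swap.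
    apply: le_PE => // e; rewrite -PEZ -PEZ; apply: le_PE => // c'.
    rewrite excursion_cat /=; last by rewrite (path_of_size sa) (path_of_size sb).
    set x := endpt u a; set w := endpt x b; set z := endpt w c'.
    have [/andP[/and4P[sua sxb swc sze] /andP[hw /eqP ze]]|_] := boolP (_ && _); last first.
      by rewrite !mulr_ge0.
    have x0 : 0 <= x by exact: surv_endpt sua.
    have w0 : 0 <= w by exact: surv_endpt sxb.
    have z0 : 0 <= z by exact: surv_endpt swc.
    have : (0 <= z) && surv z e by rewrite z0.
    rewrite surv_rev ze => /andP[_ sv].
    by rewrite sua hw sv -ze endpt_rev eqxx !mulr1.
  rewrite /X -PEZr; apply: le_PE => // a; rewrite -mulrA -PEZr -PEZ.
  apply: le_PE => // b; rewrite -mulrA; apply: ler_wpM2l => //.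
  apply: ler_wpM2l => //.
  rewrite mulrC /Pv -PEZr; apply: le_PE => // e; apply: ler_wpM2l => //.
  apply: (le_trans (hloc s3 _ _ a3)); rewrite /M ler_pdivrMr ?sqrtr_gt0 ?ltr0n//.
  rewrite -[leLHS]mulr1 (_ : 3 * C1 / r * _ = C1 * (3 / r * Num.sqrt (size s3).+1%:R)); last by ring.
  apply: ler_wpM2l; first exact: ltW.
  rewrite mulrAC ler_pdivlMr// mul1r.
  rewrite -(@ler_pXn2r _ 2)// ?nnegrE ?(ltW r0) ?mulr_ge0 ?sqrtr_ge0//.
  rewrite exprMn r2 sqr_sqrtr//.
  apply: (@le_trans _ _ (7 * (size s3).+1%:R)); last by apply: ler_wpM2r => //; lra.
  by rewrite -natrM ler_nat; apply: (leq_trans l3); rewrite leq_mul2l leqnSn orbT.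
have n2s (l : seq (@law R)) : (size s <= 7 * size l)%N -> (n2 <= size l)%N.
  by move=> h; rewrite -(@leq_pmul2l 7)//; exact: leq_trans h.
have r7 (l : seq (@law R)) : (size s <= 7 * size l)%N -> r ^+ 2 <= 7 * (size l)%:R.
  by move=> h; rewrite r2 -natrM ler_nat.
have hPv : Pv <= C2 * Num.min (v + 1) r / r.
  have -> : Pv = PE (rev_laws s4) (fun e => (surv v e)%:R) by rewrite PE_rev.
  apply: hsurv => //; rewrite size_rev_laws; [exact: n2s|exact: r7].
have hX : X <= C5 * (Num.min (u + 1) r / r) * expR (- (c * t ^+ 2)).
  have e3 : expR (- (c3 * t ^+ 2)) <= expR (- (c * t ^+ 2)).
    by rewrite ler_expR lerN2; apply: ler_wpM2r.
  have e4 : expR (- (c4 * t ^+ 2)) <= expR (- (c * t ^+ 2)).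
    by rewrite ler_expR lerN2; apply: ler_wpM2r.
  set E := expR (- (c * t ^+ 2)) in e3 e4 *.
  have E0 : 0 <= E by exact: expR_ge0.
  pose H := PE s1 (fun a => (surv u a && (3 / 4 * t * r <= endpt u a))%:R).
  have m0' : 0 <= Num.min (u + 1) r / r.
    by rewrite divr_ge0 ?(ltW r0)// le_min (ltW r0) andbT; lra.
  have split_high : X <= H + PE s1 (fun a => (surv u a)%:R) * E.
    rewrite /X /H -PEZr -PED; apply: le_PE => // a.
    case: (boolP (surv u a)) => _ /=; last by rewrite !mul0r addr0.
    rewrite !mul1r; have [hi|lo] := leP (3 / 4 * t * r) (endpt u a).
      apply: (@le_trans _ _ 1); last by rewrite lerDl.
      apply: (@le_trans _ _ (PE s2 (fun=> 1))); last by rewrite (adm_cst 1 a2).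
      by apply: le_PE => // b; rewrite lern1 leq_b1.
    rewrite add0r; apply: le_trans e4; apply: hch a2.1 t1 r0 hN4 ls2 _; lra.
  have hs1 : PE s1 (fun a => (surv u a)%:R) <= C2 * Num.min (u + 1) r / r.
    by apply: hsurv => //; [exact: n2s|exact: r7].
  have hH : H <= (2 * C3 + 2) * (Num.min (u + 1) r / r) * E.
    have [ur|ru] := leP u r.
      have ur' : 0 <= u <= r by rewrite u0.
      have hh := hhigh s1 u t r a1.1 tt r0 hN3 ls1 ur'.
      apply: (le_trans hh); apply: ler_pM; rewrite ?expR_ge0//.
        by rewrite divr_ge0 ?(ltW r0)// mulr_ge0 ?(ltW C30)//; lra.
      rewrite mulrA; apply: ler_wpM2r; first by rewrite invr_ge0 ltW.
      have : (u + 1) / 2 <= Num.min (u + 1) r by rewrite le_min; apply/andP; split; lra.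
      move: (Num.min _ _) => m hm.
      have := ler_wpM2l (ltW C30) hm; lra.
    have -> : Num.min (u + 1) r = r by apply/min_idPr; lra.
    rewrite divff ?gt_eqF// mulr1.
    apply: (@le_trans _ _ E); last by rewrite ler_peMl//; lra.
    apply: le_trans e4; apply: (@le_trans _ _ (PE s1 (fun a => (3 / 4 * t * r <= endpt u a)%R%:R))).
      by apply: le_PE => // a; rewrite ler_nat; case: surv.
    by apply: hch a1.1 t1 r0 hN4 ls1 _; lra.
  have := ler_wpM2r E0 hs1.
  move: hH split_high; rewrite /C5; lra.
apply: (le_trans step1).
have X0 : 0 <= X by apply: PE_ge0 => // a; rewrite mulr_ge0//; exact: PE_ge0.
have Pv0 : 0 <= Pv by exact: PE_ge0.
have MPv : M * Pv <= M * (C2 * Num.min (v + 1) r / r) by apply: ler_wpM2l.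
apply: (le_trans (ler_pM X0 (mulr_ge0 M0 Pv0) hX MPv)).
rewrite le_eqVlt; apply/orP; left; apply/eqP; rewrite /M.
by move: (Num.min _ _) (Num.min _ _) (expR _) => A B E; ring.
Qed.

End excursions.

(** ** Lower bound *)

Section excursion_lower.
Context {R : realType} (d K kap eta : R) (m0 : nat).
Hypotheses (d0 : 0 < d) (kap0 : 0 < kap) (K1 : 1 <= K).
Hypotheses (eta01 : 0 < eta <= 1) (m00 : (0 < m0)%N).
Implicit Types (p : @law R) (s : seq (@law R)) (x z t u v r h : R).
Local Notation good := (good_law d K kap).
Local Notation adm := (admissible d K kap eta m0).

Lemma sqrt_part (n m : nat) : (m <= n)%N -> (n <= 7 * m)%N ->
  Num.sqrt m%:R <= Num.sqrt n%:R :> R /\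
  Num.sqrt n%:R <= 3 * Num.sqrt m%:R :> R.
Proof.
move=> mn nm; split; first by apply: ler_wsqrtr; rewrite ler_nat.
rewrite -(@ler_pXn2r _ 2)// ?nnegrE ?mulr_ge0 ?sqrtr_ge0//.
rewrite exprMn !sqr_sqrtr//; apply: (@le_trans _ _ (7 * m%:R)).
  by rewrite -natrM ler_nat.
by apply: ler_wpM2r => //; lra.
Qed.

(** The first stretch and the reversed last one bring both ends to the scale
    [r], at heights at most of order [t * r].  The second stretch climbs to
    height [t * r] at time [k]; the third joins the two pieces, the target being
    on the lattice of the walk.  The two crossings produce the exponential. *)
Lemma excursion_lower : exists Cc c N0 : R, exists n0 : nat,
  [/\ 0 < Cc, 0 < c & forall s u v t (k : nat),
  adm s -> adm (rev_laws s) -> (n0 <= size s)%N ->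
  (size s <= 3 * k <= 2 * size s)%N -> 1 <= t -> N0 * t ^+ 4 <= (size s)%:R ->
  let r := Num.sqrt (size s)%:R in
  0 <= u <= 1 / 2 * t * r -> 0 <= v <= 1 / 2 * t * r -> reaches s u v ->
  c * (Num.min (u + 1) r / r) * (Num.min (v + 1) r / r) / r *
  expR (- (Cc * t ^+ 2)) <=
  PE s (fun ys => (excursion u v (t * r) k ys)%:R)].
Proof.
have [a [B [c1 [n1 [a0 B1 c10 hwin]]]]] := surv_window d0 kap0 K1 eta01 m00.
have [a' a'E] : {a' | a' = Num.min a 1} by eexists.
have a'a : a' <= a by rewrite a'E ge_min lexx.
have a'1 : a' <= 1 by rewrite a'E ge_min lexx orbT.
have a'0 : 0 < a' by rewrite a'E lt_min a0 ltr01.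
have B'1 : 1 <= 3 * (2 + B) by lra.
have [Cm [N1 [Cm0 N11 hmid]]] := crossing kap d0 K1 eta01 m00 a'0 B'1.
exists (2 * Cm), (c1 ^+ 2 / 4), (7 * N1), (maxn 42 (7 * n1)); split.
- by rewrite mulr_gt0.
- by rewrite divr_gt0// exprn_gt0.
move=> s u v t k as_ ars; rewrite geq_max => /andP[n42 sn1] nk t1 hN r.
move=> /andP[u0 ut] /andP[v0 vt] reach.
have [s1 [s2 [s3 [s4 [sE szk [l1 l2] [l3 l4]]]]]] := split_four n42 nk.
have n0 : (0 < size s)%N by apply: leq_trans n42.
have r0 : 0 < r by rewrite sqrtr_gt0 ltr0n.
have r2 : r ^+ 2 = (size s)%:R by rewrite sqr_sqrtr.
have r4 : 4 <= r.
  rewrite -(@ler_pXn2r _ 2)// ?nnegrE ?(ltW r0)// r2.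
  apply: (@le_trans _ _ 42%:R); last by rewrite ler_nat.
  by rewrite -natrX ler_nat.
have t0 : 0 <= t by lra.
have [a1 [a2 [a3 a4]]] : adm s1 /\ adm s2 /\ adm s3 /\ adm s4.
  move: as_; rewrite sE => /admissible_cat[? /admissible_cat[? /admissible_cat[? ?]]].
  by [].
have ar4 : adm (rev_laws s4).
  move: ars; rewrite sE !rev_laws_cat => /admissible_cat[+ _].
  by move=> /admissible_cat[+ _] => /admissible_cat[].
have [p1 p2 p3 p4] : [/\ nonneg_laws s1, nonneg_laws s2, nonneg_laws s3 & nonneg_laws s4].
  by split; [exact: admissible_nonneg a1|exact: admissible_nonneg a2
            |exact: admissible_nonneg a3|exact: admissible_nonneg a4].
have szs : size s = (size s1 + (size s2 + (size s3 + size s4)))%N.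
  by rewrite sE !size_cat.
have [q1 q2 q3 q4] : [/\ (size s1 <= size s)%N, (size s2 <= size s)%N,
    (size s3 <= size s)%N & (size s4 <= size s)%N].
  by rewrite szs; clear; split; lia.
have nsl (l : seq (@law R)) : (size s <= 7 * size l)%N -> (n1 <= size l)%N.
  by move=> h; rewrite -(@leq_pmul2l 7)//; exact: leq_trans h.
have rsl (l : seq (@law R)) : (size l <= size s)%N -> (size s <= 7 * size l)%N ->
    (size l)%:R <= r ^+ 2 <= 7 * (size l)%:R.
  by move=> h h'; rewrite r2 ler_nat h -natrM ler_nat.
have br0 : 0 <= B * r by rewrite mulr_ge0 ?(ltW r0)//; lra.
have tr1 : r <= t * r by rewrite ler_peMl// ltW.
have top w : 0 <= w <= 1 / 2 * t * r -> Num.max w r + B * r <= (2 + B) * t * r.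
  move=> /andP[w0 wt].
  have : Num.max w r <= t * r.
    rewrite ge_max tr1 andbT; apply: (le_trans wt).
    have := mulr_ge0 t0 (ltW r0); rewrite -!mulrA; lra.
  have : B * r <= B * (t * r) by apply: ler_wpM2l => //; lra.
  have := mulr_ge0 t0 (ltW r0).
  by rewrite -mulrA mulrDl; lra.
pose box x := (a * r <= x) && (x <= (2 + B) * t * r).
pose W1 := fun ys => surv u ys && box (endpt u ys).
pose W4 := fun ys => surv v ys && box (endpt v ys).
have hW1 : c1 * Num.min (u + 1) r / r <= PE s1 (fun ys => (W1 ys)%:R).
  apply: le_trans (hwin s1 u r a1 (nsl _ l1) r0 (rsl _ q1 l1) u0) _.
  apply: le_PE => // ys; rewrite ler_nat /W1; case: surv => //=.
  have [/andP[h1 h2]|//] := boolP (_ <= _ <= _).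
  by rewrite /box h1 (le_trans h2)//; apply: top; rewrite u0.
have hW4 : c1 * Num.min (v + 1) r / r <= PE s4 (fun ys => (W4 (rev_steps ys))%:R).
  rewrite -(PE_rev s4 (fun ys => (W4 ys)%:R)).
  have l4' := l4; have q4' := q4; rewrite -(size_rev_laws s4) in l4' q4'.
  apply: le_trans (hwin (rev_laws s4) v r ar4 (nsl _ l4') r0 (rsl _ q4' l4') v0) _.
  apply: le_PE => [|ys]; first exact: admissible_nonneg ar4.
  rewrite ler_nat /W4; case: surv => //=.
  have [/andP[h1 h2]|//] := boolP (_ <= _ <= _).
  by rewrite /box h1 (le_trans h2)//; apply: top; rewrite v0.
pose E := expR (- (Cm * t ^+ 2)).
have E0 : 0 <= E by exact: expR_ge0.
have midl l x z : adm l -> (size l <= size s)%N -> (size s <= 7 * size l)%N ->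
    reaches l x z -> a' * r <= x <= (2 + B) * t * r -> a' * r <= z <= (2 + B) * t * r ->
    E / r <= PE l (fun ys => (surv x ys && (endpt x ys == z))%:R).
  move=> al h h' rl /andP[x1 x2] /andP[z1 z2].
  have [e1 e2] := sqrt_part h h'; rewrite -/r in e1 e2.
  have lr0 : 0 < Num.sqrt (size l)%:R :> R by lra.
  apply: (@le_trans _ _ (E / Num.sqrt (size l)%:R)).
    by apply: ler_wpM2l => //; rewrite lef_pV2 ?posrE.
  have lo : a' * Num.sqrt (size l)%:R <= a' * r by apply: ler_wpM2l => //; exact: ltW.
  have hi : (2 + B) * t * r <= 3 * (2 + B) * t * Num.sqrt (size l)%:R.
    have Bt : 0 <= (2 + B) * t by rewrite mulr_ge0//; lra.
    by have := ler_wpM2l Bt e2; lra.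
  apply: hmid => //.
  - rewrite -(@ler_pM2l _ 7)//; apply: (@le_trans _ _ (size s)%:R).
      by rewrite mulrA.
    by rewrite -natrM ler_nat.
  - by rewrite (le_trans lo x1) (le_trans x2).
  - by rewrite (le_trans lo z1) (le_trans z2).
have boxa x : box x -> a' * r <= x <= (2 + B) * t * r.
  move=> /andP[h1 h2]; rewrite h2 andbT; apply: le_trans h1.
  by apply: ler_wpM2r => //; exact: ltW.
pose W2 x := fun ys => surv x ys && (t * r <= endpt x ys <= t * r + r).
have hW2 x : box x -> E / 4 <= PE s2 (fun ys => (W2 x ys)%:R).
  move=> bx; have -> : E / 4 = E / r * (r / 4) by field; rewrite gt_eqF.
  apply: (lattice_sum a2 r4); first by rewrite divr_ge0// ltW.
  move=> y ry /andP[y1 y2]; apply: (midl s2 x y a2 q2 l2 ry (boxa _ bx)).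
  apply/andP; split.
    apply: le_trans y1; apply: le_trans tr1.
    by rewrite ler_piMl// ltW.
  have : 0 <= B * (t * r) by apply: mulr_ge0; [lra|exact: mulr_ge0 (ltW r0)].
  by rewrite -mulrA mulrDl; lra.
pose W3 w z := fun ys => surv w ys && (endpt w ys == z).
have tr_box w : t * r <= w <= t * r + r -> a' * r <= w <= (2 + B) * t * r.
  move=> /andP[w1 w2]; apply/andP; split.
    by apply: le_trans w1; apply: le_trans tr1; rewrite ler_piMl// ltW.
  have : 0 <= B * (t * r) by apply: mulr_ge0; [lra|exact: mulr_ge0 (ltW r0)].
  by rewrite -mulrA mulrDl; lra.
rewrite [in leRHS]sE PE_cat.
apply: (@le_trans _ _ (PE s1 (fun b => PE s4 (fun e => PE s2 (fun g => PE s3 (fun c =>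
   (W1 b)%:R * (W4 (rev_steps e))%:R * (W2 (endpt u b) g)%:R *
   (W3 (endpt (endpt u b) g) (endpt v (rev_steps e)) c)%:R)))))); last first.
  apply: le_PE_supp => // b sb; rewrite PE_swap PE_cat.
  apply: le_PE_supp => // g sg; rewrite PE_swap PE_cat.
  apply: le_PE => // c; apply: le_PE => // e.
  rewrite excursion_cat /=; last by rewrite (path_of_size sb) (path_of_size sg).
  set x := endpt u b; set w := endpt x g; set z := endpt w c.
  rewrite /W1 -/x; case: (boolP (surv u b)) => su /=; last by rewrite !mul0r.
  rewrite /W2 -/w; case: (boolP (surv x g)) => sx /=; last by rewrite mulr0 !mul0r.
  rewrite /W3; case: (boolP (surv w c)) => sw /=; last by rewrite mulr0.
  case: (boolP (t * r <= w <= t * r + r)) => [/andP[-> _]|_] /=; last first.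
    by rewrite mulr0 mul0r.
  rewrite /W4; have [/andP[sv bz]|_] := boolP (_ && box (endpt v _)); last first.
    by rewrite mulr0 !mul0r.
  have [ze|_] := eqVneq z (endpt v (rev_steps e)); last by rewrite mulr0.
  have z0 : 0 <= endpt v (rev_steps e).
    by move: bz => /andP[+ _]; apply: le_trans; rewrite mulr_ge0// ltW.
  have : (0 <= v) && surv v (rev_steps e) by rewrite v0.
  rewrite surv_rev rev_stepsK -ze => /andP[_ ->].
  have -> : endpt z e == v by rewrite ze -{2}(rev_stepsK e) endpt_rev.
  by rewrite /= !mulr1 lern1 leq_b1.
have m1 w : 0 <= w -> 0 <= c1 * Num.min (w + 1) r / r.
  move=> w0; apply: divr_ge0; last exact: ltW.
  by apply: mulr_ge0; [exact: ltW|rewrite le_min (ltW r0) andbT; lra].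
apply: (@le_trans _ _ (PE s1 (fun b => (W1 b)%:R *
    PE s4 (fun e => (W4 (rev_steps e))%:R * (E / 4 * (E / r)))))).
  under eq_PE do rewrite PEZr; rewrite PEZr [leRHS]mulrA.
  have Er : 0 <= E / 4 * (E / r).
    by apply: mulr_ge0; apply: divr_ge0 => //; exact: ltW.
  apply: (@le_trans _ _ ((c1 * Num.min (u + 1) r / r) * (c1 * Num.min (v + 1) r / r)
     * (E / 4 * (E / r)))); last first.
    by apply: ler_wpM2r => //; apply: ler_pM => //; exact: m1.
  have -> : expR (- (2 * Cm * t ^+ 2)) = E * E.
    by rewrite /E -expRD; congr expR; ring.
  rewrite le_eqVlt; apply/orP; left; apply/eqP.
  by move: (Num.min _ _) (Num.min _ _) => m m'; field; rewrite gt_eqF.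
apply: le_PE_supp => // b sb; rewrite -PEZ.
apply: le_PE_supp => // e se; rewrite mulrA.
under eq_PE do under eq_PE do rewrite -mulrA.
under eq_PE do rewrite PEZ; rewrite PEZ.
case: (boolP (W1 b)) => [/andP[sb1 bx]|_]; last by rewrite !mul0r.
case: (boolP (W4 (rev_steps e))) => [/andP[_ bz]|_]; last by rewrite !(mul0r, mulr0).
rewrite !mul1r.
apply: (@le_trans _ _ (PE s2 (fun g => (W2 (endpt u b) g)%:R) * (E / r))).
  by apply: ler_wpM2r; [rewrite divr_ge0// ltW|exact: hW2].
rewrite -PEZr; apply: le_PE_supp => // g sg; rewrite PEZ.
case: (boolP (W2 (endpt u b) g)) => [/andP[_ wt]|_]; last by rewrite !mul0r.
rewrite !mul1r; apply: (midl s3 _ _ a3 q3 l3 _ (tr_box _ wt) (boxa _ bz)).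
move=> c sc.
have full : path_of s (b ++ (g ++ (c ++ e))).
  by rewrite sE; do 3 (apply: path_of_cat => //).
have := reach _ full; rewrite !endpt_cat.
set z := endpt (endpt (endpt u b) g) c => h.
have -> : endpt v (rev_steps e) - z = v - endpt z e.
  have := endpt_rev 0 e; rewrite (endptE v) (endptE z) (endptE (endpt 0 e)).
  by move: (endpt 0 e) (endpt 0 _) => y y' yy; lra.
exact: h.
Qed.

End excursion_lower.

(** * Aperiodicity *)

Section aperiodicity.
Context {R : realType} (a : int -> R).

Definition charged_path (n : nat) (k : int) (l : seq int) :=
  [/\ size l = n, \sum_(i <- l) i = k & forall i, i \in l -> 0 < a i].

Lemma charged_path_cat n1 k1 l1 n2 k2 l2 :
  charged_path n1 k1 l1 -> charged_path n2 k2 l2 ->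
  charged_path (n1 + n2) (k1 + k2) (l1 ++ l2).
Proof.
move=> [s1 k1E p1] [s2 k2E p2]; split.
- by rewrite size_cat s1 s2.
- by rewrite big_cat /= k1E k2E.
- by move=> i; rewrite mem_cat => /orP[/p1|/p2].
Qed.

Lemma step_prob_ge0 (p : probability int R) n x y :
  (0 <= step_prob (walk_kernel p) n x y)%E.
Proof.
elim: n x => [|n IH] x /=; first by rewrite lee_fin.
by apply: esum_ge0 => z _; rewrite mule_ge0.
Qed.

(** A positive transition probability is a sum over paths, one of which is
    charged. *)
Lemma charged_of_step_prob (p : probability int R) n x y :
  (forall i, (0 < p [set i])%E -> 0 < a i) ->
  (0 < step_prob (walk_kernel p) n x y)%E ->
  exists l, charged_path n (y - x) l.
Proof.
move=> pa; elim: n x => [|n IH] x /=.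
  rewrite lte_fin; case: eqP => [-> _|_]; last by rewrite ltxx.
  by exists [::]; split; rewrite ?big_nil ?subrr.
move=> /[dup] pos; apply: contraPP => noz.
apply/negP; rewrite -leNgt esum1// => z _.
have := step_prob_ge0 p n z y; rewrite le_eqVlt => /orP[/eqP <-|]; first by rewrite mule0.
move=> /IH[l hl]; have : (0 <= walk_kernel p x z)%E by [].
rewrite le_eqVlt => /orP[/eqP <-|pz]; first by rewrite mul0e.
exfalso; apply: noz; exists ((z - x) :: l).
have := @charged_path_cat 1 (z - x) [:: z - x] _ _ _ _ hl.
rewrite add1n (addrC (z - x)) addrA subrK; apply.
split; rewrite ?big_seq1// => i; rewrite inE => /eqP ->; exact: pa.
Qed.

(** A set of integers containing 0, closed under addition and with gcd 1
    contains two consecutive integers: the smallest positive difference of two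
    of its elements divides all of them. *)
Lemma semigroup_consecutive (S : nat -> Prop) : S 0%N ->
  (forall m n, S m -> S n -> S (m + n)%N) -> is_gcd [set n | (0 < n)%N /\ S n] 1%N ->
  exists x, S x /\ S x.+1.
Proof.
move=> S0 SD [_ gcd1].
(* If [e] is the least positive difference, the remainder of an element [n]
   modulo [e] is again a difference: add multiples of the two elements. *)
pose D e := (0 < e)%N /\ exists x, S x /\ S (x + e)%N.
have [e0 [e00 Se0]] : exists e, (0 < e)%N /\ S e.
  apply: contrapT => none; have := gcd1 0%N; rewrite dvd0n => h.
  suff : (1 == 0)%N by [].
  by apply: h => n [n0 Sn]; exfalso; apply: none; exists n.
have exD : exists e, `[< D e >].
  by exists e0; apply/asboolP; split=> //; exists 0%N; rewrite add0n.
pose e := ex_minn exD.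
have [De emin] : D e /\ forall f, D f -> (e <= f)%N.
  by rewrite /e; case: ex_minnP => m /asboolP Dm h; split=> // f Df; apply: h; apply/asboolP.
have [e_gt0 [x [Sx Sxe]]] := De.
have Smul k y : S y -> S (k * y)%N.
  by move=> Sy; elim: k => [|k IH]; rewrite ?mul0n// mulSn; exact: SD.
suff : (e %| 1)%N.
  by rewrite dvdn1 => /eqP e1; exists x; split=> //; rewrite -addn1 -e1.
apply: gcd1 => n [n0 Sn]; rewrite /dvdn.
have [//|r0] := posnP (n %% e).
have : D (n %% e)%N.
  split=> //; exists (n %/ e * (x + e))%N; split; first exact: Smul.
  have -> : (n %/ e * (x + e) + n %% e = n + n %/ e * x)%N.
    by rewrite mulnDr -addnA -divn_eq addnC.
  by apply: SD => //; exact: Smul.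
by move=> /emin; rewrite leqNgt ltn_pmod.
Qed.

Lemma semigroup_cofinite (S : nat -> Prop) : S 0%N ->
  (forall m n, S m -> S n -> S (m + n)%N) -> is_gcd [set n | (0 < n)%N /\ S n] 1%N ->
  exists N, forall n, (N <= n)%N -> S n.
Proof.
move=> S0 SD gcd1; have [x [Sx Sx1]] := semigroup_consecutive S0 SD gcd1.
have Smul k y : S y -> S (k * y)%N.
  by move=> Sy; elim: k => [|k IH]; rewrite ?mul0n// mulSn; exact: SD.
have [x0|x0] := posnP x.
  by exists 0%N => n _; rewrite -(muln1 n); apply: Smul; rewrite x0 in Sx1.
exists (x * x)%N => n xn.
have rq : (n %% x <= n %/ x)%N.
  by apply: ltnW; apply: leq_trans (ltn_pmod n x0) _; rewrite leq_divRL.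
have -> : n = ((n %/ x - n %% x) * x + n %% x * x.+1)%N.
  by rewrite {1}(divn_eq n x) mulnS addnCA -mulnDl subnK// addnC.
by apply: SD; exact: Smul.
Qed.

(** Paths up and down by 1 exist by irreducibility, and loops of all large
    lengths by aperiodicity: the loops pad the paths to a common length. *)
Lemma charged_paths : irreducible_aperiodic_seq a ->
  exists (m0 : nat) (lm l0 lp : seq int), [/\ (0 < m0)%N,
  charged_path m0 (-1) lm, charged_path m0 0 l0 & charged_path m0 1 lp].
Proof.
move=> [p [b [irr aper b0 ab]]].
have pa i : (0 < p [set i])%E -> 0 < a i.
  by move=> pi0; rewrite -lte_fin ab mule_gt0// lte_fin.
pose S n := exists l, charged_path n 0 l.
have S0 : S 0%N by exists [::]; split; rewrite ?big_nil.
have SD m n : S m -> S n -> S (m + n)%N.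
  by move=> [l hl] [l' hl']; exists (l ++ l'); rewrite -[0]addr0; exact: charged_path_cat.
have [N SN] : exists N, forall n, (N <= n)%N -> S n.
  apply: semigroup_cofinite => //; have [_ gcd1] := aper 0.
  split=> [n _|e he]; first exact: dvd1n.
  apply: gcd1 => n [n0 /(charged_of_step_prob pa)[l hl]]; apply: he; split=> //.
  by exists l; rewrite subrr in hl.
have [np /(charged_of_step_prob pa)[lp hp]] := irr 0 1.
have [nm /(charged_of_step_prob pa)[lm hm]] := irr 0 (-1).
rewrite subr0 in hp hm.
pose m0 := (N + np + nm + 1)%N.
have [l0 h0] : S m0 by apply: SN; rewrite /m0 -!addnA leq_addr.
have [l1 h1] : S (m0 - np)%N by apply: SN; rewrite /m0; lia.
have [l2 h2] : S (m0 - nm)%N by apply: SN; rewrite /m0; lia.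
exists m0, (lm ++ l2), l0, (lp ++ l1); split=> //; first by rewrite /m0 addn1.
  have := charged_path_cat hm h2; rewrite addr0 subnKC//; rewrite /m0; lia.
have := charged_path_cat hp h1; rewrite addr0 subnKC//; rewrite /m0; lia.
Qed.

End aperiodicity.

(** * Finitely supported approximations with the same mean *)

Section three_points_from_paths.
Context {R : realType}.
Implicit Types (p : @law R) (s : seq (@law R)).

Definition charges (A : seq int) (al : R) p := exists mu : R,
  forall i, i \in A -> exists2 w, al <= w & (i%:~R - mu, w) \in p.

Lemma Ex_ge_atom p (f : R -> R) y w : nonneg_law p -> (y, w) \in p ->
  (forall y, 0 <= f y) -> w * f y <= Ex p f.
Proof.
move=> p0 yw f0; rewrite /Ex (big_rem _ yw) /= lerDl big_seq sumr_ge0// => a ap.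
by rewrite mulr_ge0// p0// (mem_rem ap).
Qed.

(** The constant [M] is the sum of the means of the laws of the block: it is the
    same for all the paths, so that charged paths whose integer sums differ by
    1 have endpoints that differ by 1. *)
Lemma path_mass A al b : 0 <= al -> (forall p, p \in b -> nonneg_law p) ->
  (forall p, p \in b -> charges A al p) -> exists M : R, forall l : seq int,
  size l = size b -> {subset l <= A} ->
  (exists2 ys, path_of b ys & forall x, endpt x ys = x + (\sum_(i <- l) i)%:~R - M) /\
  forall (f : R -> R) x, (forall z, 0 <= f z) ->
  al ^+ size b * f (x + (\sum_(i <- l) i)%:~R - M) <=
  PE b (fun ys => f (endpt x ys)).
Proof.
move=> al0; elim: b => [|p b IH] b0 bA.
  exists 0 => -[|//] _ _; rewrite big_nil; split.
    by exists [::] => // x /=; rewrite addr0 subr0.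
  by move=> f x _ /=; rewrite mul1r addr0 subr0.
have [M hM] : exists M : R, forall l : seq int,
    size l = size b -> {subset l <= A} ->
    (exists2 ys, path_of b ys & forall x, endpt x ys = x + (\sum_(i <- l) i)%:~R - M) /\
    forall (f : R -> R) x, (forall z, 0 <= f z) ->
    al ^+ size b * f (x + (\sum_(i <- l) i)%:~R - M) <=
    PE b (fun ys => f (endpt x ys)).
  by apply: IH => q qb; [apply: b0|apply: bA]; rewrite inE qb orbT.
have [mu hmu] := bA p (mem_head _ _).
have p0 := b0 p (mem_head _ _).
exists (M + mu) => -[//|i l] /= [szl] lA.
have [|ll] := hM l szl; first by move=> j jl; apply: lA; rewrite inE jl orbT.
move: ll => -[ys bys ysE] hf.
have [w alw iw] := hmu i (lA i (mem_head _ _)).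
split.
  exists (i%:~R - mu :: ys) => /=.
    by split=> //; apply/mapP; exists (i%:~R - mu, w).
  by move=> x; rewrite ysE big_cons intrD; ring.
move=> f x f0.
have g0 y : 0 <= PE b (fun ys => f (endpt (x + y) ys)).
  by apply: PE_ge0 => // q qb; apply: b0; rewrite inE qb orbT.
apply: le_trans (Ex_ge_atom p0 iw g0).
have e : x + (\sum_(k <- i :: l) k)%:~R - (M + mu) =
    x + (i%:~R - mu) + (\sum_(k <- l) k)%:~R - M.
  by rewrite big_cons intrD; ring.
rewrite e exprS -mulrA; apply: ler_pM => //; last exact: hf.
by rewrite mulr_ge0// exprn_ge0.
Qed.

Lemma three_points_of_paths A al b lm l0 lp : 0 <= al ->
  (forall p, p \in b -> nonneg_law p) -> (forall p, p \in b -> charges A al p) ->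
  size lm = size b -> size l0 = size b -> size lp = size b ->
  {subset lm <= A} -> {subset l0 <= A} -> {subset lp <= A} ->
  \sum_(i <- lm) i = -1 -> \sum_(i <- l0) i = 0 -> \sum_(i <- lp) i = 1 ->
  three_points (al ^+ size b / 3) b.
Proof.
move=> al0 b0 bA sm s0 sp lmA l0A lpA em e0 ep.
have [M hM] := path_mass al0 b0 bA.
have [[ys bys ysE] h0] := hM l0 s0 l0A.
have [_ hm] := hM lm sm lmA; have [_ hp] := hM lp sp lpA.
exists ys => // f x f0; rewrite ysE.
have := h0 f x f0; have := hm f x f0; have := hp f x f0.
rewrite em e0 ep mulrN1z addr0.
have -> : x - 1 - M = x - M - 1 by ring.
have -> : x + 1%:~R - M = x - M + 1 by ring.
lra.
Qed.

Lemma spreading_of_charges A al m0 s lm l0 lp : 0 <= al ->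
  (forall p, p \in s -> nonneg_law p) -> (forall p, p \in s -> charges A al p) ->
  size lm = m0 -> size l0 = m0 -> size lp = m0 ->
  {subset lm <= A} -> {subset l0 <= A} -> {subset lp <= A} ->
  \sum_(i <- lm) i = -1 -> \sum_(i <- l0) i = 0 -> \sum_(i <- lp) i = 1 ->
  spreading m0 (al ^+ m0 / 3) s.
Proof.
move=> al0 b0 bA sm s0 sp lmA l0A lpA em e0 ep s1 b s2 sE szb.
have bs p : p \in b -> p \in s by move=> pb; rewrite sE !mem_cat pb orbT.
rewrite -szb in sm s0 sp *.
by apply: (three_points_of_paths al0 _ _ sm s0 sp lmA l0A lpA em e0 ep) => p /bs;
  [exact: b0|exact: bA].
Qed.

Lemma good_law_opp d K kap p : good_law d K kap p -> good_law d K kap (opp_law p).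
Proof.
move=> [p0 p1 pm pe pn pl]; split.
- by move=> a /mapP[c cp ->]; exact: (p0 c cp).
- by rewrite Ex_opp.
- have -> : Ex (opp_law p) id = - Ex p id by rewrite Ex_opp -ExN.
  by rewrite pm oppr0.
- by rewrite Ex_opp; under eq_Ex do rewrite normrN.
- apply: (le_trans pn); rewrite Ex_opp le_eqVlt; apply/orP; left; apply/eqP.
  by apply: eq_Ex => y; rewrite normrN.
- have opp_val y : y \in unzip1 (opp_law p) -> - y \in unzip1 p.
    by move=> /mapP[_ /mapP[c cp ->] ->]; rewrite opprK; exact: map_f.
  move=> y y' /opp_val yp /opp_val yp'; have := pl _ _ yp' yp.
  by rewrite opprK addrC.
Qed.

Lemma charges_opp A al p : charges A al p -> charges (map -%R A) al (opp_law p).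
Proof.
move=> [mu h]; exists (- mu) => _ /mapP[i iA ->]; have [w alw iw] := h i iA.
exists w => //; apply/mapP; exists (i%:~R - mu, w) => //=.
by congr pair; rewrite intrN; ring.
Qed.

End three_points_from_paths.

Section approximation.
Context {R : realType}.
Implicit Types (w : int -> R) (mu del c : R).

Definition int_range (M : nat) : seq int := [seq i%:Z - M%:Z | i <- iota 0 M.*2.+1].

Lemma mem_int_range M j : (j \in int_range M) = (absz j <= M)%N.
Proof.
apply/mapP/idP => [[i]|jM]; first by rewrite mem_iota => /andP[_ iM] ->; lia.
by exists (absz (j + M%:Z)); [rewrite mem_iota; lia|lia].
Qed.

Lemma int_range_uniq M : uniq (int_range M).
Proof. by rewrite map_inj_uniq ?iota_uniq// => i j; lia. Qed.

Lemma le_sum_int_range (g : int -> R) M N : (forall j, 0 <= g j) -> (M <= N)%N ->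
  \sum_(j <- int_range M) g j <= \sum_(j <- int_range N) g j.
Proof.
move=> g0 MN; rewrite [leRHS](bigID (mem (int_range M))) /=.
apply: ler_wpDr; first exact: sumr_ge0.
have pe : perm_eq [seq j <- int_range N | j \in int_range M] (int_range M).
  apply: uniq_perm; rewrite ?filter_uniq ?int_range_uniq// => j.
  rewrite mem_filter /= !mem_int_range; case: leqP => //= jM.
  by rewrite (leq_trans jM).
by rewrite -(perm_big _ pe) big_filter.
Qed.

(** What is used of an integer-valued random variable with mean [mu]. *)
Definition pmf_with_mean del c w mu := [/\ forall j, 0 <= w j,
  \sum_(j <- int_range N) w j @[N --> \oo] --> (1 : R),
  \sum_(j <- int_range N) w j * j%:~R @[N --> \oo] --> mu &
  forall N th, `|th| <= del ->
    \sum_(j <- int_range N) w j * expR (th * j%:~R) <= c].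

Definition atoms w mu M : @law R := [seq (j%:~R - mu, w j) | j <- int_range M].

Definition tail_mass w M : R := 1 - \sum_(j <- int_range M) w j.

Definition tail_moment w mu M : R := mu - \sum_(j <- int_range M) w j * j%:~R.

Definition tail_mean w mu M : R := tail_moment w mu M / tail_mass w M.

(** The mass outside of the range is moved to the two integers around its
    barycentre: this keeps the mean, which centres the walk, and by convexity
    it does not increase the exponential moments by more than a constant. *)
Definition approx_law w mu M : @law R :=
  let m := tail_mean w mu M in let i := Num.floor m in
  let f := m - i%:~R in let q := tail_mass w M in
  atoms w mu M ++ [:: (i%:~R - mu, q * (1 - f)); ((i + 1)%:~R - mu, q * f)].

Lemma approx_lattice w mu M y : y \in unzip1 (approx_law w mu M) ->
  exists k : int, y = k%:~R - mu.
Proof.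
move=> /mapP[a + ->]; rewrite mem_cat => /orP[/mapP[j _ ->]|]; first by exists j.
by set i := Num.floor _; rewrite !inE => /orP[/eqP ->|/eqP ->]; [exists i|exists (i + 1)].
Qed.

Section estimates.
Context (del c mu : R) (w : int -> R).
Hypotheses (del0 : 0 < del) (c0 : 0 <= c) (pmf : pmf_with_mean del c w mu).

Lemma tail_mass_ge0 M : 0 <= tail_mass w M.
Proof.
have [w0 w1 _ _] := pmf; rewrite subr_ge0.
apply: (cvgr_to_ge w1); exists M => // N /= MN.
exact: le_sum_int_range.
Qed.

(** The exponential lies above its tangent at [m].  Outside of the range this
    bounds the exponential moment of the tail from below by its mass and its
    first moment, in a form that only involves finite sums and their limits. *)
Lemma tail_exp_ge M th m : `|th| <= del ->
  expR (th * m) * (tail_mass w M + th * (tail_moment w mu M - m * tail_mass w M)) <= c.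
Proof.
have [w0 w1 wmu wexp] := pmf => thd.
pose g (j : int) := expR (th * m) * (w j * (1 - th * m) + th * (w j * j%:~R)).
have gE N : \sum_(j <- int_range N) g j = expR (th * m) *
    ((\sum_(j <- int_range N) w j) * (1 - th * m) +
     th * \sum_(j <- int_range N) w j * j%:~R).
  by rewrite -big_distrr /=; congr (_ * _); rewrite big_split /= big_distrl big_distrr.
have g_le j : g j <= w j * expR (th * j%:~R).
  have -> : th * j%:~R = th * m + th * (j%:~R - m) by ring.
  rewrite expRD /g (_ : w j * (1 - th * m) + th * (w j * j%:~R) =
    w j * (1 + th * (j%:~R - m))); last by ring.
  rewrite mulrCA; apply: ler_wpM2l => //; apply: ler_wpM2l; first exact: expR_ge0.
  exact: expR_ge1Dx.
have cvg_g : \sum_(j <- int_range N) g j @[N --> \oo] -->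
    expR (th * m) * (1 * (1 - th * m) + th * mu).
  under eq_fun do rewrite gE.
  apply: cvgMr; apply: cvgD; first exact: cvgMl.
  exact: cvgMr.
have : expR (th * m) * (1 * (1 - th * m) + th * mu) <=
    c + \sum_(j <- int_range M) g j.
  apply: (cvgr_to_le cvg_g); exists M => // N /= MN.
  have h1 : \sum_(j <- int_range M) (w j * expR (th * j%:~R) - g j) <=
      \sum_(j <- int_range N) (w j * expR (th * j%:~R) - g j).
    by apply: le_sum_int_range => // j; rewrite subr_ge0.
  rewrite !sumrB in h1.
  have h2 : 0 <= \sum_(j <- int_range M) w j * expR (th * j%:~R).
    by apply: sumr_ge0 => j _; rewrite mulr_ge0 ?expR_ge0.
  have := wexp N th thd; lra.
rewrite gE /tail_mass /tail_moment; lra.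
Qed.

(** Without mass outside of the range there is no first moment either: the
    tangent point can be sent to infinity. *)
Lemma tail_moment0 M : tail_mass w M = 0 -> tail_moment w mu M = 0.
Proof.
move=> q0; apply/eqP; rewrite eq_le; apply/andP; split.
  rewrite leNgt; apply/negP => D0.
  have dd : `|del| <= del by rewrite gtr0_norm.
  have := tail_exp_ge M (c / (del ^+ 2 * tail_moment w mu M)) dd.
  rewrite q0 mulr0 subr0 add0r.
  set D := tail_moment w mu M in D0 *.
  have -> : del * (c / (del ^+ 2 * D)) = c / (del * D).
    by field; rewrite !gt_eqF.
  have dD : 0 < del * D by rewrite mulr_gt0.
  have := ler_wpM2r (ltW dD) (expR_ge1Dx (c / (del * D))).
  by rewrite mulrDl divfK ?gt_eqF//; lra.
rewrite leNgt; apply/negP => D0.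
have dd : `|- del| <= del by rewrite normrN gtr0_norm.
have := tail_exp_ge M (c / (del ^+ 2 * tail_moment w mu M)) dd.
rewrite q0 mulr0 subr0 add0r.
set D := tail_moment w mu M in D0 *.
have -> : - del * (c / (del ^+ 2 * D)) = c / (- del * D).
  by field; rewrite lt_eqF// gt_eqF.
have dD : 0 < - del * D by rewrite mulNr oppr_gt0 pmulr_rlt0.
have := ler_wpM2r (ltW dD) (expR_ge1Dx (c / (- del * D))).
by rewrite mulrDl divfK ?gt_eqF//; lra.
Qed.

Lemma tail_meanK M : tail_mass w M * tail_mean w mu M = tail_moment w mu M.
Proof.
rewrite /tail_mean; have [/eqP q0|q0] := boolP (tail_mass w M == 0).
  by rewrite q0 mul0r tail_moment0.
by rewrite mulrC divfK.
Qed.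

(** The tangent at the barycentre gives Jensen's inequality for the tail. *)
Lemma tail_jensen M th : `|th| <= del ->
  tail_mass w M * expR (th * tail_mean w mu M) <= c.
Proof.
move=> thd; have := tail_exp_ge M (tail_mean w mu M) thd.
by rewrite (mulrC (tail_mean _ _ _)) tail_meanK subrr mulr0 addr0 mulrC.
Qed.

Lemma mean_le : del * `|mu| <= c.
Proof.
have [w0 _ wmu wexp] := pmf.
have bound th : `|th| = del -> th * mu <= c.
  move=> thE.
  have cv : th * \sum_(j <- int_range N) w j * j%:~R @[N --> \oo] --> th * mu.
    exact: cvgMr.
  apply: (cvgr_to_le cv); exists 0%N => // N _ /=.
  apply: le_trans (wexp N th _); last by rewrite thE.
  rewrite big_distrr /=; apply: ler_sum => j _; rewrite mulrCA.
  by apply: ler_wpM2l => //; exact: expR_ge_id.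
have [mu0|mu0] := leP 0 mu.
  by rewrite ger0_norm//; apply: bound; rewrite gtr0_norm.
rewrite ltr0_norm// mulrN -mulNr; apply: bound.
by rewrite normrN gtr0_norm.
Qed.

Lemma Ex_atoms M f : Ex (atoms w mu M) f = \sum_(j <- int_range M) w j * f (j%:~R - mu).
Proof. by rewrite /Ex big_map. Qed.

Lemma Ex_approx M f : let m := tail_mean w mu M in let i := Num.floor m in
  let q := tail_mass w M in
  Ex (approx_law w mu M) f = Ex (atoms w mu M) f +
  q * ((1 - (m - i%:~R)) * f (i%:~R - mu) + (m - i%:~R) * f ((i + 1)%:~R - mu)).
Proof.
by rewrite /= /Ex /approx_law big_cat /= !big_cons big_nil /=; ring.
Qed.

Definition approx_exp_const : R := 2 * c * expR c + 2 * c * expR (c + del).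

(** The nondegeneracy comes from two charged sites: one of them is at distance
    at least 1/2 from the mean. *)
Lemma approx_good M (al : R) (i0 j0 : int) : 0 <= al -> i0 != j0 ->
  i0 \in int_range M -> j0 \in int_range M -> al <= w i0 -> al <= w j0 ->
  good_law del approx_exp_const al (approx_law w mu M).
Proof.
have [w0 w1 wmu wexp] := pmf => al0 ij iM jM wi wj.
pose m := tail_mean w mu M; pose i := Num.floor m; pose q := tail_mass w M.
have /andP[f0 f1] := floor_itv m.
rewrite -/i intrD in f0 f1.
have q0 : 0 <= q := tail_mass_ge0 M.
have qm : q * m = tail_moment w mu M := tail_meanK M.
have nn : nonneg_law (approx_law w mu M).
  move=> a; rewrite mem_cat => /orP[/mapP[j _ ->]|]; first exact: (w0 j).
  rewrite !inE => /orP[/eqP ->|/eqP ->] /=.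
    by apply: mulr_ge0 => //; rewrite -/m -/i; lra.
  by apply: mulr_ge0 => //; rewrite -/m -/i; lra.
split=> //.
- rewrite Ex_approx Ex_atoms -/m -/i -/q.
  under eq_bigr do rewrite mulr1.
  by rewrite /q /tail_mass; ring.
- rewrite Ex_approx Ex_atoms -/m -/i -/q /=.
  under eq_bigr do rewrite mulrBr.
  rewrite sumrB -big_distrl /= intrD.
  have -> : q * ((1 - (m - i%:~R)) * (i%:~R - mu) + (m - i%:~R) * (i%:~R + 1%:~R - mu))
    = q * m - q * mu by ring.
  by rewrite qm /q /tail_moment /tail_mass; ring.
- rewrite Ex_approx Ex_atoms -/m -/i -/q /approx_exp_const.
  have dmu := mean_le.
  apply: lerD.
    apply: (@le_trans _ _ (\sum_(j <- int_range M)
        (w j * expR (del * j%:~R) + w j * expR (- del * j%:~R)) * expR c)).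
      apply: ler_sum => j _; rewrite -mulrDr -mulrA; apply: ler_wpM2l => //.
      rewrite mulrDl -!expRD.
      apply: (@le_trans _ _ (expR (del * `|j%:~R| + c))).
        rewrite ler_expR; apply: (@le_trans _ _ (del * (`|j%:~R| + `|mu|))).
          by apply: ler_wpM2l; [exact: ltW|exact: ler_normB].
        by rewrite mulrDr lerD2l.
      have [j_ge0|j_lt0] := leP 0 (j%:~R : R).
        by rewrite ger0_norm// lerDl expR_ge0.
      by rewrite ltr0_norm// mulrN -mulNr lerDr expR_ge0.
    rewrite -big_distrl /= big_split /=; apply: ler_wpM2r; first exact: expR_ge0.
    have h1 : `|del| <= del by rewrite gtr0_norm.
    have h2 : `|- del| <= del by rewrite normrN gtr0_norm.
    by have := wexp M del h1; have := wexp M (- del) h2; lra.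
  have ex y : `|y - m| <= 1 -> expR (del * `|y - mu|) <=
      (expR (del * m) + expR (- del * m)) * expR (c + del).
    move=> ym; apply: (@le_trans _ _ (expR (del * `|m| + (c + del)))).
      rewrite ler_expR; apply: (@le_trans _ _ (del * (`|m| + `|mu| + 1))).
        apply: ler_wpM2l; first exact: ltW.
        apply: (le_trans (ler_normB y mu)).
        have -> : y = m + (y - m) by ring.
        by have := ler_normD m (y - m); lra.
      by rewrite !mulrDr mulr1; lra.
    rewrite [in leLHS]expRD; apply: ler_wpM2r; first exact: expR_ge0.
    have [m_ge0|m_lt0] := leP 0 m.
      by rewrite ger0_norm// lerDl expR_ge0.
    by rewrite ltr0_norm// mulrN -mulNr lerDr expR_ge0.
  set E := (expR (del * m) + expR (- del * m)) * expR (c + del) in ex.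
  have qE : q * E <= 2 * c * expR (c + del).
    rewrite /E mulrA; apply: ler_wpM2r; first exact: expR_ge0.
    have h1 : `|del| <= del by rewrite gtr0_norm.
    have h2 : `|- del| <= del by rewrite normrN gtr0_norm.
    have := tail_jensen M h1; have := tail_jensen M h2; rewrite -/q -/m; lra.
  apply: le_trans qE; apply: ler_wpM2l => //.
  have h1 : expR (del * `|i%:~R - mu|) <= E.
    by apply: ex; rewrite ler_norml; apply/andP; split; lra.
  have h2 : expR (del * `|(i + 1)%:~R - mu|) <= E.
    by apply: ex; rewrite intrD ler_norml; apply/andP; split; lra.
  have g1 : 0 <= 1 - (m - i%:~R) by lra.
  have g2 : 0 <= m - i%:~R by lra.
  by have := ler_wpM2l g1 h1; have := ler_wpM2l g2 h2; lra.
- have far k : k \in int_range M -> al <= w k -> 1 / 2 <= `|k%:~R - mu| ->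
      al <= Ex (approx_law w mu M) (fun y => (1 / 2 <= `|y|)%R%:R).
    move=> kM alk far_k; apply: (le_trans alk).
    have kin : (k%:~R - mu, w k) \in approx_law w mu M.
      by rewrite mem_cat; apply/orP; left; apply/mapP; exists k.
    have f_ge0 (y : R) : 0 <= ((1 / 2 <= `|y|)%R%:R : R) by [].
    by have := Ex_ge_atom nn kin f_ge0; rewrite far_k mulr1.
  have [hi|hi] := leP (1 / 2) `|i0%:~R - mu|; first exact: far iM wi hi.
  apply: far jM wj _; rewrite leNgt; apply/negP => hj.
  have : `|(i0 - j0)%:~R| < 1 :> R.
    have -> : (i0 - j0)%:~R = (i0%:~R - mu) - (j0%:~R - mu) :> R by rewrite intrB; ring.
    by apply: le_lt_trans (ler_normB _ _) _; lra.
  rewrite -intr_norm (_ : 1 = 1%:~R)// ltr_int; move: ij; lia.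
- move=> y y' /approx_lattice[k ->] /approx_lattice[k' ->].
  by rewrite opprB addrA subrK -intrB intr_int.
Qed.

End estimates.

Lemma approx_charges w mu M (A : seq int) (al : R) : {subset A <= int_range M} ->
  (forall i, i \in A -> al <= w i) -> charges A al (approx_law w mu M).
Proof.
move=> AM Aw; exists mu => i iA; exists (w i); first exact: Aw.
by rewrite mem_cat; apply/orP; left; apply/mapP; exists i => //; exact: AM.
Qed.

End approximation.

(** * From random variables to finitely supported laws *)

Section random_variable_pmf.
Context {R : realType} {d : measure_display} {T : measurableType d}
  {P : probability T R}.
Implicit Types (X : {RV P >-> int}) (f : int -> R).

Definition rv_mass X (j : int) : R := fine (P (X @^-1` [set j])).

Definition rv_mean X : R := fine 'E_P[fun w => (X w)%:~R : R].

Lemma measurable_rv_preimage X (B : set int) : measurable (X @^-1` B).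
Proof. by rewrite -[X in measurable X]setTI; apply: measurable_funP. Qed.

Lemma measurable_of_rv X (g : int -> R) : measurable_fun [set: T] (fun w => (g (X w))%:E).
Proof.
move=> _ B _; rewrite setTI.
exact: (measurable_rv_preimage X ((fun j => (g j)%:E) @^-1` B)).
Qed.

Lemma rv_massE X j : P (X @^-1` [set j]) = (rv_mass X j)%:E.
Proof. by rewrite /rv_mass fineK// fin_num_measure//; exact: measurable_rv_preimage. Qed.

Lemma rv_mass_ge0 X j : 0 <= rv_mass X j.
Proof. exact: fine_ge0. Qed.

Lemma sum_int_range_delta f M j : \sum_(i <- int_range M) f i * (j == i)%:R =
  (absz j <= M)%N%:R * f j.
Proof.
have [jM|jM] := boolP (absz j <= M)%N.
  rewrite (bigD1_seq j) ?int_range_uniq ?mem_int_range//= eqxx mulr1 mul1r.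
  rewrite big1 ?addr0// => i ij.
  by rewrite eq_sym (negbTE ij) mulr0.
rewrite mul0r big_seq big1// => i; rewrite mem_int_range => iM.
by case: eqP iM jM => [->->|]; rewrite ?mulr0.
Qed.

Lemma sum_rv_mass X f N : (forall j, 0 <= f j) ->
  (\int[P]_w ((absz (X w) <= N)%N%:R * f (X w))%:E =
   (\sum_(j <- int_range N) rv_mass X j * f j)%:E)%E.
Proof.
move=> f0; transitivity (\int[P]_w \sum_(j <- int_range N)
    ((f j)%:E * (\1_(X @^-1` [set j]) w)%:E))%E.
  apply: eq_integral => w _; rewrite -sum_int_range_delta -sumEFin.
  apply: eq_bigr => j _; rewrite -EFinM indicE; congr (_ * _%:R)%:E.
  by congr nat_of_bool; apply/eqP/idP; rewrite inE.
rewrite ge0_integral_sum//; last first.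
- by move=> j w _; rewrite -EFinM lee_fin mulr_ge0.
- move=> j; apply: measurable_funeM; apply/measurable_EFinP.
  by apply: measurable_indic; exact: measurable_rv_preimage.
rewrite -sumEFin; apply: eq_bigr => j _; rewrite ge0_integralZl_EFin//.
- rewrite integral_indic ?setIT; last exact: measurable_rv_preimage.
  by rewrite mulrC EFinM; congr (_ * _)%E; exact: rv_massE.
- exact: measurableT.
- apply/measurable_EFinP; apply: measurable_indic; exact: measurable_rv_preimage.
Qed.

(** Monotone convergence over the ranges. *)
Lemma cvg_sum_rv_mass X f : (forall j, 0 <= f j) ->
  ((\sum_(j <- int_range N) rv_mass X j * f j)%:E @[N --> \oo] -->
   \int[P]_w (f (X w))%:E)%E.
Proof.
move=> f0; pose g N w := ((absz (X w) <= N)%N%:R * f (X w))%:E.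
have -> : (fun N => (\sum_(j <- int_range N) rv_mass X j * f j)%:E) =
    (fun N => \int[P]_w g N w)%E by apply/funext => N; rewrite sum_rv_mass.
have lim_g w : limn (g ^~ w) = (f (X w))%:E.
  apply/cvg_lim => //; apply: cvg_near_cst; exists (absz (X w)) => // N /= XN.
  by rewrite /g XN mul1r.
under eq_integral do rewrite -lim_g.
apply: cvg_monotone_convergence => //.
- move=> N; exact: (measurable_of_rv X (fun j => (absz j <= N)%N%:R * f j)).
- by move=> N w _; rewrite lee_fin mulr_ge0.
- move=> w _ M N MN; rewrite lee_fin; apply: ler_wpM2r => //.
  by rewrite ler_nat; case: (leqP (absz (X w)) M) => // XM; rewrite (leq_trans XM).
Qed.

Lemma cvg_sum_rv_mass_fin X f (B : R) : (forall j, 0 <= f j) ->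
  (forall N, \sum_(j <- int_range N) rv_mass X j * f j <= B) ->
  (\int[P]_w (f (X w))%:E \is a fin_num)%E /\
  \sum_(j <- int_range N) rv_mass X j * f j @[N --> \oo] -->
  fine (\int[P]_w (f (X w))%:E)%E.
Proof.
move=> f0 fB; have cv := @cvg_sum_rv_mass X f f0.
have fin : (\int[P]_w (f (X w))%:E \is a fin_num)%E.
  rewrite ge0_fin_numE; last by apply: integral_ge0 => w _; rewrite lee_fin.
  apply: (@le_lt_trans _ _ B%:E); last exact: ltry.
  by apply: (cvge_to_le cv); apply: nearW => N; rewrite lee_fin.
split=> //; rewrite -(fineK fin) in cv.
exact: fine_cvg cv.
Qed.

Lemma law_class_exp_le X del c (a : int -> R) N th :
  law_class del c a (distribution P X) -> `|th| <= del ->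
  \sum_(j <- int_range N) rv_mass X j * expR (th * j%:~R) <= c.
Proof.
move=> [sup_le _] thd; rewrite -lee_fin -sumEFin.
apply: le_trans sup_le; apply: le_trans; last first.
  by apply: ereal_sup_ubound; exists th.
apply: esum_ge; exists [set` int_range N].
  by split=> //; exact: finite_seq.
rewrite -fsbig_seq ?int_range_uniq//; apply: lee_sum => j _.
by rewrite EFinM -rv_massE.
Qed.

Lemma rv_mass_ge X del c (a : int -> R) i :
  law_class del c a (distribution P X) -> a i <= rv_mass X i.
Proof. by move=> [_ /(_ i)]; rewrite -lee_fin -rv_massE. Qed.

(** The mean converges because its positive and negative parts are dominated by
    the exponential moments at [del] and [- del]. *)
Lemma rv_pmf X del c (a : int -> R) : 0 < del ->
  law_class del c a (distribution P X) ->
  pmf_with_mean del c (rv_mass X) (rv_mean X).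
Proof.
move=> del0 lawX; have expo := law_class_exp_le _ lawX.
have bound (f : int -> R) th : `|th| = del ->
    (forall j, f j <= del^-1 * expR (th * j%:~R)) ->
    forall N, \sum_(j <- int_range N) rv_mass X j * f j <= del^-1 * c.
  move=> thd fle N; apply: (@le_trans _ _
      (del^-1 * \sum_(j <- int_range N) rv_mass X j * expR (th * j%:~R))).
    rewrite big_distrr /=; apply: ler_sum => j _; rewrite mulrCA.
    by apply: ler_wpM2l; [exact: rv_mass_ge0|exact: fle].
  by apply: ler_wpM2l; [rewrite invr_ge0 ltW|apply: expo; rewrite thd].
have idel x : x <= del^-1 * expR (del * x).
  by rewrite mulrC ler_pdivlMr// mulrC; exact: expR_ge_id.
pose fp (j : int) : R := Num.max j%:~R 0; pose fm (j : int) : R := Num.max (- j%:~R) 0.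
have e0 x : 0 <= del^-1 * expR x by rewrite mulr_ge0 ?expR_ge0// invr_ge0 ltW.
have [fin_p cv_p] : (\int[P]_w (fp (X w))%:E \is a fin_num)%E /\
    \sum_(j <- int_range N) rv_mass X j * fp j @[N --> \oo] -->
    fine (\int[P]_w (fp (X w))%:E)%E.
  apply: cvg_sum_rv_mass_fin => [j|]; first by rewrite /fp le_max lexx orbT.
  apply: (bound _ del); first by rewrite gtr0_norm.
  by move=> j; rewrite /fp ge_max idel e0.
have [fin_m cv_m] : (\int[P]_w (fm (X w))%:E \is a fin_num)%E /\
    \sum_(j <- int_range N) rv_mass X j * fm j @[N --> \oo] -->
    fine (\int[P]_w (fm (X w))%:E)%E.
  apply: cvg_sum_rv_mass_fin => [j|]; first by rewrite /fm le_max lexx orbT.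
  apply: (bound _ (- del)); first by rewrite normrN gtr0_norm.
  by move=> j; rewrite /fm ge_max e0 mulNr -mulrN idel.
split.
- exact: rv_mass_ge0.
- have [|_] := @cvg_sum_rv_mass_fin X (fun=> 1) c (fun=> ler01).
    move=> N; apply: le_trans (expo N 0 _); last by rewrite normr0 ltW.
    by apply: ler_sum => j _; rewrite mul0r expR0.
  under eq_fun do under eq_bigr do rewrite mulr1.
  suff -> : fine (\int[P]_w (1 : R)%:E)%E = 1 by [].
  by rewrite integral_cst// mul1e; exact: (congr1 fine (probability_setT P)).
- have -> : rv_mean X = fine (\int[P]_w (fp (X w))%:E)%E - fine (\int[P]_w (fm (X w))%:E)%E.
    rewrite /rv_mean unlock integralE -fineB//.
    congr fine; congr (_ - _)%E; apply: eq_integral => w _.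
      by rewrite funeposE /fp /= EFin_max.
    by rewrite funenegE /fm /= EFin_max EFinN.
  have -> : (fun N => \sum_(j <- int_range N) rv_mass X j * j%:~R) =
      (fun N => \sum_(j <- int_range N) rv_mass X j * fp j -
                \sum_(j <- int_range N) rv_mass X j * fm j).
    apply/funext => N; rewrite -sumrB; apply: eq_bigr => j _.
    rewrite -mulrBr; congr (_ * _); rewrite /fp /fm.
    by case: (leP (j%:~R : R) 0) => j0; case: (leP (- j%:~R : R) 0) => j1; lra.
  exact: cvgB.
- by move=> N th thd; exact: expo.
Qed.

End random_variable_pmf.

(** ** Finite approximations of probabilities *)

Section law_extension.
Context {R : realType} {I : eqType}.
Implicit Types (A B : I -> @law R) (r : seq I) (F : seq R -> R).

Lemma le_PE_cat A B r F : (forall i, nonneg_law (A i ++ B i)) ->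
  (forall ys, 0 <= F ys) -> PE (map A r) F <= PE (map (fun i => A i ++ B i) r) F.
Proof.
move=> AB0; elim: r F => //= i r IH F F0.
have A0 : nonneg_law (A i) by move=> a ai; apply: (AB0 i); rewrite mem_cat ai.
rewrite [leRHS]/Ex big_cat /=; apply: ler_wpDr.
  rewrite big_seq; apply: sumr_ge0 => a ai; apply: mulr_ge0.
    by apply: (AB0 i); rewrite mem_cat ai orbT.
  by apply: PE_ge0 => // p /mapP[j _ ->]; exact: AB0.
rewrite /Ex big_seq [leRHS]big_seq; apply: ler_sum => a ai.
by apply: ler_wpM2l; [exact: A0|apply: IH].
Qed.

End law_extension.

Section independent_steps.
Context {R : realType} {d : measure_display} {T : measurableType d}
  {P : probability T R} {n : nat}.
Variable X : 'I_n -> {RV P >-> int}.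
Hypothesis indep : mutually_independent X.

Definition steps (w : T) : seq R := [seq centered X i w | i <- enum 'I_n].

Definition step_value (i : 'I_n) (j : int) : R := j%:~R - rv_mean (X i).

(** The event is a countable union of cylinders. *)
Lemma measurable_values_seq (r : seq 'I_n) (Q : seq int -> Prop) :
  measurable [set w | Q [seq X i w | i <- r]].
Proof.
elim: r Q => [|i r IH] Q /=.
  have [q|q] := pselect (Q [::]).
    by rewrite (_ : [set _ | _] = setT)//; apply/seteqP; split.
  by rewrite (_ : [set _ | _] = set0)//; apply/seteqP; split.
have -> : [set w | Q (X i w :: [seq X k w | k <- r])] = \bigcup_(m : nat)
    (if unpickle m is Some j then
      X i @^-1` [set j] `&` [set w | Q (j :: [seq X k w | k <- r])] else set0).
  apply/seteqP; split=> [w /= q|w [m _]].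
    by exists (pickle (X i w)); [exact: I|rewrite pickleK; split].
  by case: unpickle => // j [/= -> ].
apply: bigcupT_measurable => m; case: unpickle => // j.
by apply: measurableI; [exact: measurable_rv_preimage|exact: (IH (fun s => Q (j :: s)))].
Qed.

Lemma measurable_values (Q : ('I_n -> int) -> Prop) :
  measurable [set w | Q (X ^~ w)].
Proof.
have -> : [set w | Q (X ^~ w)] =
    [set w | (fun s => Q (fun i => nth 0 s i)) [seq X i w | i <- enum 'I_n]].
  apply: eq_set => w; congr Q; apply/funext => i.
  by rewrite (nth_map i) ?nth_ord_enum// size_enum_ord.
exact: (measurable_values_seq _ (fun s => Q (fun i : 'I_n => nth 0 s i))).
Qed.

Lemma measure_split (A : set T) (Y : {RV P >-> int}) (D : seq int) :
  uniq D -> measurable A ->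
  (P (A `&` [set w | Y w \in D]) = \sum_(j <- D) P (A `&` Y @^-1` [set j]))%E.
Proof.
move=> + mA; elim: D => [_|j D IH /= /andP[jD uD]].
  by rewrite big_nil (_ : _ `&` _ = set0) ?measure0//; apply/seteqP; split=> // w [].
rewrite big_cons -IH// -measureU.
- rewrite -setIUr; congr (P (A `&` _)); apply/seteqP; split=> w /=; rewrite inE.
    by case/orP => [/eqP|]; [left|right].
  by case=> [->|->]; rewrite ?eqxx ?orbT.
- by apply: measurableI => //; exact: measurable_rv_preimage.
- by apply: measurableI => //; exact: (measurable_rv_preimage Y [set` D]).
- apply/seteqP; split=> // w [[_ /= Yj] [_ /= YD]].
  by move: jD; rewrite -Yj YD.
Qed.

Let truncated M (i : 'I_n) := atoms (rv_mass (X i)) (rv_mean (X i)) M.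

(** The steps of index in [r0] take prescribed values; the remaining ones are
    summed out one at a time, so that independence is used only when all the
    values are prescribed. *)
Lemma prob_truncated_prefix M (F : seq R -> bool) r r0 (g : 'I_n -> int) :
  r0 ++ r = enum 'I_n ->
  P [set w | [/\ forall i, i \in r0 -> X i w = g i,
                 forall i, i \in r -> X i w \in int_range M & F (steps w)]] =
  (\prod_(i <- r0) rv_mass (X i) (g i) *
   PE (map (truncated M) r) (fun ys => (F ([seq step_value i (g i) | i <- r0] ++ ys))%:R))%:E.
Proof.
elim: r r0 g => [|i r IH] r0 g r0E /=.
  rewrite !cats0 in r0E *; rewrite r0E.
  have stepsE w : (forall i, i \in enum 'I_n -> X i w = g i) ->
      steps w = [seq step_value i (g i) | i <- enum 'I_n].
    by move=> Xg; apply/eq_in_map => k kn; rewrite /centered Xg.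
  have [Fg|Fg] := boolP (F _); last first.
    rewrite mulr0 (_ : [set _ | _] = set0) ?measure0//.
    apply/seteqP; split=> // w [/stepsE wE _].
    by rewrite wE (negbTE Fg).
  rewrite mulr1.
  have -> : [set w | [/\ forall i, i \in enum 'I_n -> X i w = g i,
      forall i, i \in [::] -> X i w \in int_range M & F (steps w)]] =
      \bigcap_(i in [set` [set: 'I_n]%SET]) (X i @^-1` [set g i]).
    apply/seteqP; split=> [w [Xg _ _] k _|w Xg].
      by apply: Xg; rewrite mem_enum.
    have Xg' k : k \in enum 'I_n -> X k w = g k.
      by move=> _; apply: (Xg k); rewrite /= finset.in_setT.
    by split=> //; rewrite stepsE.
  rewrite indep// -prodEFin [in RHS]big_enum /=.
  by apply: eq_big => k; rewrite ?inE// => _; exact: rv_massE.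
pose g' j k := if k == i then j else g k.
have ir0 : i \notin r0.
  have := enum_uniq 'I_n; rewrite -r0E cat_uniq => /and3P[_ + _].
  by apply: contra => ir; apply/hasP; exists i; rewrite ?mem_head.
have g'r0 j k : k \in r0 -> g' j k = g k.
  by move=> kr0; rewrite /g'; case: eqP kr0 ir0 => // -> ->.
have r0E' : rcons r0 i ++ r = enum 'I_n by rewrite cat_rcons.
pose A := [set w | [/\ forall k, k \in r0 -> X k w = g k,
   forall k, k \in r -> X k w \in int_range M & F (steps w)]].
have -> : [set w | [/\ forall k, k \in r0 -> X k w = g k,
   forall k, k \in i :: r -> X k w \in int_range M & F (steps w)]] =
   A `&` [set w | X i w \in int_range M].
  apply/seteqP; split=> [w [h1 h2 h3]|w [[h1 h2 h3] h4]].
    split; last by apply: h2; rewrite mem_head.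
    by split=> // k kr; apply: h2; rewrite inE kr orbT.
  by split=> // k; rewrite inE => /orP[/eqP ->|]; [exact: h4|exact: h2].
rewrite measure_split ?int_range_uniq//; last first.
  apply: (measurable_values (fun x => [/\ forall k, k \in r0 -> x k = g k,
   forall k, k \in r -> x k \in int_range M &
   F [seq step_value k (x k) | k <- enum 'I_n]])).
rewrite /truncated Ex_atoms big_distrr /= -sumEFin; apply: eq_bigr => j _.
have -> : A `&` X i @^-1` [set j] =
    [set w | [/\ forall k, k \in rcons r0 i -> X k w = g' j k,
     forall k, k \in r -> X k w \in int_range M & F (steps w)]].
  apply/seteqP; split=> [w [[h1 h2 h3] h4]|w [h1 h2 h3]].
    split=> // k; rewrite mem_rcons inE => /orP[/eqP ->|kr0].
      by rewrite /g' eqxx.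
    by rewrite g'r0// h1.
  split; last by rewrite /= h1 ?mem_rcons ?mem_head// /g' eqxx.
  by split=> // k kr0; rewrite h1 ?mem_rcons ?inE ?kr0 ?orbT// g'r0.
rewrite IH// -cats1 big_cat big_seq1 /= {2}/g' eqxx -mulrA; congr (_ * (_ * _))%:E.
  by apply: eq_big_seq => k kr0; rewrite g'r0.
apply: eq_PE => ys; rewrite map_cat -catA /= /g' eqxx; congr (F (_ ++ _))%:R.
by apply/eq_in_map => k kr0; rewrite -/(g' j k) g'r0.
Qed.

Definition in_range M : set T := [set w | forall i, X i w \in int_range M].

Lemma prob_truncated M (F : seq R -> bool) :
  P ([set w | F (steps w)] `&` in_range M) =
  (PE (map (truncated M) (enum 'I_n)) (fun ys => (F ys)%:R))%:E.
Proof.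
have := @prob_truncated_prefix M F (enum 'I_n) [::] (fun=> 0) erefl.
rewrite big_nil mul1r /= => <-; congr (P _); apply/seteqP; split=> w [h1 h2 //].
by move=> h3; split=> // i; apply: h2; rewrite mem_enum.
Qed.

Lemma measurable_steps (F : seq R -> bool) : measurable [set w | F (steps w)].
Proof.
exact: (measurable_values (fun x => F [seq step_value k (x k) | k <- enum 'I_n])).
Qed.

Lemma cvg_prob_truncated (F : seq R -> bool) :
  PE (map (truncated M) (enum 'I_n)) (fun ys => (F ys)%:R) @[M --> \oo] -->
  fine (P [set w | F (steps w)]).
Proof.
have mF := measurable_steps F.
have mG M : measurable (in_range M).
  exact: (measurable_values (fun x => forall i, x i \in int_range M)).
have EU : \bigcup_M ([set w | F (steps w)] `&` in_range M) = [set w | F (steps w)].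
  apply/seteqP; split=> [w [M _ []]//|w Fw].
  exists (\max_(i < n) absz (X i w))%N => //; split=> // i.
  by rewrite mem_int_range; exact: leq_bigmax.
have := @nondecreasing_cvg_mu _ _ _ P (fun M => [set w | F (steps w)] `&` in_range M).
rewrite EU => /(_ (fun M => measurableI _ _ mF (mG M)) mF) cv.
have {}cv : P ([set w | F (steps w)] `&` in_range M) @[M --> \oo] -->
    (fine (P [set w | F (steps w)]))%:E.
  rewrite fineK ?fin_num_measure//; apply: cv => M N MN.
  apply/subsetPset => w [Fw wM]; split=> // i; have := wM i.
  by rewrite !mem_int_range => /leq_trans; apply.
have -> : (fun M => PE (map (truncated M) (enum 'I_n)) (fun ys => (F ys)%:R)) =
    fine \o (fun M => P ([set w | F (steps w)] `&` in_range M)).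
  by apply/funext => M; rewrite /= prob_truncated.
exact: fine_cvg cv.
Qed.

Definition approx_laws M : seq (@law R) :=
  [seq approx_law (rv_mass (X i)) (rv_mean (X i)) M | i <- enum 'I_n].

(** The approximation is the truncation plus nonnegative weights, whose total is
    the mass lost by the truncation.  Apply this to [F] and to its negation. *)
Lemma PE_approx_bounds M (F : seq R -> bool) dd K kap :
  (forall p, p \in approx_laws M -> good_law dd K kap p) ->
  PE (map (truncated M) (enum 'I_n)) (fun ys => (F ys)%:R) <=
  PE (approx_laws M) (fun ys => (F ys)%:R) <=
  PE (map (truncated M) (enum 'I_n)) (fun ys => (F ys)%:R) + 1 -
  PE (map (truncated M) (enum 'I_n)) (fun=> 1).
Proof.
move=> good.
have nn i : nonneg_law (approx_law (rv_mass (X i)) (rv_mean (X i)) M).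
  have [] // := good (approx_law (rv_mass (X i)) (rv_mean (X i)) M).
  by apply: map_f; rewrite mem_enum.
have le G : (forall ys, 0 <= G ys) ->
    PE (map (truncated M) (enum 'I_n)) G <= PE (approx_laws M) G.
  by move=> G0; exact: le_PE_cat.
have := le (fun ys => 1 - (F ys)%:R) _; rewrite !PEB (PE_cst _ good) => le1.
apply/andP; split; first by apply: le => ys.
have h : forall ys : seq R, 0 <= 1 - (F ys)%:R :> R.
  by move=> ys; rewrite subr_ge0; case: (F ys).
by have := le1 h; lra.
Qed.

(** Bounds that hold for all the approximations pass to the limit, since both
    the truncated probability of the event and the lost mass converge. *)
Lemma prob_of_approx (F : seq R -> bool) dd K kap (lo up : R) M0 :
  (forall M, (M0 <= M)%N -> (forall p, p \in approx_laws M -> good_law dd K kap p) /\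
     lo <= PE (approx_laws M) (fun ys => (F ys)%:R) <= up) ->
  (lo%:E <= P [set w | F (steps w)] <= up%:E)%E.
Proof.
move=> bounds; have mF := measurable_steps F.
rewrite -(@fineK _ (P _)) ?fin_num_measure// !lee_fin; apply/andP; split.
  have cv1 := @cvg_prob_truncated (fun=> true).
  have cv : PE (map (truncated M) (enum 'I_n)) (fun ys => (F ys)%:R) + 1 -
      PE (map (truncated M) (enum 'I_n)) (fun=> 1) @[M --> \oo] -->
      fine (P [set w | F (steps w)]) + 1 - fine (P [set w | (fun=> true) (steps w)]).
    by apply: cvgB => //; apply: cvgD; [exact: cvg_prob_truncated|exact: cvg_cst].
  have e1 : fine (P [set w | (fun=> true) (steps w)]) = 1.
    rewrite (_ : [set _ | _] = setT); last by apply/seteqP; split.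
    exact: (congr1 fine (probability_setT P)).
  rewrite e1 addrK in cv.
  apply: (cvgr_to_ge cv); exists M0 => // M /= /bounds[good /andP[h _]].
  by have /andP[_] := PE_approx_bounds F good; exact: le_trans.
have cv := @cvg_prob_truncated F; apply: (cvgr_to_le cv).
exists M0 => // M /= /bounds[good /andP[_ h]].
by have /andP[+ _] := PE_approx_bounds F good => /le_trans; apply.
Qed.

End independent_steps.

(** * The excursion event *)

Section big_min.
Context {R : realType} {I : eqType}.

Lemma ge_bigmin_seq (r : seq I) (F : I -> R) x y :
  y <= \big[Num.min/x]_(i <- r) F i <-> y <= x /\ forall i, i \in r -> y <= F i.
Proof.
elim: r => [|i r IH]; first by rewrite big_nil; split=> [|[]].
rewrite big_cons le_min; split=> [/andP[yi /IH[yx yr]]|[yx yr]].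
  by split=> // j; rewrite inE => /orP[/eqP ->|/yr].
apply/andP; split; first by apply: yr; rewrite mem_head.
by apply/IH; split=> // j jr; apply: yr; rewrite inE jr orbT.
Qed.

End big_min.

Section uniform_charge.
Context {R : realType}.
Variable a : int -> R.

Lemma big_constant (l : seq int) (i : int) : (forall j, j \in l -> j = i) ->
  \sum_(j <- l) j = i * (size l)%:Z.
Proof.
elim: l => [|j l IH] li; first by rewrite big_nil mulr0.
rewrite big_cons IH; last by move=> k kl; apply: li; rewrite inE kl orbT.
by rewrite (li j (mem_head _ _)) /=; lia.
Qed.

(** Paths of the same length with sums 0 and 1 cannot both stay on one and the
    same integer, so that at least two integers are charged. *)
Lemma uniform_charge : (forall i, 0 <= a i <= 1) -> irreducible_aperiodic_seq a ->
  exists (m0 : nat) (A lm l0 lp : seq int) (al : R) (i0 j0 : int),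
  [/\ [/\ (0 < m0)%N, 0 < al <= 1, i0 \in A, j0 \in A & i0 != j0],
      forall i, i \in A -> al <= a i,
      [/\ size lm = m0, size l0 = m0 & size lp = m0],
      [/\ {subset lm <= A}, {subset l0 <= A} & {subset lp <= A}] &
      [/\ \sum_(i <- lm) i = -1, \sum_(i <- l0) i = 0 & \sum_(i <- lp) i = 1]].
Proof.
move=> a01 /charged_paths[m0 [lm [l0 [lp [m00 [sm em pm] [s0 e0 p0] [sp ep pp]]]]]].
pose A := lm ++ l0 ++ lp.
pose al := \big[Num.min/1]_(i <- A) a i.
have [al1 ala] : al <= 1 /\ forall i, i \in A -> al <= a i.
  by apply/ge_bigmin_seq.
have al0 : 0 < al.
  rewrite /al big_seq; apply: (big_ind (fun x => 0 < x)) => //.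
    by move=> x y x0 y0; rewrite lt_min x0.
  by move=> i; rewrite !mem_cat => /or3P[/pm|/p0|/pp].
have i0l0 : head 0 l0 \in l0.
  by case: (l0) s0 m00 => [<-//|i l _ _]; exact: mem_head.
set i0 := head 0 l0 in i0l0.
have i0A : i0 \in A by rewrite !mem_cat i0l0 orbT.
have [/hasP[j0 j0A j0i0]|noj] := boolP (has (fun j => j != i0) A).
  exists m0, A, lm, l0, lp, al, i0, j0; split=> //.
  - by split=> //; [rewrite al0|rewrite eq_sym].
  - by split=> i il; rewrite !mem_cat il ?orbT.
have const j : j \in A -> j = i0.
  by move=> jA; apply/eqP; move/hasPn: noj => /(_ j jA); rewrite negbK.
have c0 : \sum_(i <- l0) i = i0 * (size l0)%:Z.
  by apply: big_constant => j jl; apply: const; rewrite !mem_cat jl orbT.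
have cp : \sum_(i <- lp) i = i0 * (size lp)%:Z.
  by apply: big_constant => j jl; apply: const; rewrite !mem_cat jl !orbT.
by move: e0 ep; rewrite c0 cp s0 sp => ->.
Qed.

End uniform_charge.

Section walk_as_path.
Context {R : realType} {d : measure_display} {T : measurableType d}
  {P : probability T R} {n : nat}.
Variable X : 'I_n -> {RV P >-> int}.

Lemma size_steps w : size (steps X w) = n.
Proof. by rewrite size_map size_enum_ord. Qed.

Lemma walk_endpt u k w : (k <= n)%N -> walk X u k w = endpt u (take k (steps X w)).
Proof.
elim: k => [|k IH] kn; first by rewrite take0 /walk big_pred0_eq addr0.
rewrite (take_nth 0) ?size_steps// -cats1 endpt_cat -IH; last exact: ltnW.
pose i := Ordinal kn.
rewrite /= (nth_map i) ?size_enum_ord// (nth_ord_enum i i).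
rewrite /walk -addrA; congr (_ + _); rewrite (bigD1 i)//= addrC; congr (_ + _).
by apply: eq_bigl => j; rewrite -val_eqE /=; lia.
Qed.

Lemma surv_take x (ys : seq R) :
  surv x ys <-> forall j, (j < size ys)%N -> 0 <= endpt x (take j.+1 ys).
Proof.
elim: ys x => [|y ys IH] x //=; split.
  move=> /andP[h0 /IH h] [_|j jn]; first by rewrite take0.
  exact: h.
move=> h; apply/andP; split; first by have := h 0%N isT; rewrite take0.
by apply/IH => j jn; apply: (h j.+1).
Qed.

Lemma excursion_eventE u v t k : (0 < n)%N -> (k <= n)%N ->
  excursion_event X u v t k =
  [set w | excursion u v (t * Num.sqrt n%:R) k (steps X w)].
Proof.
move=> n0 kn; have minE w : 0 <= walk_min X u w <-> surv u (steps X w).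
  rewrite ge_bigmin_seq surv_take size_steps; split=> [[_ h] j jn|h].
    by rewrite -walk_endpt//; apply: h; rewrite mem_index_iota.
  have h' j : (0 < j <= n)%N -> 0 <= walk X u j w.
    by case: j => // j jn; rewrite walk_endpt//; exact: h.
  split; first by apply: h'; rewrite n0 leqnn.
  by move=> j; rewrite mem_index_iota ltnS; exact: h'.
have wn w : walk X u n w = endpt u (steps X w).
  by rewrite walk_endpt// take_oversize// size_steps.
apply/seteqP; split=> w; rewrite /excursion_event /excursion /= walk_endpt// wn.
  by move=> [/minE -> -> ->]; rewrite eqxx.
by move=> /and3P[/minE h1 h2 /eqP h3].
Qed.

Lemma reaches_steps M (r : seq 'I_n) w x x' : x - x' \is a Num.int ->
  reaches [seq approx_law (rv_mass (X i)) (rv_mean (X i)) M | i <- r] x'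
    (endpt x [seq centered X i w | i <- r]).
Proof.
elim: r x x' => [|i r IH] x x' xx' ys /=; first by case: ys.
case: ys => [//|y ys] /= [/approx_lattice[k ->] rys].
apply: IH rys; rewrite /centered -/(rv_mean (X i)).
have -> : x + ((X i w)%:~R - rv_mean (X i)) - (x' + (k%:~R - rv_mean (X i))) =
  x - x' + (X i w)%:~R - k%:~R by ring.
by rewrite rpredB ?intr_int// rpredD// intr_int.
Qed.

Lemma reaches_approx M u v : (0 < P [set w | walk X u n w = v])%E ->
  reaches (approx_laws X M) u v.
Proof.
move=> pos; have [w <-] : [set w | walk X u n w = v] !=set0.
  by apply/set0P/negP => /eqP e; move: pos; rewrite e measure0 ltxx.
rewrite walk_endpt// take_oversize ?size_steps//.
by apply: reaches_steps; rewrite subrr int_num0.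
Qed.

End walk_as_path.

Section admissible_approximations.
Context {R : realType} {d : measure_display} {T : measurableType d}
  {P : probability T R} {n : nat}.
Variable X : 'I_n -> {RV P >-> int}.
Variables (del c : R) (a : int -> R) (m0 : nat) (A lm l0 lp : seq int).
Variables (al : R) (i0 j0 : int) (M : nat).
Hypotheses (del0 : 0 < del) (c0 : 0 <= c).
Hypothesis step_laws : forall i, law_class del c a (distribution P (X i)).
Hypotheses (al0 : 0 <= al) (i0A : i0 \in A) (j0A : j0 \in A) (ij : i0 != j0).
Hypothesis ala : forall i, i \in A -> al <= a i.
Hypotheses (sm : size lm = m0) (s0 : size l0 = m0) (sp : size lp = m0).
Hypotheses (lmA : {subset lm <= A}) (l0A : {subset l0 <= A}) (lpA : {subset lp <= A}).
Hypotheses (em : \sum_(i <- lm) i = -1) (e0 : \sum_(i <- l0) i = 0)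
  (ep : \sum_(i <- lp) i = 1).
Hypothesis AM : {subset A <= int_range M}.

Let adm := admissible del (1 + approx_exp_const del c) al (al ^+ m0 / 3) m0.

(** Reversal changes the signs of the steps, hence exchanges the paths with sums
    1 and -1. *)
Lemma approx_laws_admissible : adm (approx_laws X M) /\ adm (rev_laws (approx_laws X M)).
Proof.
have wA i j : j \in A -> al <= rv_mass (X i) j.
  by move=> jA; apply: le_trans (rv_mass_ge _ (step_laws i)); exact: ala.
have good p : p \in approx_laws X M ->
    good_law del (1 + approx_exp_const del c) al p.
  move=> /mapP[i _ ->].
  have [g0 g1 gm ge gn gl] := approx_good del0 c0 (rv_pmf del0 (step_laws i)) al0 ij
    (AM i0A) (AM j0A) (wA i i0 i0A) (wA i j0 j0A).
  by split=> //; apply: (le_trans ge); rewrite lerDr.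
have ch p : p \in approx_laws X M -> charges A al p.
  by move=> /mapP[i _ ->]; apply: approx_charges => // j; exact: wA.
have rev_mem p : p \in rev_laws (approx_laws X M) ->
    exists2 q, q \in approx_laws X M & p = opp_law q.
  by rewrite mem_rev => /mapP.
have oppA l : {subset l <= A} -> {subset map -%R l <= map -%R A}.
  by move=> lA _ /mapP[j jl ->]; apply: map_f; exact: lA.
have oppS (l : seq int) : \sum_(i <- map -%R l) i = - \sum_(i <- l) i.
  by rewrite big_map sumrN.
split; split=> //.
- apply: (spreading_of_charges al0 _ ch sm s0 sp lmA l0A lpA em e0 ep).
  by move=> p /good[].
- by move=> p /rev_mem[q /good gq ->]; exact: good_law_opp.
- apply: (@spreading_of_charges _ (map -%R A) al m0 _
    (map -%R lp) (map -%R l0) (map -%R lm)); rewrite ?size_map ?oppS ?em ?e0 ?ep ?oppr0 ?opprK//;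
    try exact: oppA.
    by move=> p /rev_mem[q /good gq ->]; have [] := good_law_opp gq.
  by move=> p /rev_mem[q /ch cq ->]; exact: charges_opp.
Qed.

End admissible_approximations.

(** ** Adjusting the constants *)

Section numerics.
Context {R : realType}.
Implicit Types (t N c C x : R).

Lemma powR_three_halves (n : nat) : n%:R `^ (3 / 2) = Num.sqrt n%:R ^+ 3 :> R.
Proof.
have -> : 3 / 2 = 2^-1 * 3%:R :> R by field.
by rewrite powRrM powR12_sqrt// powR_mulrn ?sqrtr_ge0.
Qed.

(** The bound on [beta] enters only through this inequality, whose consequence
    [pow4_le] is what the crossing of the bulk asks for. *)
Lemma pow6_le (n : nat) t beta : (0 < n)%N -> beta < 1 / 6 -> 0 <= t ->
  t <= n%:R `^ beta -> t ^+ 6 <= n%:R.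
Proof.
move=> n0 b6 t0 tn; have n1 : 1 <= n%:R :> R by rewrite ler1n.
apply: (@le_trans _ _ ((n%:R `^ beta) ^+ 6)).
  by rewrite lerXn2r// nnegrE ?powR_ge0.
rewrite -powR_mulrn ?powR_ge0// -powRrM -[leRHS]powRr1//.
by apply: ler_powR => //; lra.
Qed.

Lemma pow4_le N t x : 0 <= N -> 0 <= t -> t ^+ 6 <= x -> N ^+ 3 <= x ->
  N * t ^+ 4 <= x.
Proof.
move=> N0 t0 tx Nx; have x0 : 0 <= x by apply: le_trans tx; rewrite exprn_ge0.
have p0 : 0 <= N * t ^+ 4 by rewrite mulr_ge0// exprn_ge0.
rewrite -(@ler_pXn2r _ 3)// ?nnegrE//.
have -> : (N * t ^+ 4) ^+ 3 = N ^+ 3 * (t ^+ 6) ^+ 2 by ring.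
rewrite [leRHS]exprS; apply: ler_pM => //; try by rewrite !exprn_ge0.
by rewrite lerXn2r// nnegrE exprn_ge0.
Qed.

(** The upper bound has room for a factor [t], at the price of a worse constant
    in the exponential. *)
Lemma absorb_linear c t : 0 < c -> 1 <= t ->
  t * expR (- (c * t ^+ 2)) <= 2 / c * expR (- (c / 2 * t ^+ 2)).
Proof.
move=> c0 t1.
have -> : - (c * t ^+ 2) = - (c / 2 * t ^+ 2) + - (c / 2 * t ^+ 2) by field.
rewrite expRD mulrA; apply: ler_wpM2r; first exact: expR_ge0.
rewrite expRN ler_pdivrMr ?expR_gt0//.
apply: (@le_trans _ _ (2 / c * (c / 2 * t ^+ 2))).
  have -> : 2 / c * (c / 2 * t ^+ 2) = t ^+ 2 by field; rewrite gt_eqF.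
  by rewrite expr2; nra.
apply: ler_wpM2l; last exact: expR_ge_id.
by rewrite divr_ge0// ltW.
Qed.

Lemma upper_shape C1 c1 C c t r x y : 0 < C1 -> 0 < c1 -> 1 <= t -> 0 < r ->
  0 <= x -> 0 <= y -> C1 * (2 / c1) <= C -> 2 / c1 <= c ->
  C1 * (x / r) * (y / r) / r * expR (- (c1 * t ^+ 2)) <=
  C * x * y / (t * r ^+ 3) * expR (- t ^+ 2 / c).
Proof.
move=> C10 c10 t1 r0 x0 y0 C1C c1c; have t0 : 0 < t := lt_le_trans ltr01 t1.
have c21 : 0 < 2 / c1 by rewrite divr_gt0.
have c_0 : 0 < c := lt_le_trans c21 c1c.
have -> : C1 * (x / r) * (y / r) / r * expR (- (c1 * t ^+ 2)) =
    x * y / (t * r ^+ 3) * (C1 * (t * expR (- (c1 * t ^+ 2)))).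
  by field; rewrite !gt_eqF.
have -> : C * x * y / (t * r ^+ 3) * expR (- t ^+ 2 / c) =
    x * y / (t * r ^+ 3) * (C * expR (- t ^+ 2 / c)) by ring.
apply: ler_wpM2l.
  exact: divr_ge0 (mulr_ge0 x0 y0) (mulr_ge0 (ltW t0) (exprn_ge0 3 (ltW r0))).
apply: (@le_trans _ _ (C1 * (2 / c1 * expR (- (c1 / 2 * t ^+ 2))))).
  by apply: ler_wpM2l; [exact: ltW|exact: absorb_linear].
rewrite mulrA; apply: ler_pM; [|exact: expR_ge0|exact: C1C|].
  exact: mulr_ge0 (ltW C10) (ltW c21).
rewrite ler_expR mulNr lerN2 (mulrC (t ^+ 2)); apply: ler_wpM2r.
  by rewrite exprn_ge0// ltW.
by rewrite -[c1 / 2]invrK invf_div lef_pV2.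
Qed.

Lemma lower_shape C2 c2 C c t r x y : 0 < C2 -> 0 < c2 -> 1 <= t -> 0 < r ->
  0 <= x -> 0 <= y -> c2^-1 <= C -> C2 <= c ->
  x * y / (C * t * r ^+ 3) * expR (- c * t ^+ 2) <=
  c2 * (x / r) * (y / r) / r * expR (- (C2 * t ^+ 2)).
Proof.
move=> C20 c20 t1 r0 x0 y0 c2C C2c; have t0 : 0 < t := lt_le_trans ltr01 t1.
have c2i : 0 < c2^-1 by rewrite invr_gt0.
have C0 : 0 < C := lt_le_trans c2i c2C.
have -> : c2 * (x / r) * (y / r) / r * expR (- (C2 * t ^+ 2)) =
    x * y / r ^+ 3 * (c2 * expR (- (C2 * t ^+ 2))) by field; rewrite gt_eqF.
have -> : x * y / (C * t * r ^+ 3) * expR (- c * t ^+ 2) =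
    x * y / r ^+ 3 * ((C * t)^-1 * expR (- (c * t ^+ 2))).
  by rewrite mulNr; field; rewrite !gt_eqF.
apply: ler_wpM2l.
  exact: divr_ge0 (mulr_ge0 x0 y0) (exprn_ge0 3 (ltW r0)).
apply: ler_pM; rewrite ?expR_ge0//.
- by rewrite invr_ge0 (mulr_ge0 (ltW C0) (ltW t0)).
- rewrite -[leRHS]invrK lef_pV2 ?posrE ?mulr_gt0//.
  by apply: (le_trans c2C); rewrite ler_peMr// ltW.
- by rewrite ler_expR lerN2; apply: ler_wpM2r => //; rewrite exprn_ge0// ltW.
Qed.

End numerics.

Theorem lemma7p4 (R : realType) (c0 delta0 : R) (a : int -> R) (beta : R)
    (hc0 : 0 < c0) (hdelta0 : 0 < delta0)
    (ha01 : forall i, 0 <= a i <= 1) (ha : irreducible_aperiodic_seq a)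
    (hbeta : 0 < beta < 1 / 6) :
  exists (n0 : nat) (t0 C c : R),
    [/\ 0 <= t0, 0 < C, 0 < c &
    forall (n : nat) (hn : (n0 <= n)%N)
      (d : measure_display) (T : measurableType d) (P : probability T R)
      (X : 'I_n -> {RV P >-> int})
      (hindep : mutually_independent X)
      (hlaw : forall i, law_class delta0 c0 a (distribution P (X i)))
      (t : R) (ht : t0 <= t <= n%:R `^ beta)
      (k : nat) (hk : n%:R / 3 <= (k%:R : R) <= 2 * n%:R / 3)
      (u v : R)
      (hu : 0 <= u <= 1 / 2 * t * Num.sqrt n%:R)
      (hv : 0 <= v <= 1 / 2 * t * Num.sqrt n%:R)
      (huv : (0 < P [set w | walk X u n w = v])%E),
      ((Num.min (u + 1) (Num.sqrt n%:R) * Num.min (v + 1) (Num.sqrt n%:R)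
          / (C * t * n%:R `^ (3 / 2)) * expR (- c * t ^+ 2))%:E
         <= P (excursion_event X u v t k))%E /\
      (P (excursion_event X u v t k)
         <= (C * Num.min (u + 1) (Num.sqrt n%:R)
               * Num.min (v + 1) (Num.sqrt n%:R)
               / (t * n%:R `^ (3 / 2)) * expR (- t ^+ 2 / c))%:E)%E].
Proof.
have [m0 [A [lm [l0 [lp [al [i0 [j0 [[m00 al01 i0A j0A ij] ala [sm s0 sp]
  [lmA l0A lpA] [em e0 ep]]]]]]]]]] := uniform_charge ha01 ha.
have /andP[al0 al1] := al01.
have eta01 : 0 < al ^+ m0 / 3 <= 1.
  have x0 : 0 < al ^+ m0 by rewrite exprn_gt0.
  have x1 : al ^+ m0 <= 1 by rewrite exprn_ile1// ltW.
  by apply/andP; split; lra.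
have K1 : 1 <= 1 + approx_exp_const delta0 c0.
  by rewrite lerDl /approx_exp_const addr_ge0// !mulr_ge0 ?expR_ge0// ltW.
have [C1 [c1 [N1 [t1 [n1 [C10 c10 t11 upper]]]]]] := excursion_upper hdelta0 al0 K1 eta01 m00.
have [C2 [c2 [N2 [n2 [C20 c20 lower]]]]] := excursion_lower hdelta0 al0 K1 eta01 m00.
pose N := Num.max 1 (Num.max N1 N2).
have [N_1 [NN1 NN2]] : 1 <= N /\ N1 <= N /\ N2 <= N.
  by rewrite /N !le_max !lexx ?orbT.
pose C := Num.max (C1 * (2 / c1)) c2^-1.
pose c := Num.max (2 / c1) C2.
have C0 : 0 < C by rewrite lt_max invr_gt0 c20 orbT.
have c_0 : 0 < c by rewrite lt_max C20 orbT.
exists (maxn (maxn n1 n2) (Num.truncn (N ^+ 3)).+1), t1, C, c.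
split=> //; first exact: le_trans ler01 t11.
move=> n hn d T P X hindep hlaw t /andP[tt1 tn] k /andP[nk kn] u v hu hv huv.
move: hn; rewrite !geq_max => /andP[/andP[n1n n2n] n3n].
have n0 : (0 < n)%N by apply: leq_trans n3n.
have t_1 : 1 <= t := le_trans t11 tt1.
have t_0 : 0 <= t := le_trans ler01 t_1.
have tm_0 m : 0 <= t ^+ m := exprn_ge0 m t_0.
have hk : (n <= 3 * k <= 2 * n)%N.
  clear - nk kn; rewrite -!(ler_nat R) !natrM; apply/andP; split; lra.
have kn_nat : (k <= n)%N by clear - hk; lia.
have N3n : N ^+ 3 <= n%:R.
  apply: ltW; apply: lt_le_trans (truncnS_gt _) _.
  by rewrite ler_nat.
have t6 : t ^+ 6 <= n%:R.
  by apply: (pow6_le n0 _ _ tn); [case/andP: hbeta|exact: t_0].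
have t4 : N * t ^+ 4 <= n%:R by apply: (pow4_le _ t_0 t6 N3n); exact: le_trans ler01 N_1.
have N2t : N2 * t ^+ 4 <= n%:R by apply: le_trans t4; exact: (ler_wpM2r (tm_0 4)).
have N1t : N1 * t ^+ 2 <= n%:R.
  apply: le_trans t4; apply: (@le_trans _ _ (N * t ^+ 2)).
    exact: (ler_wpM2r (tm_0 2)).
  by apply: ler_wpM2l; [exact: le_trans ler01 N_1|rewrite ler_weXn2l].
have r0 : 0 < Num.sqrt n%:R :> R by rewrite sqrtr_gt0 ltr0n.
rewrite (excursion_eventE X u v t n0 kn_nat).
pose M0 := (\max_(i <- A) absz i)%N.
pose lo := c2 * (Num.min (u + 1) (Num.sqrt n%:R) / Num.sqrt n%:R) *
  (Num.min (v + 1) (Num.sqrt n%:R) / Num.sqrt n%:R) / Num.sqrt n%:R *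
  expR (- (C2 * t ^+ 2)).
pose up := C1 * (Num.min (u + 1) (Num.sqrt n%:R) / Num.sqrt n%:R) *
  (Num.min (v + 1) (Num.sqrt n%:R) / Num.sqrt n%:R) / Num.sqrt n%:R *
  expR (- (c1 * t ^+ 2)).
have : (lo%:E <= P [set w | excursion u v (t * Num.sqrt n%:R) k (steps X w)]
    <= up%:E)%E.
  apply: (prob_of_approx hindep (M0 := M0)) => M MM0.
  have AM : {subset A <= int_range M}.
    move=> i iA; rewrite mem_int_range; apply: leq_trans MM0.
    by rewrite /M0 (big_rem _ iA) /= leq_maxl.
  have [adm1 adm2] := approx_laws_admissible hdelta0 (ltW hc0) hlaw (ltW al0)
    i0A j0A ij ala sm s0 sp lmA l0A lpA em e0 ep AM.
  split; first exact: adm1.1.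
  have szE : size (approx_laws X M) = n by rewrite size_map size_enum_ord.
  have hup := upper (approx_laws X M) u v t k adm1 adm2.
  have hlo := lower (approx_laws X M) u v t k adm1 adm2.
  rewrite szE in hup hlo; apply/andP; split.
    by apply: hlo => //; exact: reaches_approx.
  by apply: hup => //; case/andP: hv.
have u0 : 0 <= Num.min (u + 1) (Num.sqrt n%:R).
  by rewrite le_min sqrtr_ge0 andbT addr_ge0//; case/andP: hu.
have v0 : 0 <= Num.min (v + 1) (Num.sqrt n%:R).
  by rewrite le_min sqrtr_ge0 andbT addr_ge0//; case/andP: hv.
rewrite powR_three_halves => /andP[hlo hup]; split.
  apply: le_trans hlo; rewrite lee_fin; apply: lower_shape => //.
    by rewrite /C le_max lexx orbT.
  by rewrite /c le_max lexx orbT.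
apply: (le_trans hup); rewrite lee_fin; apply: (@upper_shape _ C1 c1) => //.
  by rewrite /C le_max lexx.
by rewrite /c le_max lexx.
Qed.
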